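(* Let $R$ be a commutative unitary ring. If $\mathcal{C}$ is a category with point objects then the 2-functor $\underline{\mathsf{Hom}}_{\rm point}(\mathcal{C},-)$ is representable, i.e. there is a universal homology satisfying the point axiom $H=\{H_i\}_{i\in\mathbb{Z}}:\mathcal{C}\to\mathcal{A}^{\rm point}(\mathcal{C})$, with values in an $R$-linear abelian category $\mathcal{A}^{\rm point}(\mathcal{C})$ which is a quotient of $\mathcal{A}(\mathcal{C})$. Moreover, if $F:\mathcal{C}\to\mathcal{D}$ is a functor sending point objects of $\mathcal{C}$ to point objects of $\mathcal{D}$, and $H^{\mathcal{C}}$, $H^{\mathcal{D}}$ are the universal homologies in $\mathcal{A}^{\rm point}(\mathcal{C})$ and $\mathcal{A}^{\rm point}(\mathcal{D})$ respectively, then there is a unique $R$-linear exact functor $r_F:\mathcal{A}^{\rm point}(\mathcal{C})\to\mathcal{A}^{\rm point}(\mathcal{D})$ such that $r_FH^{\mathcal{C}}=H^{\mathcal{D}}F$.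
   Context: Size: everything is relative to a fixed universe; $\mathcal{C},\mathcal{D}$ are small. $\mathsf{Ex}_R$ is the 2-category of (essentially small) $R$-linear abelian categories, $R$-linear exact functors and natural transformations; $\mathsf{Cat}$ is the 2-category of categories. A homology on $\mathcal{C}$ with values in an $R$-linear abelian category $\mathcal{A}$ is a family $\{H_i\}_{i\in\mathbb{Z}}$ of functors $H_i:\mathcal{C}\to\mathcal{A}$; morphisms are families of natural transformations; the category of these is $\underline{\mathsf{Hom}}(\mathcal{C},\mathcal{A})$, a 2-functor of $\mathcal{A}\in\mathsf{Ex}_R$ by composition. The universal homology with values in $\mathcal{A}(\mathcal{C})$ is the pair representing $\underline{\mathsf{Hom}}(\mathcal{C},-)$ (it exists). A category with point objects is a category with a chosen set of objects $\{*_k\}_{k\in I}$, called point objects. A homology $H$ satisfies the point axiom if $H_i( *_k)=0$ for all $i\neq 0$ and $k\in I$. $\underline{\mathsf{Hom}}_{\rm point}(\mathcal{C},\mathcal{A})\subseteq\underline{\mathsf{Hom}}(\mathcal{C},\mathcal{A})$ is the full subcategory of homologies satisfying the point axiom. A 2-functor $\Theta:\mathsf{Ex}_R\to\mathsf{Cat}$ is representable by $(\mathcal{A}_0,u)$, $u\in\Theta(\mathcal{A}_0)$, if $G\mapsto\Theta(G)(u)$ is an equivalence $\mathsf{Ex}_R(\mathcal{A}_0,\mathcal{A})\cong\Theta(\mathcal{A})$ natural in $\mathcal{A}$; $u$ is called universal. A quotient of an abelian category is its quotient by a thick (Serre) subcategory, i.e. one closed under subobjects, quotients and extensions. Uniqueness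 and equality of functors are understood up to natural isomorphism. *)

(* Defs.v *)
From mathcomp Require Import all_boot all_algebra.
From mathcomp Require Import boolp.

Set Implicit Arguments.
Unset Strict Implicit.
Unset Printing Implicit Defensive.

Import GRing.Theory.
Local Open Scope ring_scope.

Declare Scope cat_scope.
Delimit Scope cat_scope with cat.

(* All categories below are small with respect to one fixed universe: nothing
   is universe polymorphic, and [fun_cat] is itself a [category]. *)
Record category := Category {
  obj :> Type;
  mor : obj -> obj -> Type;
  idm : forall x, mor x x;
  mcomp : forall x y z, mor y z -> mor x y -> mor x z;
  comp1m : forall x y (f : mor x y), mcomp (idm y) f = f;
  compm1 : forall x y (f : mor x y), mcomp f (idm x) = f;
  compA : forall x y z t (h : mor z t) (g : mor y z) (f : mor x y),
    mcomp h (mcomp g f) = mcomp (mcomp h g) f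
}.

Notation "g \oc f" := (mcomp g f)
  (at level 40, left associativity) : cat_scope.
Local Open Scope cat_scope.

Section Morphisms.
Context (C : category).

Definition is_iso (x y : C) (f : mor x y) : Prop :=
  exists g : mor y x, g \oc f = idm x /\ f \oc g = idm y.

Definition isomorphic (x y : C) : Prop := exists f : mor x y, is_iso f.

Definition is_mono (x y : C) (f : mor x y) : Prop :=
  forall w (g h : mor w x), f \oc g = f \oc h -> g = h.

Definition is_epi (x y : C) (f : mor x y) : Prop :=
  forall w (g h : mor y w), g \oc f = h \oc f -> g = h.

Definition is_zero_object (z : C) : Prop :=
  forall x : C, (exists! f : mor x z, True) /\ (exists! f : mor z x, True).

End Morphisms.

Record functor (C D : category) := Functor {
  fobj :> C -> D;
  fmap : forall x y, mor x y -> mor (fobj x) (fobj y);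
  fmap1 : forall x, fmap (idm x) = idm (fobj x);
  fmapM : forall x y z (g : mor y z) (f : mor x y),
    fmap (g \oc f) = fmap g \oc fmap f
}.

Record nat_trans (C D : category) (F G : functor C D) := NatTrans {
  ntc :> forall x, mor (F x) (G x);
  ntP : forall x y (f : mor x y), ntc y \oc fmap F f = fmap G f \oc ntc x
}.

Lemma nat_trans_eq (C D : category) (F G : functor C D) (a b : nat_trans F G) :
  (forall x, a x = b x) -> a = b.
Proof.
case: a b => [a aP] [b bP] /= ab.
have ab' : a = b by apply: functional_extensionality_dep.
by subst b; congr NatTrans; apply: Prop_irrelevance.
Qed.

Section FunctorCategory.
Context (C D : category).

Definition nat_id (F : functor C D) : nat_trans F F.
Proof.
exists (fun x => idm (F x)) => x y f.
by rewrite comp1m compm1.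
Defined.

Definition nat_comp (F G H : functor C D)
  (b : nat_trans G H) (a : nat_trans F G) : nat_trans F H.
Proof.
exists (fun x => b x \oc a x) => x y f.
by rewrite -compA ntP compA ntP compA.
Defined.

Definition fun_cat : category.
Proof.
apply: (@Category (functor C D) (@nat_trans C D) nat_id nat_comp).
- by move=> F G a; apply: nat_trans_eq => x /=; apply: comp1m.
- by move=> F G a; apply: nat_trans_eq => x /=; apply: compm1.
- by move=> F G H K c b a; apply: nat_trans_eq => x /=; apply: compA.
Defined.

End FunctorCategory.

Definition id_functor (C : category) : functor C C.
Proof. by exists id (fun x y f => f). Defined.

Definition comp_functor (C D E : category)
  (G : functor D E) (F : functor C D) : functor C E.
Proof.
exists (fun x => G (F x)) (fun x y f => fmap G (fmap F f)).
- by move=> x; rewrite !fmap1.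
- by move=> x y z g f; rewrite !fmapM.
Defined.

Notation "G \of F" := (comp_functor G F)
  (at level 40, left associativity) : cat_scope.

Definition is_equivalence (C D : category) (F : functor C D) : Prop :=
  exists G : functor D C,
    isomorphic (C := fun_cat C C) (G \of F) (id_functor C) /\
    isomorphic (C := fun_cat D D) (F \of G) (id_functor D).

Definition full_sub (C : category) (P : C -> Prop) : category.
Proof.
apply: (@Category {x : C | P x} (fun x y => mor (sval x) (sval y))
  (fun x => idm (sval x)) (fun x y z g f => g \oc f)).
- by move=> x y f; apply: comp1m.
- by move=> x y f; apply: compm1.
- by move=> x y z t h g f; apply: compA.
Defined.

Definition full_sub_lift (X C : category) (P : C -> Prop) (F : functor X C)
  (FP : forall x, P (F x)) : functor X (full_sub P).
Proof.
exists (fun x => exist P (F x) (FP x) : full_sub P) (fun x y f => fmap F f).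
- by move=> x; apply: fmap1.
- by move=> x y z g f; apply: fmapM.
Defined.

Definition pow_cat (I : Type) (C : category) : category.
Proof.
apply: (@Category (I -> C) (fun x y => forall i, mor (x i) (y i))
  (fun x i => idm (x i)) (fun x y z g f i => g i \oc f i)).
- by move=> x y f; apply: functional_extensionality_dep => i; apply: comp1m.
- by move=> x y f; apply: functional_extensionality_dep => i; apply: compm1.
- move=> x y z t h g f; apply: functional_extensionality_dep => i.
  exact: compA.
Defined.

Definition nat_whiskr (C D E : category) (G G' : functor D E)
  (a : nat_trans G G') (F : functor C D) : nat_trans (G \of F) (G' \of F).
Proof.
exists (fun x => a (F x)) => x y f.
exact: (ntP a (fmap F f)).
Defined.

Definition precomp (C D E : category) (F : functor C D) :
  functor (fun_cat D E) (fun_cat C E).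
Proof.
exists (fun G : fun_cat D E => G \of F : fun_cat C E)
  (fun G G' a => nat_whiskr a F).
- by move=> G; apply: nat_trans_eq.
- by move=> G G' G'' b a; apply: nat_trans_eq.
Defined.

Definition morphism_class (C : category) := forall x y : C, mor x y -> Prop.

Definition inverts (C D : category) (W : morphism_class C)
  (F : functor C D) : Prop :=
  forall (x y : C) (f : mor x y), W x y f -> is_iso (fmap F f).

Lemma inverts_comp (C D E : category) (W : morphism_class C)
  (Q : functor C D) (G : functor D E) : inverts W Q -> inverts W (G \of Q).
Proof.
move=> QW x y f /QW[g [gf fg]]; exists (fmap G g).
by rewrite /= -!fmapM gf fg !fmap1.
Qed.

(* Restriction along Q, from all functors on the target of Q to the functors
   inverting W. *)
Definition precomp_inverting (C D E : category) (W : morphism_class C)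
  (Q : functor C D) (QW : inverts W Q) :
  functor (fun_cat D E) (full_sub (C := fun_cat C E) (@inverts C E W)) :=
  full_sub_lift (F := precomp E Q) (fun G => inverts_comp G QW).

Definition is_localization (C D : category) (W : morphism_class C)
  (Q : functor C D) : Prop :=
  exists QW : inverts W Q,
    forall E : category, is_equivalence (precomp_inverting E QW).

Record lin_category (R : comPzRingType) := LinCategory {
  lobj : Type;
  lmor : lobj -> lobj -> lmodType R;
  lidm : forall x, lmor x x;
  lcomp : forall x y z, lmor y z -> lmor x y -> lmor x z;
  lcomp1m : forall x y (f : lmor x y), lcomp (lidm y) f = f;
  lcompm1 : forall x y (f : lmor x y), lcomp f (lidm x) = f;
  lcompA : forall x y z t (h : lmor z t) (g : lmor y z) (f : lmor x y),
    lcomp h (lcomp g f) = lcomp (lcomp h g) f;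
  lcomp_linearl : forall x y z (f : lmor x y),
    linear (fun g : lmor y z => lcomp g f);
  lcomp_linearr : forall x y z (g : lmor y z),
    linear (fun f : lmor x y => lcomp g f)
}.

Definition cat_of_lin (R : comPzRingType) (A : lin_category R) : category :=
  @Category (lobj A) (fun x y => lmor x y) (@lidm R A) (@lcomp R A)
    (@lcomp1m R A) (@lcompm1 R A) (@lcompA R A).
Coercion cat_of_lin : lin_category >-> category.

Section Abelian.
Context (R : comPzRingType) (A : lin_category R).

Definition is_kernel (k x y : A) (i : mor k x) (f : mor x y) : Prop :=
  f \oc i = 0 :> lmor k y /\
  forall w (g : mor w x), f \oc g = 0 :> lmor w y ->
    exists! h : mor w k, i \oc h = g.

Definition is_cokernel (x y c : A) (q : mor y c) (f : mor x y) : Prop :=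
  q \oc f = 0 :> lmor x c /\
  forall w (g : mor y w), g \oc f = 0 :> lmor x w ->
    exists! h : mor c w, h \oc q = g.

Definition short_exact (x y z : A) (f : mor x y) (g : mor y z) : Prop :=
  is_kernel f g /\ is_cokernel g f.

Definition is_biproduct (x y s : A) (i1 : lmor x s) (i2 : lmor y s)
  (p1 : lmor s x) (p2 : lmor s y) : Prop :=
  [/\ lcomp p1 i1 = lidm x, lcomp p2 i2 = lidm y,
      lcomp p2 i1 = 0, lcomp p1 i2 = 0
    & lcomp i1 p1 + lcomp i2 p2 = lidm s].

Record is_abelian : Prop := IsAbelian {
  ab_zero : exists z : A, is_zero_object z;
  ab_biproduct : forall x y : A, exists (s : A) (i1 : lmor x s)
    (i2 : lmor y s) (p1 : lmor s x) (p2 : lmor s y), is_biproduct i1 i2 p1 p2;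
  ab_kernel : forall (x y : A) (f : mor x y),
    exists (k : A) (i : mor k x), is_kernel i f;
  ab_cokernel : forall (x y : A) (f : mor x y),
    exists (c : A) (q : mor y c), is_cokernel q f;
  ab_mono : forall (x y : A) (f : mor x y), is_mono f ->
    exists (z : A) (g : mor y z), is_kernel f g;
  ab_epi : forall (x y : A) (f : mor x y), is_epi f ->
    exists (w : A) (g : mor w x), is_cokernel f g
}.

End Abelian.

Record ab_category (R : comPzRingType) := AbCategory {
  ab_lin :> lin_category R;
  ab_abelian : is_abelian ab_lin
}.

Section ExactFunctors.
Context (R : comPzRingType).

Definition is_linear_functor (A B : lin_category R) (F : functor A B) : Prop :=
  forall x y : A,
    linear ((fun f => fmap F f) : lmor x y -> lmor (F x) (F y)).

Definition is_exact_linear (A B : ab_category R) (F : functor A B) : Prop :=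
  is_linear_functor F /\
  forall (x y z : A) (f : mor x y) (g : mor y z),
    short_exact f g -> short_exact (A := B) (fmap F f) (fmap F g).

Definition ex_cat (A B : ab_category R) : category :=
  full_sub (C := fun_cat A B) (@is_exact_linear A B).

Lemma linear_zero (U V : lmodType R) (f : U -> V) : linear f -> f 0 = 0.
Proof. by move=> /(_ (-1) 0 0); rewrite !scaleN1r !addNr. Qed.

Lemma exact_zero_object (A B : ab_category R) (F : functor A B) :
  is_exact_linear F -> forall z : A, is_zero_object z -> is_zero_object (F z).
Proof.
move=> [Flin _] z zP.
have idz : idm z = (0 : lmor z z).
  by have [[f [_ fU]] _] := zP z; rewrite -(fU (idm z)) // -(fU 0).
have id0 : lidm (F z) = 0.
  by rewrite -(linear_zero (Flin z z)) /= -idz fmap1.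
move=> x; split.
  exists (0 : lmor x (F z)); split=> // f _.
  by rewrite -[RHS](lcomp1m f) id0 (linear_zero (lcomp_linearl f)).
exists (0 : lmor (F z) x); split=> // f _.
by rewrite -[RHS](lcompm1 f) id0 (linear_zero (lcomp_linearr f)).
Qed.

End ExactFunctors.

Section Quotient.
Context (R : comPzRingType).

Record is_thick (A : ab_category R) (T : A -> Prop) : Prop := IsThick {
  thick_zero : forall z : A, is_zero_object z -> T z;
  thick_sub : forall (x y : A) (f : mor x y), is_mono f -> T y -> T x;
  thick_quo : forall (x y : A) (f : mor x y), is_epi f -> T x -> T y;
  thick_ext : forall (x y z : A) (f : mor x y) (g : mor y z),
    short_exact f g -> T x -> T z -> T y
}.

Definition iso_mod (A : ab_category R) (T : A -> Prop) : morphism_class A :=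
  fun x y f =>
    (exists (k : A) (i : mor k x), is_kernel i f /\ T k) /\
    (exists (c : A) (q : mor y c), is_cokernel q f /\ T c).

(* pi exhibits B as A/T, the localization of A at the morphisms whose kernel
   and cokernel lie in T.  The localization is taken among all categories; its
   R-linear abelian structure is pinned down by pi being R-linear and exact. *)
Definition is_quotient_by (A B : ab_category R) (T : A -> Prop)
  (pi : functor A B) : Prop :=
  is_exact_linear pi /\ is_localization (iso_mod T) pi.

Definition is_quotient (A B : ab_category R) (pi : functor A B) : Prop :=
  exists T : A -> Prop, is_thick T /\ is_quotient_by T pi.

End Quotient.

Section Homologies.
Context (R : comPzRingType).

Definition homologies (C : category) (A : ab_category R) : category :=
  pow_cat int (fun_cat C A).

Definition hlg_push (C : category) (A B : ab_category R)
  (H : homologies C A) (G : functor A B) : homologies C B :=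
  fun i => G \of H i.

Definition hlg_pull (C D : category) (F : functor C D) (A : ab_category R)
  (H : homologies D A) : homologies C A :=
  fun i => H i \of F.

Definition hlg_eval (C : category) (A0 A : ab_category R)
  (u : homologies C A0) : functor (ex_cat A0 A) (homologies C A).
Proof.
exists (fun G : ex_cat A0 A => hlg_push u (sval G))
  (fun G G' a i => nat_whiskr a (u i)).
- move=> G; apply: functional_extensionality_dep => i.
  exact: nat_trans_eq.
- move=> G G' G'' b a; apply: functional_extensionality_dep => i.
  exact: nat_trans_eq.
Defined.

(* (A0, u) represents the 2-functor A |-> homologies C A. *)
Definition universal_homology (C : category) (A0 : ab_category R)
  (u : homologies C A0) : Prop :=
  forall A : ab_category R, is_equivalence (hlg_eval A u).

End Homologies.

Record point_category := PointCategory {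
  pcat :> category;
  pidx : Type;
  pobj : pidx -> pcat
}.

Definition preserves_points (C D : point_category) (F : functor C D) : Prop :=
  forall k : pidx C, exists l : pidx D, F (pobj k) = pobj l.

Section PointHomologies.
Context (R : comPzRingType) (C : point_category).

Definition point_axiom (A : ab_category R) (H : homologies C A) : Prop :=
  forall (i : int) (k : pidx C), i != 0 -> is_zero_object (H i (pobj k)).

Definition point_homologies (A : ab_category R) : category :=
  full_sub (C := homologies C A) (@point_axiom A).

Lemma point_axiom_push (A B : ab_category R) (u : homologies C A)
  (G : ex_cat A B) : point_axiom u -> point_axiom (hlg_push u (sval G)).
Proof. by move=> uP i k /uP up; apply: exact_zero_object (svalP G) _ (up k). Qed.

Definition point_eval (A0 A : ab_category R) (u : point_homologies A0) :
  functor (ex_cat A0 A) (point_homologies A) :=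
  full_sub_lift (F := hlg_eval A (sval u))
    (fun G => point_axiom_push G (svalP u)).

(* (A0, u) represents the 2-functor A |-> point_homologies A. *)
Definition universal_point_homology (A0 : ab_category R)
  (u : point_homologies A0) : Prop :=
  forall A : ab_category R, is_equivalence (point_eval A u).

End PointHomologies.

(* Main.v *)
Require Import Defs.
From HB Require Import structures.
From mathcomp Require Import all_boot all_algebra.
From mathcomp Require Import boolp.
Import Defs.
Set Implicit Arguments.
Unset Strict Implicit.
Unset Printing Implicit Defensive.
Import GRing.Theory.
Local Open Scope ring_scope.
Local Open Scope cat_scope.

(** The universal homology is the free abelian category on the objects (i, x),
    i an integer and x in C. It is reached in two steps. The free R-linear
    additive category consists of formal expressions in the operations of such a
    category, identified when they agree under every homology, so that its
    axioms and its universal property hold at once. Adelman's category then adds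
    kernels and cokernels: its objects are pairs of composable arrows
    X0 -> X1 -> X2, standing for the image of ker (X1 -> X2) in
    coker (X0 -> X1), and kernels, cokernels and the normality of monos and
    epis are given by explicit block matrices. An additive functor to an abelian
    category extends to the exact functor that forms these images, and a
    transformation extends because each object is the image of the canonical map
    from a kernel to a cokernel.

    The point axiom is then forced by passing to the quotient by the thick
    subcategory generated by the objects H_i( *_k ), i <> 0, with roofs as
    morphisms: exact functors on the quotient are the exact functors that kill
    these objects. *)

(** * Equivalences of categories *)

(** Formal expressions, Adelman's ladder maps and roofs each become morphisms only after an
    identification; all three pass through one construction, starting from hom-sets that are modules
    up to a relation. The congruence on expressions quantifies over all homologies in all abelian
    categories; being a proposition, it does not raise the universe. Sums and composites of roofs
    depend on chosen Ore squares. A roof is therefore handled through the relation [gr r a b], read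
    as [r \ol a = b] in the quotient, which is functional up to refinement, so that identities are
    checked at a common denominator and the choices drop out. A quotient has to be a localization
    among all categories, so functors are lifted for an arbitrary target and exactness of the lift
    is recovered afterwards. Moreover the quotient statement concerns every universal homology while
    its target is fixed in advance; universal objects are unique only up to equivalence, so
    localizations must be carried along equivalences. *)

Section Isomorphisms.
Context (C : category).

Lemma iso_id (x : C) : is_iso (idm x).
Proof. by exists (idm x); rewrite comp1m. Qed.

Lemma iso_comp (x y z : C) (g : mor y z) (f : mor x y) :
  is_iso g -> is_iso f -> is_iso (g \oc f).
Proof.
move=> [g' [g'g gg']] [f' [f'f ff']]; exists (f' \oc g'); split.
  by rewrite -compA [g' \oc _]compA g'g comp1m.
by rewrite -compA [f \oc _]compA ff' comp1m.
Qed.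

Lemma iso_epi (x y : C) (f : mor x y) : is_iso f -> is_epi f.
Proof.
move=> [f' [_ ff']] w g h E.
by rewrite -[g]compm1 -[h]compm1 -ff' !compA E.
Qed.

Lemma iso_mono (x y : C) (f : mor x y) : is_iso f -> is_mono f.
Proof.
move=> [f' [f'f _]] w g h E.
by rewrite -[g]comp1m -[h]comp1m -f'f -!compA E.
Qed.

Lemma isomorphic_sym (x y : C) : isomorphic x y -> isomorphic y x.
Proof. by move=> [f [g [gf fg]]]; exists g, f. Qed.

Lemma isomorphic_trans (y x z : C) :
  isomorphic x y -> isomorphic y z -> isomorphic x z.
Proof. by move=> [f fi] [g gi]; exists (g \oc f); apply: iso_comp. Qed.

End Isomorphisms.

Lemma functor_iso (C D : category) (F : functor C D) (x y : C) (f : mor x y) :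
  is_iso f -> is_iso (fmap F f).
Proof. by move=> [g [gf fg]]; exists (fmap F g); rewrite -!fmapM gf fg !fmap1. Qed.

Section Equivalences.
Context (C D : category) (F : functor C D).

Definition faithful := forall (x y : C) (f g : mor x y),
  fmap F f = fmap F g -> f = g.

Definition full := forall (x y : C) (g : mor (F x) (F y)),
  exists f, fmap F f = g.

Definition ess_surjective := forall y : D, exists x : C, isomorphic (F x) y.

Lemma ff_iso (x y : C) (f : mor x y) :
  faithful -> full -> is_iso (fmap F f) -> is_iso f.
Proof.
move=> Ffa Ffu [g [gf fg]]; have [g' g'E] := Ffu _ _ g.
by exists g'; split; apply: Ffa; rewrite fmapM g'E fmap1.
Qed.

Lemma ff_isomorphic (x y : C) :
  faithful -> full -> isomorphic (F x) (F y) -> isomorphic x y.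
Proof.
move=> Ffa Ffu [g gi]; have [f fE] := Ffu _ _ g.
by exists f; apply: ff_iso => //; rewrite fE.
Qed.

End Equivalences.

Lemma nat_iso (C D : category) (F G : functor C D) (a : nat_trans F G) :
  (forall x, is_iso (a x)) -> is_iso (C := fun_cat C D) (a : mor (c := fun_cat C D) F G).
Proof.
move=> ai; pose b x := sval (cid (ai x)).
have bP x : b x \oc a x = idm _ /\ a x \oc b x = idm _ by apply: svalP (cid (ai x)).
have bN x y (f : mor x y) : b y \oc fmap G f = fmap F f \oc b x.
  apply: iso_mono (ai y) _ _ _ _; rewrite !compA (bP y).2 comp1m ntP.
  by rewrite -compA (bP x).2 compm1.
exists (NatTrans bN); split; apply: nat_trans_eq => x; [exact: (bP x).1|exact: (bP x).2].
Qed.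

Lemma nat_isomorphic (C D : category) (F G : functor C D)
    (c : forall x, mor (F x) (G x)) :
  (forall x y (f : mor x y), c y \oc fmap F f = fmap G f \oc c x) ->
  (forall x, is_iso (c x)) -> isomorphic (C := fun_cat C D) F G.
Proof. by move=> cN ci; exists (NatTrans cN); apply: nat_iso. Qed.

Lemma nat_iso_at (C D : category) (F G : fun_cat C D) (a : mor F G) :
  is_iso a -> forall x, is_iso (ntc a x).
Proof.
move=> [b [ba ab]] x; exists (b x).
by split; [have /= := congr1 (@ntc _ _ _ _ ^~ x) ba|have /= := congr1
  (@ntc _ _ _ _ ^~ x) ab].
Qed.

Lemma pow_iso (I : Type) (C : category) (x y : pow_cat I C) (f : mor x y) :
  (forall i, is_iso (f i)) -> is_iso f.
Proof.
move=> fi; exists (fun i => sval (cid (fi i))).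
by split; apply: functional_extensionality_dep => i; have [] := svalP (cid (fi i)).
Qed.

Lemma pow_iso_at (I : Type) (C : category) (x y : pow_cat I C) (f : mor x y) :
  is_iso f -> forall i, is_iso (f i).
Proof.
move=> [g [gf fg]] i; exists (g i).
by split; [have := congr1 (@^~ i) gf|have := congr1 (@^~ i) fg].
Qed.

Lemma full_sub_isomorphic (C : category) (P : C -> Prop) (x y : full_sub P) :
  isomorphic x y <-> isomorphic (sval x) (sval y).
Proof. by []. Qed.

(** The quasi-inverse chooses for each [y] a preimage [o y] with an isomorphism [e y], and
    conjugates morphisms by the [e y]. Functoriality and naturality are checked after applying the
    faithful [F] and cancelling [e]. *)
Lemma equivalence_of_ff (C D : category) (F : functor C D) :
  faithful F -> full F -> ess_surjective F -> is_equivalence F.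
Proof.
move=> Ffa Ffu Fes.
pose o y := sval (cid (Fes y)).
have oP y : isomorphic (F (o y)) y by apply: svalP (cid (Fes y)).
pose e y : mor (F (o y)) y := sval (cid (oP y)).
have ei y : is_iso (e y) by apply: svalP (cid (oP y)).
have ex y z (g : mor y z) : exists f : mor (o y) (o z), e z \oc fmap F f = g \oc e y.
  have [e' [_ ee']] := ei z; have [f fE] := Ffu _ _ (e' \oc (g \oc e y)).
  by exists f; rewrite fE compA ee' comp1m.
pose m y z (g : mor y z) := sval (cid (ex y z g)).
have mP y z g : e z \oc fmap F (m y z g) = g \oc e y by apply: svalP (cid (ex y z g)).
have m1 y : m _ _ (idm y) = idm (o y).
  by apply/Ffa/(iso_mono (ei y)); rewrite mP fmap1 comp1m compm1.
have mM x y z (g : mor y z) (f : mor x y) : m _ _ (g \oc f) = m _ _ g \oc m _ _ f.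
  by apply/Ffa/(iso_mono (ei z)); rewrite mP fmapM compA mP -!compA mP.
pose G := @Functor D C o m m1 mM; exists G; split.
  pose n x : mor (o (F x)) x := sval (cid (Ffu _ _ (e (F x)))).
  have nE x : fmap F (n x) = e (F x) by apply: svalP (cid (Ffu _ _ (e (F x)))).
  have nN x y (f : mor x y) : n y \oc fmap (G \of F) f = fmap (id_functor C) f \oc n x.
    by apply: Ffa; rewrite !fmapM !nE mP.
  apply: (@nat_isomorphic _ _ (G \of F) (id_functor C) n nN) => x;
    apply: (ff_iso Ffa (Ffu)) => /=.
  by rewrite nE.
have eN y z (g : mor y z) : e z \oc fmap (F \of G) g = fmap (id_functor D) g \oc e y by
    rewrite mP.
exact: (@nat_isomorphic _ _ (F \of G) (id_functor D) e eN).
Qed.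

Lemma faithful_retract (C D : category) (F : functor C D) (G : functor D C) :
  isomorphic (C := fun_cat C C) (G \of F) (id_functor C) -> faithful F.
Proof.
move=> [n /nat_iso_at ni] x y f g E.
apply: iso_epi (ni x) _ _ _ _.
have /= nf := ntP n f; have /= ng := ntP n g.
by rewrite -nf -ng E.
Qed.

(** For fullness, a preimage of [g] is [fmap G g] conjugated by the isomorphism [n] from [G \of F]
    to the identity; that it maps to [g] is tested after applying [G], itself faithful because
    [F \of G] is isomorphic to the identity. *)
Lemma ff_of_equivalence (C D : category) (F : functor C D) :
  is_equivalence F -> [/\ faithful F, full F & ess_surjective F].
Proof.
move=> [G [GF FG]]; have Ffa := faithful_retract GF; have Gfa := faithful_retract FG.
split=> //; last first.
  by move=> y; exists (G y); case: FG => n /nat_iso_at ni; exists (ntc n y); apply: ni.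
move=> x y g; case: GF => n /nat_iso_at ni; have [n' [n'n nn']] := ni x.
pose f : mor x y := ntc n y \oc (fmap G g \oc n'); exists f.
apply: Gfa; apply: iso_mono (ni y) _ _ _ _.
have /= -> := ntP n f.
by rewrite /f -!compA n'n compm1.
Qed.

(** * Linear and abelian categories *)

Notation "g \ol f" := (lcomp g f) (at level 40, left associativity) : cat_scope.

Section LinearCalculus.
Context (R : comPzRingType) (A : lin_category R).
Implicit Types x y z w : lobj A.

Lemma lcompDl x y z (g h : lmor y z) (f : lmor x y) : (g + h) \ol f = g \ol f + h \ol f.
Proof. by have := lcomp_linearl f 1 g h; rewrite !scale1r. Qed.

Lemma lcompDr x y z (g : lmor y z) (f h : lmor x y) : g \ol (f + h) = g \ol f + g \ol h.
Proof. by have := lcomp_linearr g 1 f h; rewrite !scale1r. Qed.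

Lemma lcomp0l x y z (f : lmor x y) : (0 : lmor y z) \ol f = 0.
Proof. exact: linear_zero (lcomp_linearl f). Qed.

Lemma lcomp0r x y z (g : lmor y z) : g \ol (0 : lmor x y) = 0.
Proof. exact: linear_zero (lcomp_linearr g). Qed.

Lemma lcompZl x y z a (g : lmor y z) (f : lmor x y) : (a *: g) \ol f = a *: (g \ol f).
Proof. by have := lcomp_linearl f a g 0; rewrite !addr0 lcomp0l addr0. Qed.

Lemma lcompZr x y z a (g : lmor y z) (f : lmor x y) : g \ol (a *: f) = a *: (g \ol f).
Proof. by have := lcomp_linearr g a f 0; rewrite !addr0 lcomp0r addr0. Qed.

Lemma lcompNl x y z (g : lmor y z) (f : lmor x y) : (- g) \ol f = - (g \ol f).
Proof. by rewrite -!scaleN1r lcompZl. Qed.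

Lemma lcompNr x y z (g : lmor y z) (f : lmor x y) : g \ol (- f) = - (g \ol f).
Proof. by rewrite -!scaleN1r lcompZr. Qed.

Lemma lcompBl x y z (g h : lmor y z) (f : lmor x y) : (g - h) \ol f = g \ol f - h \ol f.
Proof. by rewrite lcompDl lcompNl. Qed.

Lemma lcompBr x y z (g : lmor y z) (f h : lmor x y) : g \ol (f - h) = g \ol f - g \ol h.
Proof. by rewrite lcompDr lcompNr. Qed.

Definition monic x y (f : lmor x y) := forall w (g : lmor w x), f \ol g = 0 -> g = 0.
Definition epic x y (f : lmor x y) := forall w (g : lmor y w), g \ol f = 0 -> g = 0.

Lemma monic_eq x y (f : lmor x y) w (g h : lmor w x) : monic f -> f \ol g = f \ol h -> g
    = h.
Proof. by move=> fm E; apply/eqP; rewrite -subr_eq0; apply/eqP/fm; rewrite lcompBr E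
  subrr. Qed.

Lemma epic_eq x y (f : lmor x y) w (g h : lmor y w) : epic f -> g \ol f = h \ol f -> g
    = h.
Proof. by move=> fm E; apply/eqP; rewrite -subr_eq0; apply/eqP/fm; rewrite lcompBl E
  subrr. Qed.

Lemma monoP x y (f : lmor x y) : is_mono (C := A) f <-> monic f.
Proof.
split=> [fm w g E | fm w g h]; last exact: monic_eq.
by apply: fm => /=; rewrite E lcomp0r.
Qed.

Lemma epiP x y (f : lmor x y) : is_epi (C := A) f <-> epic f.
Proof.
split=> [fm w g E | fm w g h]; last exact: epic_eq.
by apply: fm => /=; rewrite E lcomp0l.
Qed.

(** In a linear category, uniqueness of the factorization amounts to [i] being monic, which is
    tested against zero only. *)
Definition kernel k x y (i : lmor k x) (f : lmor x y) :=
  [/\ f \ol i = 0, monic i & forall w (g : lmor w x), f \ol g = 0 -> exists h, i \ol h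
    = g].
Definition cokernel x y c (q : lmor y c) (f : lmor x y) :=
  [/\ q \ol f = 0, epic q & forall w (g : lmor y w), g \ol f = 0 -> exists h, h \ol q
    = g].

Lemma kernelP k x y (i : lmor k x) (f : lmor x y) : is_kernel (A := A) i f <-> kernel i f.
Proof.
split=> [[/= fi iU] | [fi im il]].
  split=> // [w g ig | w g /iU[h [hE _]]]; last by exists h.
  have [|h [_ hU]] := iU w (i \ol g); first by rewrite /= lcompA fi lcomp0l.
  by rewrite -(hU g) // (hU 0) //= lcomp0r ig.
split=> // w g /il[h hE]; exists h; split=> // h' h'E.
by apply: monic_eq im _; rewrite hE.
Qed.

Lemma cokernelP x y c (q : lmor y c) (f : lmor x y) : is_cokernel (A := A) q f <->
    cokernel q f.
Proof.
split=> [[/= fi iU] | [fi im il]].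
  split=> // [w g ig | w g /iU[h [hE _]]]; last by exists h.
  have [|h [_ hU]] := iU w (g \ol q); first by rewrite /= -lcompA fi lcomp0r.
  by rewrite -(hU g) // (hU 0) //= lcomp0l ig.
split=> // w g /il[h hE]; exists h; split=> // h' h'E.
by apply: epic_eq im _; rewrite hE.
Qed.

Lemma monic_comp x y z (g : lmor y z) (f : lmor x y) : monic g -> monic f -> monic
    (g \ol f).
Proof. by move=> gm fm w h; rewrite -lcompA => /gm/fm. Qed.

Lemma epic_comp x y z (g : lmor y z) (f : lmor x y) : epic g -> epic f -> epic (g \ol f).
Proof. by move=> gm fm w h; rewrite lcompA => /fm/gm. Qed.

Lemma monic_cancel x y z (g : lmor y z) (f : lmor x y) : monic (g \ol f) -> monic f.
Proof. by move=> gfm w h E; apply: gfm; rewrite -lcompA E lcomp0r. Qed.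

Lemma epic_cancel x y z (g : lmor y z) (f : lmor x y) : epic (g \ol f) -> epic g.
Proof. by move=> gfm w h E; apply: gfm; rewrite lcompA E lcomp0l. Qed.

Lemma epic_id x : epic (lidm x).
Proof. by move=> w h; rewrite lcompm1. Qed.

Lemma monic_id x : monic (lidm x).
Proof. by move=> w h; rewrite lcomp1m. Qed.

Lemma iso_monic x y (f : lmor x y) : is_iso (C := A) f -> monic f.
Proof. by move=> /iso_mono/monoP. Qed.

Lemma iso_epic x y (f : lmor x y) : is_iso (C := A) f -> epic f.
Proof. by move=> /iso_epi/epiP. Qed.

Lemma zero_objectP x : is_zero_object (C := A) x <-> lidm x = 0.
Proof.
split=> [/(_ x)[[f [_ fU]] _] | x0 y]; first by rewrite -(fU (lidm x)) // -(fU 0).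
split.
  exists (0 : lmor y x); split=> // f _.
  by rewrite -[RHS](lcomp1m f) x0 lcomp0l.
exists (0 : lmor x y); split=> // f _.
by rewrite -[RHS](lcompm1 f) x0 lcomp0r.
Qed.

Lemma from_zero x y (f : lmor x y) : lidm x = 0 -> f = 0.
Proof. by move=> x0; rewrite -[f]lcompm1 x0 lcomp0r. Qed.

Lemma to_zero x y (f : lmor y x) : lidm x = 0 -> f = 0.
Proof. by move=> x0; rewrite -[f]lcomp1m x0 lcomp0l. Qed.

Lemma zero_isomorphic x y : lidm x = 0 -> isomorphic (C := A) x y -> lidm y = 0.
Proof. by move=> x0 [f [g [_ /= <-]]]; rewrite -[f]lcompm1 x0 lcomp0r lcomp0l. Qed.

End LinearCalculus.

(** * Duality *)

Section Opposite.
Context (R : comPzRingType).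

(** [kernel] and [monic] for the opposite category are [cokernel] and [epic] by conversion, so dual
    statements follow by instantiation. *)
Definition lin_op (A : lin_category R) : lin_category R :=
  @LinCategory R (lobj A) (fun x y => lmor y x) (@lidm R A)
    (fun x y z g f => f \ol g) (fun x y f => lcompm1 f) (fun x y f => lcomp1m f)
    (fun x y z t h g f => esym (lcompA f g h))
    (fun x y z f => lcomp_linearr f) (fun x y z g => lcomp_linearl g).

Lemma ab_op_abelian (A : ab_category R) : is_abelian (lin_op A).
Proof.
have [[z z0] bi ke co mo ep] := ab_abelian A; split.
- by exists z => x; have [] := z0 x.
- move=> x y; have [s [i1 [i2 [p1 [p2 [? ? ? ? ?]]]]]] := bi x y.
  by exists s, p1, p2, i1, i2; split.
- by move=> x y f; have [c [q [qf qU]]] := co _ _ f; exists c, q; split.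
- by move=> x y f; have [c [q [qf qU]]] := ke _ _ f; exists c, q; split.
- move=> x y f fm; have [|z' [g [gf gU]]] := ep _ _ f; first exact: fm.
  by exists z', g; split.
- move=> x y f fm; have [|z' [g [gf gU]]] := mo _ _ f; first exact: fm.
  by exists z', g; split.
Qed.

Definition ab_op (A : ab_category R) : ab_category R := AbCategory (ab_op_abelian A).

End Opposite.

(** * Quotients of linear categories *)

(** The hom-sets before identification: the module axioms hold up to [pm_eq] only, and the negative
    is the multiple by [- 1]. *)
Record pre_module (R : comPzRingType) := PreModule {
  pm_sort :> Type;
  pm_eq : pm_sort -> pm_sort -> Prop;
  pm_zero : pm_sort;
  pm_add : pm_sort -> pm_sort -> pm_sort;
  pm_scale : R -> pm_sort -> pm_sort;
  pm_refl : forall u, pm_eq u u;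
  pm_sym : forall u v, pm_eq u v -> pm_eq v u;
  pm_trans : forall u v w, pm_eq u v -> pm_eq v w -> pm_eq u w;
  pm_addE : forall u u' v v',
    pm_eq u u' -> pm_eq v v' -> pm_eq (pm_add u v) (pm_add u' v');
  pm_scaleE : forall a u u', pm_eq u u' -> pm_eq (pm_scale a u) (pm_scale a u');
  pm_addA : forall u v w,
    pm_eq (pm_add u (pm_add v w)) (pm_add (pm_add u v) w);
  pm_addC : forall u v, pm_eq (pm_add u v) (pm_add v u);
  pm_add0 : forall u, pm_eq (pm_add pm_zero u) u;
  pm_addN : forall u, pm_eq (pm_add (pm_scale (- 1) u) u) pm_zero;
  pm_scaleA : forall a b u,
    pm_eq (pm_scale a (pm_scale b u)) (pm_scale (a * b) u);
  pm_scale1 : forall u, pm_eq (pm_scale 1 u) u;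
  pm_scaleDr : forall a u v,
    pm_eq (pm_scale a (pm_add u v)) (pm_add (pm_scale a u) (pm_scale a v));
  pm_scaleDl : forall u a b,
    pm_eq (pm_scale (a + b) u) (pm_add (pm_scale a u) (pm_scale b u))
}.

Section QuotientModule.
Context (R : comPzRingType) (M : pre_module R).

(** A class is the predicate of its members. Extensionality of predicates turns [pm_eq] into
    equality, and representatives are extracted by choice. *)
Definition pm_quo : Type := {P : M -> Prop | exists u, P = pm_eq u}.

Definition pm_pi (u : M) : pm_quo :=
  exist _ (pm_eq u) (ex_intro _ u erefl).

Definition pm_repr (c : pm_quo) : M := sval (cid (svalP c)).

Lemma pm_reprK c : pm_pi (pm_repr c) = c.
Proof.
rewrite /pm_repr; case: cid => u /=; case: c => P Pu /= E.
exact/esym/eq_exist.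
Qed.

Lemma pm_piP u v : pm_pi u = pm_pi v <-> pm_eq u v.
Proof.
split=> [/(congr1 sval)/= E | uv]; first by rewrite E; apply: pm_refl.
apply: eq_exist; apply: functional_extensionality_dep => w; apply: propext.
by split; apply: pm_trans => //; apply: pm_sym.
Qed.

Lemma pm_repr_pi u : pm_eq (pm_repr (pm_pi u)) u.
Proof. by apply/pm_piP; rewrite pm_reprK. Qed.

Definition quo_zero : pm_quo := pm_pi (pm_zero M).
Definition quo_add (c d : pm_quo) := pm_pi (pm_add (pm_repr c) (pm_repr d)).
Definition quo_scale (a : R) (c : pm_quo) := pm_pi (pm_scale a (pm_repr c)).

Lemma quo_add_pi u v : quo_add (pm_pi u) (pm_pi v) = pm_pi (pm_add u v).
Proof. by apply/pm_piP/pm_addE; apply: pm_repr_pi. Qed.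

Lemma quo_scale_pi a u : quo_scale a (pm_pi u) = pm_pi (pm_scale a u).
Proof. by apply/pm_piP/pm_scaleE; apply: pm_repr_pi. Qed.

Let ind (P : pm_quo -> Prop) : (forall u, P (pm_pi u)) -> forall c, P c.
Proof. by move=> Ppi c; rewrite -[c]pm_reprK. Qed.

Let quoE := (quo_add_pi, quo_scale_pi).

Fact quo_addA : associative quo_add.
Proof.
elim/ind=> u; elim/ind=> v; elim/ind=> w; rewrite !quoE.
exact/pm_piP/pm_addA.
Qed.

Fact quo_addC : commutative quo_add.
Proof. by elim/ind=> u; elim/ind=> v; rewrite !quoE; apply/pm_piP/pm_addC. Qed.

Fact quo_add0 : left_id quo_zero quo_add.
Proof. by elim/ind=> u; rewrite /quo_zero !quoE; apply/pm_piP/pm_add0. Qed.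

Fact quo_addN : left_inverse quo_zero (quo_scale (- 1)) quo_add.
Proof. by elim/ind=> u; rewrite /quo_zero !quoE; apply/pm_piP/pm_addN. Qed.

HB.instance Definition _ := gen_eqMixin pm_quo.
HB.instance Definition _ := gen_choiceMixin pm_quo.
HB.instance Definition _ :=
  GRing.isZmodule.Build pm_quo quo_addA quo_addC quo_add0 quo_addN.

Fact quo_scaleA a b (c : pm_quo) :
  quo_scale a (quo_scale b c) = quo_scale (a * b) c.
Proof. by elim/ind: c => u; rewrite !quoE; apply/pm_piP/pm_scaleA. Qed.

Fact quo_scale1 : left_id 1 quo_scale.
Proof. by elim/ind=> u; rewrite !quoE; apply/pm_piP/pm_scale1. Qed.

Fact quo_scaleDr : right_distributive quo_scale +%R.
Proof.
move=> a; elim/ind=> u; elim/ind=> v; rewrite /GRing.add /= !quoE.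
exact/pm_piP/pm_scaleDr.
Qed.

Fact quo_scaleDl (c : pm_quo) : {morph quo_scale^~ c : a b / a + b}.
Proof.
elim/ind: c => u a b; rewrite [RHS]/GRing.add /= !quoE.
exact/pm_piP/pm_scaleDl.
Qed.

HB.instance Definition _ := GRing.Zmodule_isLmodule.Build R pm_quo
  quo_scaleA quo_scale1 quo_scaleDr quo_scaleDl.

Definition quo_module : lmodType R := pm_quo.

Definition quo_pi (u : M) : quo_module := pm_pi u.

Lemma quo_pi_onto (c : quo_module) : exists u, c = quo_pi u.
Proof. by exists (pm_repr c); rewrite /quo_pi pm_reprK. Qed.

Lemma quo_pi_eq u v : quo_pi u = quo_pi v <-> pm_eq u v.
Proof. exact: pm_piP. Qed.

Lemma quo_piD u v : quo_pi (pm_add u v) = quo_pi u + quo_pi v.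
Proof. by rewrite /quo_pi -quo_add_pi. Qed.

Lemma quo_piZ a u : quo_pi (pm_scale a u) = a *: quo_pi u.
Proof. by rewrite /quo_pi -quo_scale_pi. Qed.

Lemma quo_pi0 : quo_pi (pm_zero M) = 0.
Proof. by []. Qed.

End QuotientModule.

Record pre_lin (R : comPzRingType) := PreLin {
  pl_obj : Type;
  pl_mor : pl_obj -> pl_obj -> pre_module R;
  pl_id : forall x, pl_mor x x;
  pl_comp : forall x y z, pl_mor y z -> pl_mor x y -> pl_mor x z;
  pl_compE : forall x y z (g g' : pl_mor y z) (f f' : pl_mor x y),
    pm_eq g g' -> pm_eq f f' -> pm_eq (pl_comp g f) (pl_comp g' f');
  pl_comp1m : forall x y (f : pl_mor x y), pm_eq (pl_comp (pl_id y) f) f;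
  pl_compm1 : forall x y (f : pl_mor x y), pm_eq (pl_comp f (pl_id x)) f;
  pl_compA : forall x y z t
    (h : pl_mor z t) (g : pl_mor y z) (f : pl_mor x y),
    pm_eq (pl_comp h (pl_comp g f)) (pl_comp (pl_comp h g) f);
  pl_linl : forall x y z (f : pl_mor x y) a (g g' : pl_mor y z),
    pm_eq (pl_comp (pm_add (pm_scale a g) g') f)
      (pm_add (pm_scale a (pl_comp g f)) (pl_comp g' f));
  pl_linr : forall x y z (g : pl_mor y z) a (f f' : pl_mor x y),
    pm_eq (pl_comp g (pm_add (pm_scale a f) f'))
      (pm_add (pm_scale a (pl_comp g f)) (pl_comp g f'))
}.

Section QuotientCategory.
Context (R : comPzRingType) (P : pre_lin R).

Definition ql_id (x : pl_obj P) : quo_module (pl_mor x x) := quo_pi (pl_id x).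

Definition ql_comp (x y z : pl_obj P) (g : quo_module (pl_mor y z))
  (f : quo_module (pl_mor x y)) : quo_module (pl_mor x z) :=
  quo_pi (pl_comp (pm_repr g) (pm_repr f)).

Lemma ql_comp_pi (x y z : pl_obj P) (g : pl_mor y z) (f : pl_mor x y) :
  ql_comp (quo_pi g) (quo_pi f) = quo_pi (pl_comp g f).
Proof. by apply/quo_pi_eq/pl_compE; apply: pm_repr_pi. Qed.

Definition quo_lin : lin_category R.
Proof.
apply: (@LinCategory R (pl_obj P) (fun x y => quo_module (pl_mor x y))
  ql_id ql_comp).
- move=> x y f; have [{}f ->] := quo_pi_onto f.
  by rewrite ql_comp_pi; apply/quo_pi_eq/pl_comp1m.
- move=> x y f; have [{}f ->] := quo_pi_onto f.
  by rewrite ql_comp_pi; apply/quo_pi_eq/pl_compm1.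
- move=> x y z t h g f; have [{}f ->] := quo_pi_onto f.
  have [{}g ->] := quo_pi_onto g; have [{}h ->] := quo_pi_onto h.
  by rewrite !ql_comp_pi; apply/quo_pi_eq/pl_compA.
- move=> x y z f a g g'; have [{}f ->] := quo_pi_onto f.
  have [{}g ->] := quo_pi_onto g; have [{}g' ->] := quo_pi_onto g'.
  rewrite -quo_piZ -quo_piD !ql_comp_pi -quo_piZ -quo_piD.
  exact/quo_pi_eq/pl_linl.
- move=> x y z g a f f'; have [{}f ->] := quo_pi_onto f.
  have [{}g ->] := quo_pi_onto g; have [{}f' ->] := quo_pi_onto f'.
  rewrite -quo_piZ -quo_piD !ql_comp_pi -quo_piZ -quo_piD.
  exact/quo_pi_eq/pl_linr.
Defined.

Definition qmor (x y : pl_obj P) (f : pl_mor x y) :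
  lmor (l := quo_lin) x y := quo_pi f.

Lemma qmor_onto (x y : pl_obj P) (f : lmor (l := quo_lin) x y) :
  exists f0, f = qmor f0.
Proof. exact: quo_pi_onto. Qed.

Lemma qmor_eq (x y : pl_obj P) (f g : pl_mor x y) :
  qmor f = qmor g <-> pm_eq f g.
Proof. exact: quo_pi_eq. Qed.

Lemma qmorM (x y z : pl_obj P) (g : pl_mor y z) (f : pl_mor x y) :
  qmor (pl_comp g f) = lcomp (qmor g) (qmor f).
Proof. by rewrite /= ql_comp_pi. Qed.

Lemma qmorD (x y : pl_obj P) (f g : pl_mor x y) :
  qmor (pm_add f g) = qmor f + qmor g.
Proof. exact: quo_piD. Qed.

Lemma qmorZ (x y : pl_obj P) a (f : pl_mor x y) :
  qmor (pm_scale a f) = a *: qmor f.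
Proof. exact: quo_piZ. Qed.

Lemma qmor0 (x y : pl_obj P) : qmor (pm_zero (pl_mor x y)) = 0.
Proof. exact: quo_pi0. Qed.

End QuotientCategory.

(** * Diagram chasing *)

Section AbelianToolbox.
Context (R : comPzRingType).

Lemma ex_kernel (A : ab_category R) (x y : lobj A) (f : lmor x y) :
  exists k (i : lmor k x), kernel i f.
Proof. by have [k [i /kernelP]] := ab_kernel (ab_abelian A) f; exists k, i. Qed.

Lemma ex_cokernel (A : ab_category R) (x y : lobj A) (f : lmor x y) :
  exists c (q : lmor y c), cokernel q f.
Proof. by have [k [i /cokernelP]] := ab_cokernel (ab_abelian A) f; exists k, i. Qed.

(** [f] is the kernel of some [g], and [g] factors through the cokernel [q]; so whatever [q] kills
    is killed by [g]. *)
Lemma monic_kernel (A : ab_category R) (x y c : lobj A) (f : lmor x y) (q : lmor y c) :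
  monic f -> cokernel q f -> kernel f q.
Proof.
move=> fm [qf qe qU]; split=> // w v qv.
have [z [g /kernelP[gf _ gU]]] := ab_mono (ab_abelian A) ((monoP f).2 fm).
by have [h hE] := qU _ g gf; apply: gU; rewrite -hE -lcompA qv lcomp0r.
Qed.

Lemma epic_cokernel (A : ab_category R) (k x y : lobj A) (f : lmor x y) (i : lmor k x) :
  epic f -> kernel i f -> cokernel f i.
Proof. exact: (@monic_kernel (ab_op A)). Qed.

Lemma monic_epic_iso (A : ab_category R) (x y : lobj A) (f : lmor x y) :
  monic f -> epic f -> is_iso (C := A) f.
Proof.
move=> fm fe; have [c [q qf]] := ex_cokernel f.
have [_ _ fU] := monic_kernel fm qf.
have [|g gE] := fU _ (lidm y).
  by rewrite lcompm1; case: qf => /fe.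
exists g; split=> //=; apply: (monic_eq fm).
by rewrite lcompA gE lcomp1m lcompm1.
Qed.

(** The image [m] is the kernel of the cokernel [q] of [f]. To see that [e] is epic, let
    [g \ol e = 0] and [i] be the kernel of [g]. The monic [m \ol i] is the kernel of its cokernel
    [r]; [r] kills [f], hence factors through [q] and kills [m]. So [m] factors through [m \ol i],
    the map [i] has a right inverse, and [g = 0]. *)
Lemma epi_mono_factor (A : ab_category R) (x y : lobj A) (f : lmor x y) :
  exists z (e : lmor x z) (m : lmor z y), [/\ epic e, monic m & f = m \ol e].
Proof.
have [c [q [qf qe qU]]] := ex_cokernel f.
have [z [m [qm mm mU]]] := ex_kernel q.
have [e eE] := mU _ _ qf; exists z, e, m; split=> // w g ge.
have [k [i [gi im iU]]] := ex_kernel g.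
have [e' e'E] := iU _ _ ge.
have [d [r [rmi re rU]]] := ex_cokernel (m \ol i).
have [|r' r'E] := qU _ r; first by rewrite -eE -e'E !lcompA -[r \ol m \ol i]lcompA rmi
  lcomp0l.
have [_ _ miU] := monic_kernel (monic_comp mm im) (And3 rmi re rU).
have [|j jE] := miU _ m; first by rewrite -r'E -lcompA qm lcomp0r.
have ij : i \ol j = lidm z by apply: (monic_eq mm); rewrite lcompA jE lcompm1.
by rewrite -[g]lcompm1 -ij lcompA gi lcomp0l.
Qed.

(** The pullback is the kernel [j] of [h = f \ol p1 - g \ol p2]. As [h] restricts to [f] on the
    first summand it is epic, hence the cokernel of [j]. If [k] kills [p2 \ol j], then [k \ol p2] is
    some [u \ol h]; restriction to the first summand gives [u \ol f = 0], so [u] and then [k]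
    vanish. *)
Lemma pullback_epic (A : ab_category R) (x y z : lobj A) (f : lmor x z) (g : lmor y z) :
  epic f -> exists w (e : lmor w y) (u : lmor w x), epic e /\ f \ol u = g \ol e.
Proof.
move=> fe.
have [s [i1 [i2 [p1 [p2 [p11 p22 p21 p12 ip]]]]]] := ab_biproduct (ab_abelian A) x y.
pose h := f \ol p1 - g \ol p2.
have hi1 : h \ol i1 = f by rewrite lcompBl -!lcompA p11 p21 lcomp0r subr0 lcompm1.
have he : epic h by move=> v k hk; apply: fe; rewrite -hi1 lcompA hk lcomp0l.
have [w [j jP]] := ex_kernel h.
have [hj _ hU] := epic_cokernel he jP.
exists w, (p2 \ol j), (p1 \ol j); split; last first.
  by apply/eqP; rewrite -subr_eq0 !lcompA -lcompBl hj.
move=> v k; rewrite lcompA => /hU[u uE].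
have u0 : u = 0 by apply: fe; rewrite -hi1 lcompA uE -lcompA p21 lcomp0r.
by rewrite -[k]lcompm1 -p22 lcompA -uE u0 !lcomp0l.
Qed.

(* Generalized elements, considered up to refinement along epimorphisms,
   make diagrams chase as for modules. *)
Definition exact_at (A : lin_category R) (x y z : lobj A) (f : lmor x y) (g : lmor y z) :=
  forall w (v : lmor w y), g \ol v = 0 ->
  exists w' (e : lmor w' w) (u : lmor w' x), epic e /\ v \ol e = f \ol u.

Lemma cokernel_exact (A : ab_category R) (x y c : lobj A) (f : lmor x y) (q : lmor y c) :
  cokernel q f -> exact_at f q.
Proof.
move=> [qf qe qU] w v qv; have [z [e [m [ee mm fE]]]] := epi_mono_factor f.
have qme : cokernel q m.
  split=> // [|d g gm]; first by apply: ee; rewrite -lcompA -fE.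
  by apply: qU; rewrite fE lcompA gm lcomp0l.
have [_ _ mU] := monic_kernel mm qme; have [v' v'E] := mU _ _ qv.
have [w' [e' [u [e'e uE]]]] := pullback_epic v' ee.
by exists w', e', u; split=> //; rewrite fE -lcompA uE lcompA v'E.
Qed.

Lemma epic_lift (A : lin_category R) (x y w : lobj A) (f : lmor x y) (e : lmor w y)
    (u : lmor w x) :
  epic e -> f \ol u = e -> epic f.
Proof. by move=> ee E; rewrite -E in ee; apply: epic_cancel ee. Qed.

(** Exactness lifts [v] only after an epic refinement [e]. Since [f] is monic, the lift kills the
    kernel of [e] and therefore descends along [e]. *)
Lemma exact_kernel (A : ab_category R) (x y z : lobj A) (f : lmor x y) (g : lmor y z) :
  g \ol f = 0 -> monic f -> exact_at f g -> kernel f g.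
Proof.
move=> gf fm fg; split=> // w v /fg[w' [e [u [ee uE]]]].
have [k [i iP]] := ex_kernel e; have [ei _ eU] := epic_cokernel ee iP.
have [|h hE] := eU _ u; first by apply: fm; rewrite lcompA -uE -lcompA ei lcomp0r.
by exists h; apply: (epic_eq ee); rewrite -lcompA hE.
Qed.

Lemma short_exactP (A : ab_category R) (x y z : lobj A) (f : lmor x y) (g : lmor y z) :
  short_exact (A := A) f g <-> kernel f g /\ cokernel g f.
Proof. by rewrite /short_exact kernelP cokernelP. Qed.

Lemma short_exact_intro (A : ab_category R) (x y z : lobj A) (f : lmor x y)
    (g : lmor y z) :
  g \ol f = 0 -> monic f -> exact_at f g -> epic g -> short_exact (A := A) f g.
Proof.
move=> gf fm fg ge; have kf := exact_kernel gf fm fg.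
by apply/short_exactP; split=> //; apply: epic_cokernel.
Qed.

Lemma monic_short_exact (A : ab_category R) (x y c : lobj A) (f : lmor x y)
    (q : lmor y c) :
  monic f -> cokernel q f -> short_exact (A := A) f q.
Proof. by move=> fm qf; apply/short_exactP; split=> //; apply: monic_kernel. Qed.

Lemma epic_short_exact (A : ab_category R) (k x y : lobj A) (f : lmor x y)
    (i : lmor k x) :
  epic f -> kernel i f -> short_exact (A := A) i f.
Proof. by move=> fe fi; apply/short_exactP; split=> //; apply: epic_cokernel. Qed.

Lemma kernel_unique (A : lin_category R) (k k' x y : lobj A) (i : lmor k x)
    (i' : lmor k' x) (f : lmor x y) :
  kernel i f -> kernel i' f -> exists t, is_iso (C := A) t /\ i' \ol t = i.
Proof.
move=> [fi im iU] [fi' im' iU'].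
have [t tE] := iU' _ _ fi; have [s sE] := iU _ _ fi'.
exists t; split=> //; exists s; split=> /=.
  by apply: (monic_eq im); rewrite lcompA sE tE lcompm1.
by apply: (monic_eq im'); rewrite lcompA tE sE lcompm1.
Qed.

Lemma cokernel_unique (A : lin_category R) (k k' x y : lobj A) (i : lmor x k)
    (i' : lmor x k') (f : lmor y x) :
  cokernel i f -> cokernel i' f -> exists t, is_iso (C := A) t /\ t \ol i' = i.
Proof.
move=> ci ci'; have [t [[s [st ts]] tE]] := kernel_unique (A := lin_op A) ci ci'.
by exists t; split=> //; exists s.
Qed.

Lemma kernel_iso (A : lin_category R) (k k' x y : lobj A) (i : lmor k x) (f : lmor x y)
    (t : lmor k' k) :
  kernel i f -> is_iso (C := A) t -> kernel (i \ol t) f.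
Proof.
move=> [fi im iU] ti; split; first by rewrite lcompA fi lcomp0l.
  exact/monic_comp/iso_monic.
case: ti => s [_ /= ts] w g /iU[h hE]; exists (s \ol h).
by rewrite -lcompA [t \ol _]lcompA ts lcomp1m.
Qed.

Lemma cokernel_iso (A : lin_category R) (k k' x y : lobj A) (i : lmor x k)
    (f : lmor y x) (t : lmor k k') :
  cokernel i f -> is_iso (C := A) t -> cokernel (t \ol i) f.
Proof.
move=> ci [s [st ts]]; apply: (kernel_iso (A := lin_op A) ci).
by exists s.
Qed.

Lemma cokernel_epic_comp (A : lin_category R) (w x y c : lobj A) (q : lmor y c)
    (m : lmor x y) (e : lmor w x) :
  epic e -> cokernel q (m \ol e) <-> cokernel q m.
Proof.
move=> ee; split=> [[qf qe qU]|[qf qe qU]]; split=> //.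
- by apply: ee; rewrite -lcompA.
- by move=> d g gm; apply: qU; rewrite lcompA gm lcomp0l.
- by rewrite lcompA qf lcomp0l.
- by move=> d g; rewrite lcompA => /ee; apply: qU.
Qed.

Lemma kernel_monic_comp (A : lin_category R) (w x y c : lobj A) (q : lmor c w)
    (m : lmor x y) (e : lmor w x) :
  monic m -> kernel q (m \ol e) <-> kernel q e.
Proof. exact: (@cokernel_epic_comp (lin_op A)). Qed.

End AbelianToolbox.

Section LinearFunctor.
Context (R : comPzRingType) (A B : lin_category R) (F : functor A B).
Hypothesis Flin : is_linear_functor F.

Definition lfmap (x y : lobj A) (f : lmor x y) : lmor (F x) (F y) := fmap F f.

Lemma lfmap1 x : lfmap (lidm x) = lidm (F x).
Proof. exact: (fmap1 F x). Qed.
Lemma lfmapM (x y z : lobj A) (g : lmor y z) (f : lmor x y) :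
  lfmap (g \ol f) = lfmap g \ol lfmap f.
Proof. exact: (fmapM F g f). Qed.
Lemma lfmap0 (x y : lobj A) : lfmap (0 : lmor x y) = 0.
Proof. exact: (linear_zero (@Flin x y)). Qed.
Lemma lfmapD (x y : lobj A) (f g : lmor x y) : lfmap (f + g) = lfmap f + lfmap g.
Proof. by have /= := Flin 1 f g; rewrite !scale1r. Qed.
Lemma lfmapZ (x y : lobj A) a (f : lmor x y) : lfmap (a *: f) = a *: lfmap f.
Proof. by have := Flin a f 0; rewrite addr0 -!/(lfmap _) lfmap0 addr0. Qed.
End LinearFunctor.

Section ExactFunctor.
Context (R : comPzRingType) (A B : ab_category R) (G : functor A B).
Hypothesis Gex : is_exact_linear G.

Let short_exact_image (x y z : lobj A) (f : lmor x y) (g : lmor y z) :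
  short_exact (A := A) f g -> kernel (lfmap G f) (lfmap G g) /\ cokernel (lfmap G g)
    (lfmap G f).
Proof. by move=> /(Gex.2 _ _ _)/short_exactP. Qed.

Lemma exact_monic (x y : lobj A) (f : lmor x y) : monic f -> monic (lfmap G f).
Proof.
move=> fm; have [c [q qf]] := ex_cokernel f.
by have [[]] := short_exact_image (monic_short_exact fm qf).
Qed.

Lemma exact_epic (x y : lobj A) (f : lmor x y) : epic f -> epic (lfmap G f).
Proof.
move=> fm; have [c [q qf]] := ex_kernel f.
by have [_ []] := short_exact_image (epic_short_exact fm qf).
Qed.

Lemma exact_preserves_kernel (k x y : lobj A) (i : lmor k x) (f : lmor x y) :
  kernel i f -> kernel (lfmap G i) (lfmap G f).
Proof.
have [z [e [m [ee mm ->]]]] := epi_mono_factor f.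
rewrite lfmapM kernel_monic_comp // => ie; apply/kernel_monic_comp; first
  exact: exact_monic.
by have [] := short_exact_image (epic_short_exact ee ie).
Qed.

Lemma exact_preserves_cokernel (k x y : lobj A) (q : lmor y k) (f : lmor x y) :
  cokernel q f -> cokernel (lfmap G q) (lfmap G f).
Proof.
have [z [e [m [ee mm ->]]]] := epi_mono_factor f.
rewrite lfmapM cokernel_epic_comp // => ie; apply/cokernel_epic_comp; first
  exact: exact_epic.
by have [] := short_exact_image (monic_short_exact mm ie).
Qed.

End ExactFunctor.

(** * Subquotients and the maps induced between them *)

Section Subquotients.
Context (R : comPzRingType).

(* [sqI] is the subquotient (im f + ker g) / im f of [x1]; [g \ol f] need not vanish. *)
Record subquotient (A : lin_category R) (x0 x1 x2 : lobj A) (f : lmor x0 x1)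
  (g : lmor x1 x2) := Subquotient {
  sqI : lobj A; sqK : lobj A; sqQ : lobj A;
  sqk : lmor sqK x1; sqq : lmor x1 sqQ;
  sqe : lmor sqK sqI; sqm : lmor sqI sqQ;
  sqkP : kernel sqk g; sqqP : cokernel sqq f;
  sqeP : epic sqe; sqmP : monic sqm;
  sqE : sqm \ol sqe = sqq \ol sqk
}.
Arguments sqeP {A x0 x1 x2 f g} s.
Arguments sqmP {A x0 x1 x2 f g} s.
Arguments sqkP {A x0 x1 x2 f g} s.
Arguments sqqP {A x0 x1 x2 f g} s.

Lemma ex_subquotient (A : ab_category R) (x0 x1 x2 : lobj A) (f : lmor x0 x1)
    (g : lmor x1 x2) :
  exists s : subquotient f g, True.
Proof.
have [K [k kP]] := ex_kernel g; have [Q [q qP]] := ex_cokernel f.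
have [z [e [m [ee mm E]]]] := epi_mono_factor (q \ol k).
by exists (Subquotient kP qP ee mm (esym E)).
Qed.

Context (A : ab_category R).

(** This says that [a] induces [h]. As [sqe s] is epic and [sqm s'] is monic, [a] determines [h], so
    equations between maps of subquotients reduce to equations between maps of middle terms. *)
Definition sq_rep (x0 x1 x2 y0 y1 y2 : lobj A) (f : lmor x0 x1) (g : lmor x1 x2)
    (f' : lmor y0 y1) (g' : lmor y1 y2)
  (s : subquotient f g) (s' : subquotient f' g') (a : lmor x1 y1)
    (h : lmor (sqI s) (sqI s')) :=
  sqm s' \ol h \ol sqe s = sqq s' \ol a \ol sqk s.

Lemma sq_rep_unique (x0 x1 x2 y0 y1 y2 : lobj A) (f : lmor x0 x1) (g : lmor x1 x2)
    (f' : lmor y0 y1) (g' : lmor y1 y2)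
  (s : subquotient f g) (s' : subquotient f' g') (a : lmor x1 y1)
    (h h' : lmor (sqI s) (sqI s')) :
  sq_rep a h -> sq_rep a h' -> h = h'.
Proof.
move=> H H'; apply: (monic_eq (sqmP s')); apply: (epic_eq (sqeP s)).
by rewrite H H'.
Qed.

(** Evaluation on generalized elements: the induced map sends the class of [v] to the class of any
    [v'] lying over the image of [v] under [a]. *)
Lemma sq_rep_elt (x0 x1 x2 y0 y1 y2 : lobj A) (f : lmor x0 x1) (g : lmor x1 x2)
    (f' : lmor y0 y1) (g' : lmor y1 y2)
  (s : subquotient f g) (s' : subquotient f' g') (a : lmor x1 y1)
    (h : lmor (sqI s) (sqI s'))
  w (v : lmor w (sqK s)) (v' : lmor w (sqK s')) :
  sq_rep a h -> a \ol (sqk s \ol v) = sqk s' \ol v' -> h \ol (sqe s \ol v) = sqe s' \ol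
    v'.
Proof.
move=> H E; apply: (monic_eq (sqmP s')).
by rewrite !lcompA H sqE -!lcompA E.
Qed.

(** The ladder makes [a] restrict to a map [b] of kernels and descend to a map [c] of cokernels. The
    composite [sqe s' \ol b] factors through [sqe s] because, followed by the monic [sqm s'], it
    equals [c \ol sqm s \ol sqe s], which kills the kernel of [sqe s]. *)
Lemma sq_rep_ex (x0 x1 x2 y0 y1 y2 : lobj A) (f : lmor x0 x1) (g : lmor x1 x2)
    (f' : lmor y0 y1) (g' : lmor y1 y2)
  (s : subquotient f g) (s' : subquotient f' g') (a : lmor x1 y1) a0 a2 :
  a \ol f = f' \ol a0 -> g' \ol a = a2 \ol g -> exists h : lmor (sqI s) (sqI s'), sq_rep
    a h.
Proof.
move=> af ga.
have [gk _ _] := sqkP s; have [gk' km' kU'] := sqkP s'.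
have [qf _ qU] := sqqP s; have [qf' _ _] := sqqP s'.
have [|b bE] := kU' _ (a \ol sqk s); first by rewrite lcompA ga -lcompA gk lcomp0r.
have [|c cE] := qU _ (sqq s' \ol a); first by rewrite -lcompA af lcompA qf' lcomp0l.
have [n [j jP]] := ex_kernel (sqe s); have [ej _ eU] := epic_cokernel (sqeP s) jP.
have [|h hE] := eU _ (sqe s' \ol b).
  apply: (sqmP s').
  by rewrite !lcompA sqE -!lcompA [sqk s' \ol _]lcompA bE !lcompA -cE
    -[c \ol _ \ol _]lcompA -sqE -!lcompA ej !lcomp0r.
exists h; rewrite /sq_rep -lcompA hE lcompA sqE -lcompA bE.
by rewrite lcompA.
Qed.

Lemma sq_rep_comp (x0 x1 x2 y0 y1 y2 z0 z1 z2 : lobj A)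
  (f : lmor x0 x1) (g : lmor x1 x2) (f' : lmor y0 y1) (g' : lmor y1 y2)
    (f'' : lmor z0 z1) (g'' : lmor z1 z2)
  (s : subquotient f g) (s' : subquotient f' g') (s'' : subquotient f'' g'')
  (a : lmor x1 y1) a2 (b : lmor y1 z1) (h : lmor (sqI s) (sqI s'))
    (h' : lmor (sqI s') (sqI s'')) :
  g' \ol a = a2 \ol g -> sq_rep a h -> sq_rep b h' -> sq_rep (b \ol a) (h' \ol h).
Proof.
move=> ga H H'.
have [gk _ _] := sqkP s; have [_ _ kU'] := sqkP s'.
have [|v vE] := kU' _ (a \ol sqk s); first by rewrite lcompA ga -lcompA gk lcomp0r.
have E : h \ol sqe s = sqe s' \ol v.
  apply: (monic_eq (sqmP s')).
  by rewrite !lcompA H sqE -!lcompA vE.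
rewrite /sq_rep -!lcompA E 2!lcompA H'.
by rewrite -!lcompA vE.
Qed.

Lemma sq_rep_id (x0 x1 x2 : lobj A) (f : lmor x0 x1) (g : lmor x1 x2)
    (s : subquotient f g) :
  sq_rep (lidm x1) (lidm (sqI s)).
Proof. by rewrite /sq_rep !lcompm1 sqE. Qed.

Lemma sq_rep_iso (x0 x1 x2 : lobj A) (f : lmor x0 x1) (g : lmor x1 x2)
    (s s' : subquotient f g)
  (h : lmor (sqI s) (sqI s')) : sq_rep (lidm x1) h -> is_iso (C := A) h.
Proof.
have E1 : lidm x1 \ol f = f \ol lidm x0 by rewrite lcomp1m lcompm1.
have E2 : g \ol lidm x1 = lidm x2 \ol g by rewrite lcomp1m lcompm1.
have [h' H'] := sq_rep_ex s' s E1 E2.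
move=> H; exists h'; split => /=.
  by have := sq_rep_comp E2 H H'; rewrite lcompm1 => /sq_rep_unique; apply;
    apply: sq_rep_id.
by have := sq_rep_comp E2 H' H; rewrite lcompm1 => /sq_rep_unique; apply;
  apply: sq_rep_id.
Qed.

(** With the next two lemmas, this allows chasing in a subquotient as with classes of cycles modulo
    boundaries: an element lifts to [sqK] after refinement, and the class of a lift vanishes exactly
    when, after refinement, the lift comes from [x0]. *)
Lemma sq_elt (x0 x1 x2 : lobj A) (f : lmor x0 x1) (g : lmor x1 x2) (s : subquotient f g)
    w (v : lmor w (sqI s)) :
  exists w' (p : lmor w' w) (u : lmor w' (sqK s)), [/\ epic p, v \ol p = sqe s \ol u & g
    \ol (sqk s \ol u) = 0].
Proof.
have [w' [p [u [pe uE]]]] := pullback_epic v (sqeP s).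
by exists w', p, u; rewrite lcompA; have [-> _ _] := sqkP s; rewrite lcomp0l uE.
Qed.

Lemma sq_elt_eq0 (x0 x1 x2 : lobj A) (f : lmor x0 x1) (g : lmor x1 x2)
    (s : subquotient f g) w (v : lmor w (sqK s)) u :
  sqk s \ol v = f \ol u -> sqe s \ol v = 0.
Proof.
move=> E; apply: (sqmP s); rewrite lcompA sqE -lcompA E lcompA.
by have [-> _ _] := sqqP s; rewrite lcomp0l.
Qed.

Lemma sq_elt_exact (x0 x1 x2 : lobj A) (f : lmor x0 x1) (g : lmor x1 x2)
    (s : subquotient f g) w (v : lmor w (sqK s)) :
  sqe s \ol v = 0 -> exists w' (p : lmor w' w) u, epic p /\ sqk s \ol v \ol p = f \ol u.
Proof.
move=> E; apply: (cokernel_exact (sqqP s)).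
by rewrite lcompA -sqE -lcompA E lcomp0r.
Qed.

End Subquotients.
Arguments sqeP {R A x0 x1 x2 f g} s.
Arguments sqmP {R A x0 x1 x2 f g} s.
Arguments sqkP {R A x0 x1 x2 f g} s.
Arguments sqqP {R A x0 x1 x2 f g} s.

(** * The free additive category *)

Section Biproducts.
Context (R : comPzRingType).

Record biproduct (A : lin_category R) (x y : lobj A) := Biproduct {
  bs : lobj A;
  bi1 : lmor x bs; bi2 : lmor y bs; bp1 : lmor bs x; bp2 : lmor bs y;
  biproductP : is_biproduct (A := A) bi1 bi2 bp1 bp2
}.

Lemma ex_biproduct (A : ab_category R) (x y : lobj A) : exists b : biproduct x y, True.
Proof.
have [s [i1 [i2 [p1 [p2 P]]]]] := ab_biproduct (ab_abelian A) x y.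
by exists (Biproduct P).
Qed.

Definition the_biproduct (A : ab_category R) (x y : lobj A) : biproduct x y :=
  sval (cid (ex_biproduct x y)).

Definition the_zero (A : ab_category R) : lobj A := sval (cid (ab_zero (ab_abelian A))).

Lemma the_zeroP (A : ab_category R) : lidm (the_zero A) = 0.
Proof. exact/zero_objectP/(svalP (cid (ab_zero (ab_abelian A)))). Qed.

End Biproducts.

Section Expressions.
Context (R : comPzRingType) (C : category).

Inductive xobj : Type :=
  | XGen of int & C
  | XZero
  | XSum of xobj & xobj.

Inductive xmor : xobj -> xobj -> Type :=
  | XMor i x y of @mor C x y : xmor (XGen i x) (XGen i y)
  | XId a : xmor a a
  | XComp a b c of xmor b c & xmor a b : xmor a c
  | XNull a b : xmor a b
  | XAdd a b of xmor a b & xmor a b : xmor a b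
  | XScale a b of R & xmor a b : xmor a b
  | XIn1 a b : xmor a (XSum a b)
  | XIn2 a b : xmor b (XSum a b)
  | XPr1 a b : xmor (XSum a b) a
  | XPr2 a b : xmor (XSum a b) b.

Section Semantics.
Context (A : ab_category R) (H : homologies C A).

Fixpoint sem_obj (a : xobj) : lobj A :=
  match a with
  | XGen i x => H i x
  | XZero => the_zero A
  | XSum a b => bs (the_biproduct (sem_obj a) (sem_obj b))
  end.

Fixpoint sem_mor a b (e : xmor a b) : lmor (sem_obj a) (sem_obj b) :=
  match e in xmor a b return lmor (sem_obj a) (sem_obj b) with
  | XMor i x y f => fmap (H i) f
  | XId a => lidm (sem_obj a)
  | XComp a b c g f => sem_mor g \ol sem_mor f
  | XNull a b => 0
  | XAdd a b f g => sem_mor f + sem_mor g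
  | XScale a b r f => r *: sem_mor f
  | XIn1 a b => bi1 (the_biproduct (sem_obj a) (sem_obj b))
  | XIn2 a b => bi2 (the_biproduct (sem_obj a) (sem_obj b))
  | XPr1 a b => bp1 (the_biproduct (sem_obj a) (sem_obj b))
  | XPr2 a b => bp2 (the_biproduct (sem_obj a) (sem_obj b))
  end.

End Semantics.

(* Identifying expressions with the same value under every homology gives the
   free additive category without normal forms. *)
Definition sem_eq a b (e e' : xmor a b) : Prop :=
  forall (A : ab_category R) (H : homologies C A), sem_mor H e = sem_mor H e'.

Definition xpre_module (a b : xobj) : pre_module R.
Proof.
apply: (@PreModule R (xmor a b) (@sem_eq a b) (XNull a b) (@XAdd a b) (@XScale a b)).
- by [].
- by move=> u v E A H; rewrite E.
- by move=> u v w E E' A H; rewrite E E'.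
- by move=> u u' v v' E E' A H /=; rewrite E E'.
- by move=> r u u' E A H /=; rewrite E.
- by move=> u v w A H /=; rewrite addrA.
- by move=> u v A H /=; rewrite addrC.
- by move=> u A H /=; rewrite add0r.
- by move=> u A H /=; rewrite scaleN1r addNr.
- by move=> r r' u A H /=; rewrite scalerA.
- by move=> u A H /=; rewrite scale1r.
- by move=> r u v A H /=; rewrite scalerDr.
- by move=> u r r' A H /=; rewrite scalerDl.
Defined.

Definition xpre_lin : pre_lin R.
Proof.
apply: (@PreLin R xobj xpre_module XId (@XComp)).
- by move=> a b c g g' f f' E E' A H /=; rewrite E E'.
- by move=> a b f A H /=; rewrite lcomp1m.
- by move=> a b f A H /=; rewrite lcompm1.
- by move=> a b c d h g f A H /=; rewrite lcompA.
- by move=> a b c f r g g' A H /=; rewrite lcompDl lcompZl.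
- by move=> a b c g r f f' A H /=; rewrite lcompDr lcompZr.
Defined.

Definition xcat : lin_category R := quo_lin xpre_lin.

Definition xclass a b (e : xmor a b) : lmor (l := xcat) a b := qmor (P := xpre_lin) e.

Lemma xclass_onto (a b : lobj xcat) (f : lmor a b) : exists e, f = xclass e.
Proof. exact: (qmor_onto (P := xpre_lin)). Qed.

Lemma xclass_eq a b (e e' : xmor a b) : sem_eq e e' -> xclass e = xclass e'.
Proof. by move=> E; apply/(qmor_eq (P := xpre_lin)). Qed.

Lemma xclassM a b c (g : xmor b c) (f : xmor a b) : xclass (XComp g f) = xclass g \ol
    xclass f.
Proof. exact: (qmorM (P := xpre_lin)). Qed.

Lemma xclassD a b (f g : xmor a b) : xclass (XAdd f g) = xclass f + xclass g.
Proof. exact: (qmorD (P := xpre_lin)). Qed.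

Lemma xclassZ a b r (f : xmor a b) : xclass (XScale r f) = r *: xclass f.
Proof. exact: (qmorZ (P := xpre_lin)). Qed.

Lemma xclass0 a b : xclass (XNull a b) = 0.
Proof. exact: (qmor0 (P := xpre_lin)). Qed.

Lemma xclass1 a : xclass (XId a) = lidm (l := xcat) a.
Proof. by []. Qed.

Lemma xzeroP : lidm (l := xcat) XZero = 0.
Proof. by rewrite -xclass0; apply: xclass_eq => A H /=; apply: the_zeroP. Qed.

Lemma xsumP a b : is_biproduct (A := xcat)
  (xclass (XIn1 a b)) (xclass (XIn2 a b)) (xclass (XPr1 a b)) (xclass (XPr2 a b)).
Proof.
split; rewrite -?xclassM -?xclassD -?xclass1 -?xclass0;
  by apply: xclass_eq => A H /=; have [] := biproductP
    (the_biproduct (sem_obj H a) (sem_obj H b)).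
Qed.

Section SemanticFunctor.
Context (A : ab_category R) (H : homologies C A).

(** Any representative will do: congruent expressions agree under every homology, in particular
    under [H]. *)
Definition xsem a b (f : lmor (l := xcat) a b) : lmor (sem_obj H a) (sem_obj H b) :=
  sem_mor H (sval (cid (xclass_onto f))).

Lemma xsem_class a b (e : xmor a b) : xsem (xclass e) = sem_mor H e.
Proof.
rewrite /xsem; case: cid => e' /= /(qmor_eq (P := xpre_lin)) E; apply: esym (E A H).
Qed.

Definition xsem_functor : functor xcat A.
Proof.
exists (sem_obj H : xcat -> A) xsem.
- by move=> a; rewrite -[idm a]/(xclass (XId a)) xsem_class.
- move=> a b c g f; have [{}g ->] := xclass_onto g; have [{}f ->] := xclass_onto f.
  by rewrite -[X in xsem X]xclassM !xsem_class.
Defined.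

Lemma xsem_linear : is_linear_functor xsem_functor.
Proof.
move=> a b r f g; have [{}g ->] := xclass_onto g; have [{}f ->] := xclass_onto f.
by rewrite -xclassZ -xclassD; rewrite ![fmap _ _]xsem_class.
Qed.

End SemanticFunctor.

Definition xgen (i : int) : functor C xcat.
Proof.
exists (XGen i : C -> xcat) (fun x y f => xclass (XMor i f)).
- by move=> x; rewrite -[idm (XGen i x : xcat)]xclass1; apply: xclass_eq => A H /=;
  apply: (fmap1 (H i) x).
- by move=> x y z g f; rewrite -[RHS]xclassM; apply: xclass_eq => A H /=;
  apply: (fmapM (H i) g f).
Defined.

Lemma xsem_gen (A : ab_category R) (H : homologies C A) i x y (f : @mor C x y) :
  fmap (xsem_functor H) (fmap (xgen i) f) = fmap (H i) f.
Proof. exact: xsem_class. Qed.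

End Expressions.

Lemma zmod_eq (V : zmodType) (x y : V) : x - y + 0 = 0 -> x = y.
Proof. by move/eqP; rewrite addr0 subr_eq0 => /eqP. Qed.

(* Decides equality in an abelian group by cancelling opposite summands. *)
Ltac zmod_cancel :=
  match goal with
  | |- - ?x + ?r = 0 =>
    repeat match r with _ => match goal with |- context [?a + (x + ?b)] =>
      lazymatch a with - x => fail | x => fail | _ => rewrite (addrCA a x b) end end end;
    rewrite (addKr x)
  | |- ?x + ?r = 0 =>
    repeat match r with _ => match goal with |- context [?a + (- x + ?b)] =>
      lazymatch a with - x => fail | x => fail | _ => rewrite (addrCA a (- x) b) end end
        end;
    rewrite (addNKr x)
  end.
Ltac zmod :=
  apply: zmod_eq;
  rewrite ?(add0r, addr0, subr0, sub0r) ?(opprD, opprK, oppr0) -?addrA ?(addr0, add0r);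
  rewrite -1?[LHS]addr0 -?addrA; repeat zmod_cancel; reflexivity.

Section BiproductCalculus.
Context (R : comPzRingType) (B : lin_category R) (x y : lobj B) (b : biproduct x y).
Let P := biproductP b.

Lemma bp11 : bp1 b \ol bi1 b = lidm x. Proof. by case: P. Qed.
Lemma bp22 : bp2 b \ol bi2 b = lidm y. Proof. by case: P. Qed.
Lemma bp21 : bp2 b \ol bi1 b = 0. Proof. by case: P. Qed.
Lemma bp12 : bp1 b \ol bi2 b = 0. Proof. by case: P. Qed.
Lemma bip : bi1 b \ol bp1 b + bi2 b \ol bp2 b = lidm (bs b). Proof. by case: P. Qed.

Lemma bp11A w (h : lmor w x) : bp1 b \ol (bi1 b \ol h) = h. Proof. by rewrite lcompA
    bp11 lcomp1m. Qed.
Lemma bp22A w (h : lmor w y) : bp2 b \ol (bi2 b \ol h) = h. Proof. by rewrite lcompA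
    bp22 lcomp1m. Qed.
Lemma bp21A w (h : lmor w x) : bp2 b \ol (bi1 b \ol h) = 0. Proof. by rewrite lcompA
    bp21 lcomp0l. Qed.
Lemma bp12A w (h : lmor w y) : bp1 b \ol (bi2 b \ol h) = 0. Proof. by rewrite lcompA
    bp12 lcomp0l. Qed.

Lemma bip_to w (h : lmor w (bs b)) : h = bi1 b \ol (bp1 b \ol h) + bi2 b \ol
    (bp2 b \ol h).
Proof. by rewrite !lcompA -lcompDl bip lcomp1m. Qed.

Lemma bip_from w (h : lmor (bs b) w) : h = h \ol bi1 b \ol bp1 b + h \ol bi2 b \ol bp2 b.
Proof. by rewrite -!lcompA -lcompDr bip lcompm1. Qed.

End BiproductCalculus.

Arguments bip_to {R B x y} b {w} h.
Arguments bip_from {R B x y} b {w} h.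

Definition bipE := (bp11, bp22, bp21, bp12, bp11A, bp22A, bp21A, bp12A).

Ltac lin_expand := rewrite ?(lcompDl, lcompDr, lcompNl, lcompNr, =^~ lcompA, bipE,
  lcomp0l, lcomp0r,
  lcomp1m, lcompm1, addr0, add0r, subr0, sub0r, oppr0, opprK).

(** Lets an equation between composites be applied inside a right-associated composite, the normal
    form produced by [lin_expand]. *)
Lemma lcompA_eq (R : comPzRingType) (B : lin_category R) (x y z w : lobj B)
  (f : lmor y z) (g : lmor x y) (k : lmor x z) (h : lmor w x) :
  f \ol g = k -> f \ol (g \ol h) = k \ol h.
Proof. by move=> <-; rewrite lcompA. Qed.

(** * The Adelman category *)

Section Adelman.
Context (R : comPzRingType) (B : lin_category R).

Record tri := Tri {
  t0 : lobj B; t1 : lobj B; t2 : lobj B; ta : lmor t0 t1; tb : lmor t1 t2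
}.

(* A triple stands for the subquotient (im a + ker b) / im a of its middle term.
   Morphisms are represented by maps of middle terms that extend to a
   commutative ladder, modulo those factoring as in [tnull]. *)
Definition tadm (X Y : tri) (f : lmor (t1 X) (t1 Y)) : Prop :=
  (exists f0, f \ol ta X = ta Y \ol f0) /\ (exists f2, tb Y \ol f = f2 \ol tb X).

Definition tnull (X Y : tri) (f : lmor (t1 X) (t1 Y)) : Prop :=
  exists s t, f = ta Y \ol s + t \ol tb X.

Lemma tadm_lin X Y a (f g : lmor (t1 X) (t1 Y)) : tadm f -> tadm g -> tadm (a *: f + g).
Proof.
move=> [[f0 f0E] [f2 f2E]] [[g0 g0E] [g2 g2E]]; split.
  by exists (a *: f0 + g0); rewrite lcompDl lcompZl lcompDr lcompZr f0E g0E.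
by exists (a *: f2 + g2); rewrite lcompDl lcompZl lcompDr lcompZr f2E g2E.
Qed.

Lemma tadm0 X Y : tadm (0 : lmor (t1 X) (t1 Y)).
Proof. by split; exists 0; rewrite !lcomp0l !lcomp0r. Qed.

Lemma tadm_add X Y (f g : lmor (t1 X) (t1 Y)) : tadm f -> tadm g -> tadm (f + g).
Proof. by move=> fa /(tadm_lin 1 fa); rewrite scale1r. Qed.

Lemma tadm_scale X Y a (f : lmor (t1 X) (t1 Y)) : tadm f -> tadm (a *: f).
Proof. by move=> /(tadm_lin a) /(_ (tadm0 _ _)); rewrite addr0. Qed.

Lemma tadm_id X : tadm (X := X) (Y := X) (lidm (t1 X)).
Proof. by split; [exists (lidm _) | exists (lidm _)]; rewrite lcomp1m lcompm1. Qed.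

Lemma tadm_comp X Y Z (g : lmor (t1 Y) (t1 Z)) (f : lmor (t1 X) (t1 Y)) :
  tadm g -> tadm f -> tadm (X := X) (Y := Z) (g \ol f).
Proof.
move=> [[g0 g0E] [g2 g2E]] [[f0 f0E] [f2 f2E]]; split.
  by exists (g0 \ol f0); rewrite -lcompA f0E !lcompA g0E.
by exists (g2 \ol f2); rewrite lcompA g2E -!lcompA f2E.
Qed.

Lemma tnull0 X Y : tnull (0 : lmor (t1 X) (t1 Y)).
Proof. by exists 0, 0; rewrite lcomp0l lcomp0r addr0. Qed.

Lemma tnull_lin X Y a (f g : lmor (t1 X) (t1 Y)) : tnull f -> tnull g -> tnull
    (a *: f + g).
Proof.
move=> [s [t ->]] [s' [t' ->]]; exists (a *: s + s'), (a *: t + t').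
by rewrite lcompDl lcompZl lcompDr lcompZr scalerDr addrACA.
Qed.

Lemma tnull_compl X Y Z (g : lmor (t1 Y) (t1 Z)) (f : lmor (t1 X) (t1 Y)) :
  tadm g -> tnull f -> tnull (X := X) (Y := Z) (g \ol f).
Proof.
move=> [[g0 g0E] _] [s [t ->]]; exists (g0 \ol s), (g \ol t).
by rewrite lcompDr !lcompA g0E.
Qed.

Lemma tnull_compr X Y Z (g : lmor (t1 Y) (t1 Z)) (f : lmor (t1 X) (t1 Y)) :
  tnull g -> tadm f -> tnull (X := X) (Y := Z) (g \ol f).
Proof.
move=> [s [t ->]] [_ [f2 f2E]]; exists (s \ol f), (t \ol f2).
by rewrite lcompDl -!lcompA f2E.
Qed.

Lemma tnull_sub X Y (f g : lmor (t1 X) (t1 Y)) : f = g -> tnull (f - g).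
Proof. by move=> ->; rewrite subrr; apply: tnull0. Qed.

Definition tpre_module (X Y : tri) : pre_module R.
Proof.
apply: (@PreModule R {f : lmor (t1 X) (t1 Y) | tadm f}
  (fun f g => tnull (sval f - sval g)) (exist _ 0 (tadm0 X Y))
  (fun f g => exist _ (sval f + sval g) (tadm_add (proj2_sig f) (proj2_sig g)))
  (fun a f => exist _ (a *: sval f) (tadm_scale a (proj2_sig f)))).
- by move=> f; apply: tnull_sub.
- by move=> f g /(tnull_lin (-1)) /(_ (tnull0 _ _)); rewrite addr0 scaleN1r opprB.
- by move=> f g h /(tnull_lin 1) H /H; rewrite scale1r addrA subrK.
- move=> f f' g g' /(tnull_lin 1) H /H; rewrite scale1r /=.
  by rewrite opprD addrACA.
- move=> a f f' /(tnull_lin a) /(_ (tnull0 _ _)); rewrite addr0 /=.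
  by rewrite scalerBr.
- by move=> f g h; apply: tnull_sub; rewrite /= addrA.
- by move=> f g; apply: tnull_sub; rewrite /= addrC.
- by move=> f; apply: tnull_sub; rewrite /= add0r.
- by move=> f; apply: tnull_sub; rewrite /= scaleN1r addNr.
- by move=> a b f; apply: tnull_sub; rewrite /= scalerA.
- by move=> f; apply: tnull_sub; rewrite /= scale1r.
- by move=> a f g; apply: tnull_sub; rewrite /= scalerDr.
- by move=> f a b; apply: tnull_sub; rewrite /= scalerDl.
Defined.

Definition tpre_lin : pre_lin R.
Proof.
apply: (@PreLin R tri tpre_module (fun X => exist _ (lidm (t1 X)) (tadm_id X))
  (fun X Y Z g f => exist _ (sval g \ol sval f) (tadm_comp (proj2_sig g) (proj2_sig f)))).
- move=> X Y Z [g ga] [g' g'a] [f fa] [f' f'a] /= gg' ff'.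
  have -> : g \ol f - g' \ol f' = 1 *: ((g - g') \ol f) + g' \ol (f - f').
    by rewrite scale1r lcompBl lcompBr addrA subrK.
  by apply: tnull_lin; [apply: (tnull_compr (Y := Y)) | apply: (tnull_compl (Y := Y))].
- by move=> X Y f; apply: tnull_sub; rewrite /= lcomp1m.
- by move=> X Y f; apply: tnull_sub; rewrite /= lcompm1.
- by move=> X Y Z T h g f; apply: tnull_sub; rewrite /= lcompA.
- by move=> X Y Z f a g g'; apply: tnull_sub; rewrite /= lcompDl lcompZl.
- by move=> X Y Z g a f f'; apply: tnull_sub; rewrite /= lcompDr lcompZr.
Defined.

Definition adelman : lin_category R := quo_lin tpre_lin.

(** A relation instead of a chosen representative: computations can use whichever middle map is
    convenient, and composites and sums of representatives are again representatives. *)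
Definition trep (X Y : lobj adelman) (F : lmor X Y) (f : lmor (t1 X) (t1 Y)) : Prop :=
  exists fa : tadm f, F = qmor (P := tpre_lin) (exist _ f fa).

Lemma trep_ex X Y (F : lmor (l := adelman) X Y) : exists f, trep F f.
Proof. by have [[f fa] ->] := qmor_onto (P := tpre_lin) F; exists f, fa. Qed.

Lemma trep_adm X Y (F : lmor (l := adelman) X Y) f : trep F f -> tadm f.
Proof. by case. Qed.

Lemma trep_make (X Y : lobj adelman) (f : lmor (t1 X) (t1 Y)) : tadm f -> exists
    F : lmor X Y, trep F f.
Proof. by move=> fa; exists (qmor (P := tpre_lin) (exist _ f fa)), fa. Qed.

Lemma trep_eq X Y (F G : lmor (l := adelman) X Y) f g : trep F f -> trep G g ->
    (F = G <-> tnull (f - g)).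
Proof. by move=> [fa ->] [ga ->]; exact: (qmor_eq (P := tpre_lin)). Qed.

Lemma trep_zero X Y : trep (0 : lmor (l := adelman) X Y) 0.
Proof. by exists (tadm0 X Y). Qed.

Lemma trep0 X Y (F : lmor (l := adelman) X Y) f : trep F f -> (F = 0 <-> tnull f).
Proof. by move=> /trep_eq /(_ (trep_zero X Y)); rewrite subr0. Qed.

Lemma trep_uniq X Y (F G : lmor (l := adelman) X Y) f : trep F f -> trep G f -> F = G.
Proof. by move=> Ff Gf; apply/(trep_eq Ff Gf); apply: tnull_sub. Qed.

Lemma trep1 (X : lobj adelman) : trep (lidm X) (lidm (t1 X)).
Proof. by exists (tadm_id X). Qed.

Lemma trepM X Y Z (G : lmor (l := adelman) Y Z) (F : lmor X Y) g f : trep G g -> trep F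
    f -> trep (G \ol F) (g \ol f).
Proof.
move=> [ga ->] [fa ->]; exists (tadm_comp ga fa).
exact: esym (@qmorM _ tpre_lin X Y Z (exist _ g ga) (exist _ f fa)).
Qed.

Lemma trepD X Y (G F : lmor (l := adelman) X Y) g f : trep G g -> trep F f -> trep
    (G + F) (g + f).
Proof.
move=> [ga ->] [fa ->]; exists (tadm_add ga fa).
exact: esym (@qmorD _ tpre_lin X Y (exist _ g ga) (exist _ f fa)).
Qed.

Lemma trepZ X Y a (F : lmor (l := adelman) X Y) f : trep F f -> trep (a *: F) (a *: f).
Proof.
move=> [fa ->]; exists (tadm_scale a fa).
exact: esym (@qmorZ _ tpre_lin X Y a (exist _ f fa)).
Qed.

End Adelman.

Section AdelmanAbelian.
Context (R : comPzRingType) (B : lin_category R).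
Context (z : lobj B) (z0 : lidm z = 0) (bi : forall x y : lobj B, biproduct x y).

Let Ad := adelman B.
Implicit Types X Y : lobj Ad.

Section KernelCokernel.
Context (X Y : lobj Ad) (f : lmor (t1 X) (t1 Y)).

(* With X = (a, b) and Y = (c, d): in terms of elements, the pairs (x, y) such that
   b x = 0 and f x + c y = 0, modulo the pairs (a x0, y0). *)
Definition tker : lobj Ad :=
  Tri (bi1 (bi (t1 X) (t0 Y)) \ol ta X \ol bp1 (bi (t0 X) (t0 Y)) +
       bi2 (bi (t1 X) (t0 Y)) \ol bp2 (bi (t0 X) (t0 Y)))
      (bi1 (bi (t2 X) (t1 Y)) \ol tb X \ol bp1 (bi (t1 X) (t0 Y)) +
       bi2 (bi (t2 X) (t1 Y)) \ol
         (f \ol bp1 (bi (t1 X) (t0 Y)) + ta Y \ol bp2 (bi (t1 X) (t0 Y)))).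

(* In terms of elements, the pairs (y, 0) such that d y = 0, modulo the pairs
   (c y0 + f x, b x). *)
Definition tcok : lobj Ad :=
  Tri (bi1 (bi (t1 Y) (t2 X)) \ol
         (ta Y \ol bp1 (bi (t0 Y) (t1 X)) + f \ol bp2 (bi (t0 Y) (t1 X))) +
       bi2 (bi (t1 Y) (t2 X)) \ol tb X \ol bp2 (bi (t0 Y) (t1 X)))
      (bi1 (bi (t2 Y) (t2 X)) \ol tb Y \ol bp1 (bi (t1 Y) (t2 X)) +
       bi2 (bi (t2 Y) (t2 X)) \ol bp2 (bi (t1 Y) (t2 X))).

Lemma tker_adm : tadm (X := tker) (Y := X) (bp1 (bi (t1 X) (t0 Y))).
Proof.
split; first by exists (bp1 (bi (t0 X) (t0 Y))); rewrite /=; lin_expand.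
by exists (bp1 (bi (t2 X) (t1 Y))); rewrite /=; lin_expand.
Qed.

Lemma tcok_adm : tadm (X := Y) (Y := tcok) (bi1 (bi (t1 Y) (t2 X))).
Proof.
split; first by exists (bi1 (bi (t0 Y) (t1 X))); rewrite /=; lin_expand.
by exists (bi1 (bi (t2 Y) (t2 X))); rewrite /=; lin_expand.
Qed.

Lemma tker_kernel (F : lmor X Y) (K : lmor tker X) :
  trep F f -> trep K (bp1 (bi (t1 X) (t0 Y))) -> kernel K F.
Proof.
move=> Ff Kk; split.
- apply/(trep0 (trepM Ff Kk)).
  exists (- bp2 (bi (t1 X) (t0 Y))), (bp2 (bi (t2 X) (t1 Y))); rewrite /=; lin_expand.
  by rewrite addrC addrK.
- move=> W G; have [g Gg] := trep_ex G; move/(trep0 (trepM Kk Gg)) => [s [t E]].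
  apply/(trep0 Gg).
  (* The second diagonal block of [ta tker] is the identity, so the component of [g] in [t0 Y] is a
     boundary at no cost; only the component in [t1 X] uses [E]. *)
  exists (bi1 (bi (t0 X) (t0 Y)) \ol s + bi2 (bi (t0 X) (t0 Y)) \ol bp2
    (bi (t1 X) (t0 Y)) \ol g),
    (bi1 (bi (t1 X) (t0 Y)) \ol t).
  rewrite [LHS](bip_to (bi (t1 X) (t0 Y))) E /=; lin_expand; zmod.
move=> W G; have [g Gg] := trep_ex G; move/(trep0 (trepM Ff Gg)) => [s [t E]].
(* [E] says that [f \ol g - ta Y \ol s] factors through [tb W], so the pair of [g] and [- s]
   satisfies the equation defining the kernel modulo [tb W]. *)
pose l : lmor (t1 W) (t1 tker) := bi1 (bi (t1 X) (t0 Y)) \ol g - bi2 (bi (t1 X) (t0 Y))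
  \ol s.
have [[g0 g0E] [g2 g2E]] := trep_adm Gg.
have la : tadm (X := W) (Y := tker) l.
  split.
    exists (bi1 (bi (t0 X) (t0 Y)) \ol g0 - bi2 (bi (t0 X) (t0 Y)) \ol s \ol ta W).
    by rewrite /l /=; lin_expand; rewrite g0E.
  exists (bi1 (bi (t2 X) (t1 Y)) \ol g2 + bi2 (bi (t2 X) (t1 Y)) \ol t).
  by rewrite /l /=; lin_expand; rewrite g2E E; lin_expand; zmod.
have [L Ll] := trep_make la; exists L.
apply/(trep_eq (trepM Kk Ll) Gg)/tnull_sub.
by rewrite /l; lin_expand.
Qed.

Lemma tcok_cokernel (F : lmor X Y) (P : lmor Y tcok) :
  trep F f -> trep P (bi1 (bi (t1 Y) (t2 X))) -> cokernel P F.
Proof.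
move=> Ff Pp; split.
- apply/(trep0 (trepM Pp Ff)).
  exists (bi2 (bi (t0 Y) (t1 X))), (- bi2 (bi (t1 Y) (t2 X))); rewrite /=; lin_expand;
    zmod.
- move=> W G; have [g Gg] := trep_ex G; move/(trep0 (trepM Gg Pp)) => [s [t E]].
  apply/(trep0 Gg).
  exists (s \ol bp1 (bi (t1 Y) (t2 X))),
    (t \ol bp1 (bi (t2 Y) (t2 X)) + g \ol bi2 (bi (t1 Y) (t2 X)) \ol bp2
      (bi (t2 Y) (t2 X))).
  rewrite [LHS](bip_from (bi (t1 Y) (t2 X))) E /=; lin_expand; zmod.
move=> W G; have [g Gg] := trep_ex G; move/(trep0 (trepM Gg Ff)) => [s [t E]].
(* On a boundary [(c y0 + f x, b x)] of [tcok], where [c = ta Y] and [b = tb X], this gives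
   [g c y0 + ta W s x] by [E], a boundary of [W]. *)
pose l : lmor (t1 tcok) (t1 W) := g \ol bp1 (bi (t1 Y) (t2 X)) - t \ol bp2
  (bi (t1 Y) (t2 X)).
have [[g0 g0E] [g2 g2E]] := trep_adm Gg.
have la : tadm (X := tcok) (Y := W) l.
  split.
    exists (g0 \ol bp1 (bi (t0 Y) (t1 X)) + s \ol bp2 (bi (t0 Y) (t1 X))).
    rewrite /l /=; lin_expand; rewrite (lcompA_eq _ g0E) (lcompA_eq _ E); lin_expand;
      zmod.
  exists (g2 \ol bp1 (bi (t2 Y) (t2 X)) - tb W \ol t \ol bp2 (bi (t2 Y) (t2 X))).
  by rewrite /l /=; lin_expand; rewrite (lcompA_eq _ g2E); lin_expand.
have [L Ll] := trep_make la; exists L.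
apply/(trep_eq (trepM Ll Pp) Gg)/tnull_sub.
by rewrite /l; lin_expand.
Qed.

End KernelCokernel.

(* [F] is monic iff its kernel vanishes, i.e. iff [bp1] is null on [tker f]; the
   witnesses [s1, s2, r1, r2] of this give an explicit preimage [h] of [g]. *)
Lemma adelman_monic_kernel X Y (F : lmor X Y) f : trep F f -> monic F ->
  forall P : lmor Y (tcok f), trep P (bi1 (bi (t1 Y) (t2 X))) -> kernel F P.
Proof.
move=> Ff Fm P Pp; split=> //; first by have [] := tcok_cokernel Ff Pp.
move=> W G; have [g Gg] := trep_ex G; move/(trep0 (trepM Pp Gg)) => ST.
have {ST} [S [T E]] : exists (S : lmor (t1 W) (bs (bi (t0 Y) (t1 X))))
    (T : lmor (t2 W) (bs (bi (t1 Y) (t2 X)))),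
    bi1 (bi (t1 Y) (t2 X)) \ol g = ta (tcok f) \ol S + T \ol tb W by apply: ST.
have [[g0 g0E] [g2 g2E]] := trep_adm Gg.
have [K Kk] := trep_make (tker_adm f).
have [FK _ _] := tker_kernel Ff Kk.
have [S' [T' E']] : exists (S' : lmor (bs (bi (t1 X) (t0 Y))) (t0 X))
    (T' : lmor (bs (bi (t2 X) (t1 Y))) (t1 X)),
    bp1 (bi (t1 X) (t0 Y)) = ta X \ol S' + T' \ol tb (tker f) by apply/(trep0 Kk)/Fm.
pose s1 := S' \ol bi1 (bi (t1 X) (t0 Y)); pose s2 := S' \ol bi2 (bi (t1 X) (t0 Y)).
pose r1 := T' \ol bi1 (bi (t2 X) (t1 Y)); pose r2 := T' \ol bi2 (bi (t2 X) (t1 Y)).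
have E1 : lidm (t1 X) = ta X \ol s1 + r1 \ol tb X + r2 \ol f.
  by rewrite -(bp11 (bi (t1 X) (t0 Y))) E' /=; lin_expand; rewrite /s1 /r1 /r2;
    lin_expand; zmod.
have E2 : r2 \ol ta Y = - (ta X \ol s2).
  apply/eqP; rewrite -addr_eq0 addrC; apply/eqP.
  by rewrite -(bp12 (bi (t1 X) (t0 Y))) E' /=; lin_expand; rewrite /s2 /r2; lin_expand;
    zmod.
clearbody s1 s2 r1 r2.
pose S0 := bp1 (bi (t0 Y) (t1 X)) \ol S; pose S1 := bp2 (bi (t0 Y) (t1 X)) \ol S.
pose T1 := bp1 (bi (t1 Y) (t2 X)) \ol T; pose T2 := bp2 (bi (t1 Y) (t2 X)) \ol T.
have E3 : f \ol S1 = g - ta Y \ol S0 - T1 \ol tb W.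
  have := congr1 (fun h => bp1 (bi (t1 Y) (t2 X)) \ol h) E; rewrite /=; lin_expand => ->.
  by rewrite /S0 /S1 /T1; lin_expand; zmod.
have E4 : tb X \ol S1 = - (T2 \ol tb W).
  have := congr1 (fun h => bp2 (bi (t1 Y) (t2 X)) \ol h) E; rewrite /=; lin_expand =>
    /esym/eqP.
  by rewrite addr_eq0 /S1 /T2 => /eqP.
clearbody S0 S1 T1 T2.
(* By [E3], [S1] is a preimage of [g] up to null maps. The correction through [tb W] makes it
   admissible: by [E1], [E3] and [E4], [h] equals [ta X \ol s1 \ol S1 + r2 \ol (g - ta Y \ol S0)],
   and [E2] moves [r2 \ol ta Y] into the image of [ta X]. *)
pose h := S1 + (r1 \ol T2 + r2 \ol T1) \ol tb W.
have ha : tadm (X := W) (Y := X) h.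
  split.
    exists (s1 \ol S1 \ol ta W - s2 \ol g0 + s2 \ol S0 \ol ta W).
    rewrite /h lcompDl -[S1 in LHS]lcomp1m E1; lin_expand.
    rewrite (lcompA_eq _ E4) (lcompA_eq _ E3); lin_expand.
    rewrite g0E !(lcompA_eq _ E2); lin_expand; zmod.
  exists (- T2 + tb X \ol (r1 \ol T2 + r2 \ol T1)).
  by rewrite /h; lin_expand; rewrite E4.
have [H Hh] := trep_make ha; exists H.
apply/(trep_eq (trepM Ff Hh) Gg).
exists (- S0), (- T1 + f \ol (r1 \ol T2 + r2 \ol T1)).
rewrite /h; lin_expand; rewrite E3; zmod.
Qed.

(** [F] is epic iff its cokernel vanishes, that is, iff [bi1] into [tcok f] is null; the blocks of
    such a nullity give the factorization of [g]. *)
Lemma adelman_epic_cokernel X Y (F : lmor X Y) f : trep F f -> epic F ->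
  forall K : lmor (tker f) X, trep K (bp1 (bi (t1 X) (t0 Y))) -> cokernel F K.
Proof.
move=> Ff Fe K Kk; split=> //; first by have [] := tker_kernel Ff Kk.
move=> W G; have [g Gg] := trep_ex G; move/(trep0 (trepM Gg Kk)) => ST.
have {ST} [S [T E]] : exists (S : lmor (bs (bi (t1 X) (t0 Y))) (t0 W))
    (T : lmor (bs (bi (t2 X) (t1 Y))) (t1 W)),
    g \ol bp1 (bi (t1 X) (t0 Y)) = ta W \ol S + T \ol tb (tker f) by apply: ST.
have [[g0 g0E] [g2 g2E]] := trep_adm Gg.
have [P Pp] := trep_make (tcok_adm f).
have [PF _ _] := tcok_cokernel Ff Pp.
have [S' [T' E']] : exists (S' : lmor (t1 Y) (bs (bi (t0 Y) (t1 X))))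
    (T' : lmor (t2 Y) (bs (bi (t1 Y) (t2 X)))),
    bi1 (bi (t1 Y) (t2 X)) = ta (tcok f) \ol S' + T' \ol tb Y by apply/(trep0 Pp)/Fe.
pose s1 := bp1 (bi (t0 Y) (t1 X)) \ol S'; pose s2 := bp2 (bi (t0 Y) (t1 X)) \ol S'.
pose r1 := bp1 (bi (t1 Y) (t2 X)) \ol T'; pose r2 := bp2 (bi (t1 Y) (t2 X)) \ol T'.
have E1 : lidm (t1 Y) = ta Y \ol s1 + f \ol s2 + r1 \ol tb Y.
  by rewrite -(bp11 (bi (t1 Y) (t2 X))) E' /=; lin_expand; rewrite /s1 /s2 /r1;
    lin_expand; zmod.
have E2 : tb X \ol s2 = - (r2 \ol tb Y).
  apply/eqP; rewrite -addr_eq0; apply/eqP.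
  by rewrite -(bp21 (bi (t1 Y) (t2 X))) E' /=; lin_expand; rewrite /s2 /r2; lin_expand;
    zmod.
clearbody s1 s2 r1 r2.
pose S1 := S \ol bi1 (bi (t1 X) (t0 Y)); pose S2 := S \ol bi2 (bi (t1 X) (t0 Y)).
pose T1 := T \ol bi1 (bi (t2 X) (t1 Y)); pose T2 := T \ol bi2 (bi (t2 X) (t1 Y)).
have E3 : T2 \ol f = g - ta W \ol S1 - T1 \ol tb X.
  have := congr1 (fun h => h \ol bi1 (bi (t1 X) (t0 Y))) E; rewrite /=; lin_expand => ->.
  by rewrite /S1 /T1 /T2; lin_expand; zmod.
have E4 : T2 \ol ta Y = - (ta W \ol S2).
  have := congr1 (fun h => h \ol bi2 (bi (t1 X) (t0 Y))) E; rewrite /=; lin_expand =>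
    /esym/eqP.
  by rewrite addrC addr_eq0 /S2 /T2 => /eqP.
clearbody S1 S2 T1 T2.
(* [T2] extends [g] along [f] up to null maps, and the correction through [ta W] makes it
   admissible: [h] equals [g \ol s2 + (T1 \ol r2 + T2 \ol r1) \ol tb Y], where [tb W \ol g \ol s2]
   factors through [tb Y] by [g2E] and [E2]. *)
pose h := T2 + ta W \ol (S2 \ol s1 + S1 \ol s2).
have ha : tadm (X := Y) (Y := W) h.
  split.
    exists (- S2 + (S2 \ol s1 + S1 \ol s2) \ol ta Y).
    by rewrite /h; lin_expand; rewrite E4.
  exists (tb W \ol T1 \ol r2 + tb W \ol T2 \ol r1 - g2 \ol r2).
  rewrite /h lcompDr -[T2 in LHS]lcompm1 E1; lin_expand.
  rewrite (lcompA_eq _ E4) (lcompA_eq _ E3); lin_expand.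
  rewrite (lcompA_eq _ g2E); lin_expand; rewrite E2; lin_expand; zmod.
have [H Hh] := trep_make ha; exists H.
apply/(trep_eq (trepM Hh Ff) Gg).
exists (- S1 + (S2 \ol s1 + S1 \ol s2) \ol f), (- T1).
rewrite /h; lin_expand; rewrite E3; zmod.
Qed.

End AdelmanAbelian.

Section AdelmanUniversal.
Context (R : comPzRingType) (B : lin_category R).
Context (z : lobj B) (z0 : lidm z = 0) (bi : forall x y : lobj B, biproduct x y).

Let Ad := adelman B.

Lemma tnull_to_zero (X Y : lobj Ad) (f : lmor (t1 X) (t1 Y)) : lidm (t1 Y) = 0 -> tnull f.
Proof. by move=> Y0; rewrite (to_zero f Y0); apply: tnull0. Qed.

Lemma adelman_zero : lidm (Tri (0 : lmor z z) (0 : lmor z z) : lobj Ad) = 0.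
Proof. by apply/(trep0 (trep1 _))/tnull_to_zero. Qed.

Lemma adelman_biproduct (X Y : lobj Ad) :
  exists (s : lobj Ad) (i1 : lmor X s) (i2 : lmor Y s) (p1 : lmor s X) (p2 : lmor s Y),
    is_biproduct i1 i2 p1 p2.
Proof.
pose b0 := bi (t0 X) (t0 Y); pose b1 := bi (t1 X) (t1 Y); pose b2 := bi (t2 X) (t2 Y).
pose S : lobj Ad := Tri (bi1 b1 \ol ta X \ol bp1 b0 + bi2 b1 \ol ta Y \ol bp2 b0)
             (bi1 b2 \ol tb X \ol bp1 b1 + bi2 b2 \ol tb Y \ol bp2 b1).
have [|i1 i1E] := trep_make (X := X) (Y := S) (f := bi1 b1).
  by split; [exists (bi1 b0) | exists (bi1 b2)]; rewrite /=; lin_expand.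
have [|i2 i2E] := trep_make (X := Y) (Y := S) (f := bi2 b1).
  by split; [exists (bi2 b0) | exists (bi2 b2)]; rewrite /=; lin_expand.
have [|p1 p1E] := trep_make (X := S) (Y := X) (f := bp1 b1).
  by split; [exists (bp1 b0) | exists (bp1 b2)]; rewrite /=; lin_expand.
have [|p2 p2E] := trep_make (X := S) (Y := Y) (f := bp2 b1).
  by split; [exists (bp2 b0) | exists (bp2 b2)]; rewrite /=; lin_expand.
exists S, i1, i2, p1, p2; split.
- by apply: trep_uniq (trep1 X); rewrite -(bp11 b1); apply: trepM.
- by apply: trep_uniq (trep1 Y); rewrite -(bp22 b1); apply: trepM.
- by apply: trep_uniq (trep_zero _ _); rewrite -(bp21 b1); apply: trepM.
- by apply: trep_uniq (trep_zero _ _); rewrite -(bp12 b1); apply: trepM.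
- by apply: trep_uniq (trep1 S); rewrite -(bip b1); apply: trepD; apply: trepM.
Qed.

Lemma adelman_abelian : is_abelian Ad.
Proof.
split.
- by exists (Tri (0 : lmor z z) (0 : lmor z z));
  apply/(zero_objectP (A := Ad))/adelman_zero.
- exact: adelman_biproduct.
- move=> X Y F; have [f Ff] := trep_ex F; have [K Kk] := trep_make (tker_adm bi f).
  by exists (tker bi f), K; apply/kernelP/(tker_kernel Ff Kk).
- move=> X Y F; have [f Ff] := trep_ex F; have [K Kk] := trep_make (tcok_adm bi f).
  by exists (tcok bi f), K; apply/cokernelP/(tcok_cokernel Ff Kk).
- move=> X Y F /monoP Fm; have [f Ff] := trep_ex F; have [K Kk] := trep_make
  (tcok_adm bi f).
  by exists (tcok bi f), K; apply/kernelP/(adelman_monic_kernel Ff Fm Kk).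
- move=> X Y F /epiP Fm; have [f Ff] := trep_ex F; have [K Kk] := trep_make
  (tker_adm bi f).
  by exists (tker bi f), K; apply/cokernelP/(adelman_epic_cokernel Ff Fm Kk).
Qed.

Definition adelman_ab : ab_category R := AbCategory adelman_abelian.

Definition tcls (X Y : lobj Ad) (f : lmor (t1 X) (t1 Y)) (fa : tadm f) : lmor X Y :=
  qmor (P := tpre_lin B) (exist _ f fa).

Lemma tclsP (X Y : lobj Ad) (f : lmor (t1 X) (t1 Y)) (fa : tadm f) : trep (tcls fa) f.
Proof. by exists fa. Qed.

(** With a zero object at both ends, the subquotient that the triple stands for is all of [x]. *)
Definition tiota_obj (x : lobj B) : lobj Ad := Tri (0 : lmor z x) (0 : lmor x z).

Lemma tiota_adm x y (f : lmor x y) : tadm (X := tiota_obj x) (Y := tiota_obj y) f.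
Proof. by split; exists 0; rewrite /= !(lcomp0l, lcomp0r). Qed.

Definition tiota : functor B adelman_ab.
Proof.
exists (tiota_obj : B -> adelman_ab) (fun x y f => tcls (tiota_adm f)).
- move=> x; apply: (trep_uniq (tclsP _)).
  exact: (trep1 (tiota_obj x)).
- move=> x y w g f; apply: (trep_uniq (tclsP _)).
  by apply: trepM; apply: tclsP.
Defined.

Lemma tiotaP x y (f : lmor x y) : trep (lfmap tiota f : lmor (tiota_obj x)
    (tiota_obj y)) f.
Proof. exact: tclsP. Qed.

Lemma tiota_linear : is_linear_functor tiota.
Proof.
move=> x y a f g; apply: (trep_uniq (tclsP _)).
by apply: trepD; [apply: trepZ|]; apply: tclsP.
Qed.

Section CanonicalSubquotient.
Context (X : lobj Ad).

Let KX : lobj Ad := Tri (0 : lmor z (t1 X)) (tb X).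
Let QX : lobj Ad := Tri (ta X) (0 : lmor (t1 X) z).

Let k_adm : tadm (X := KX) (Y := tiota_obj (t1 X)) (lidm (t1 X)).
Proof.
split; first by exists (lidm z); rewrite /= lcomp0l lcomp1m.
by exists 0; rewrite /= !lcomp0l.
Qed.

Let q_adm : tadm (X := tiota_obj (t1 X)) (Y := QX) (lidm (t1 X)).
Proof.
split; first by exists 0; rewrite /= !lcomp0r.
by exists (lidm z); rewrite /= lcompm1 lcomp1m.
Qed.

Let e_adm : tadm (X := KX) (Y := X) (lidm (t1 X)).
Proof.
split; first by exists 0; rewrite /= !lcomp0r.
by exists (lidm _); rewrite /= lcompm1 lcomp1m.
Qed.

Let m_adm : tadm (X := X) (Y := QX) (lidm (t1 X)).
Proof.
split; first by exists (lidm _); rewrite /= lcompm1 lcomp1m.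
by exists 0; rewrite /= !lcomp0l.
Qed.

Let k_kernel : kernel (tcls k_adm) (lfmap tiota (tb X) : lmor (tiota_obj (t1 X))
  (tiota_obj (t2 X))).
Proof.
split.
- apply/(trep0 (trepM (tiotaP _) (tclsP k_adm))).
  by exists 0, (lidm _); rewrite /= lcomp0r add0r lcomp1m lcompm1.
- move=> W G; have [g Gg] := trep_ex G; move/(trep0 (trepM (tclsP k_adm) Gg)) =>
  [s [t E]].
  by apply/(trep0 Gg); exists s, t; rewrite -E lcomp1m.
move=> W G; have [g Gg] := trep_ex G; move/(trep0 (trepM (tiotaP _) Gg)) => [s [t E]].
have ga : tadm (X := W) (Y := KX) g.
  split; first by have [] := trep_adm Gg.
  by exists t; rewrite E lcomp0l add0r.
exists (tcls ga); apply: trep_uniq Gg; rewrite -[X in trep _ X]lcomp1m.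
exact: trepM (tclsP _) (tclsP _).
Qed.

Let q_cokernel : cokernel (tcls q_adm) (lfmap tiota (ta X) : lmor (tiota_obj (t0 X))
  (tiota_obj (t1 X))).
Proof.
split.
- apply/(trep0 (trepM (tclsP q_adm) (tiotaP _))).
  by exists (lidm _), 0; rewrite /= lcomp0l addr0 lcomp1m lcompm1.
- move=> W G; have [g Gg] := trep_ex G; move/(trep0 (trepM Gg (tclsP q_adm))) =>
  [s [t E]].
  by apply/(trep0 Gg); exists s, t; rewrite -E lcompm1.
move=> W G; have [g Gg] := trep_ex G; move/(trep0 (trepM Gg (tiotaP _))) => [s [t E]].
have ga : tadm (X := QX) (Y := W) g.
  split; last by have [] := trep_adm Gg.
  by exists s; rewrite E lcomp0r addr0.
exists (tcls ga); apply: trep_uniq Gg; rewrite -[X in trep _ X]lcompm1.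
exact: trepM (tclsP _) (tclsP _).
Qed.

Let e_epic : epic (tcls e_adm).
Proof.
move=> W G; have [g Gg] := trep_ex G; move/(trep0 (trepM Gg (tclsP e_adm))) => [s [t E]].
by apply/(trep0 Gg); exists s, t; rewrite -E lcompm1.
Qed.

Let m_monic : monic (tcls m_adm).
Proof.
move=> W G; have [g Gg] := trep_ex G; move/(trep0 (trepM (tclsP m_adm) Gg)) => [s [t E]].
by apply/(trep0 Gg); exists s, t; rewrite -E lcomp1m.
Qed.

Let mq : tcls m_adm \ol tcls e_adm = tcls q_adm \ol tcls k_adm.
Proof.
exact: (trep_uniq (trepM (tclsP m_adm) (tclsP e_adm))
  (trepM (tclsP q_adm) (tclsP k_adm))).
Qed.

(** Inside the Adelman category, [X] is the very subquotient that it stands for, and all four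
    structure maps are represented by the identity of [t1 X]. Exact functors preserve subquotients,
    so their values and transformations are controlled by what happens along [tiota]. *)
Definition tsq : subquotient (A := adelman_ab)
    (lfmap tiota (ta X) : lmor (tiota_obj (t0 X)) (tiota_obj (t1 X)))
    (lfmap tiota (tb X) : lmor (tiota_obj (t1 X)) (tiota_obj (t2 X))) :=
  Subquotient k_kernel q_cokernel e_epic m_monic mq.

Lemma tsqe_rep : trep (sqe tsq : lmor _ X) (lidm (t1 X)).
Proof. exact: tclsP. Qed.
Lemma tsqm_rep : trep (sqm tsq : lmor X _) (lidm (t1 X)).
Proof. exact: tclsP. Qed.
Lemma tsqk_rep : trep (sqk tsq) (lidm (t1 X)).
Proof. exact: tclsP. Qed.
Lemma tsqq_rep : trep (sqq tsq) (lidm (t1 X)).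
Proof. exact: tclsP. Qed.

End CanonicalSubquotient.

Lemma trep_sq_rep (X Y : lobj Ad) (F : lmor X Y) f : trep F f ->
  sq_rep (A := adelman_ab) (s := tsq X) (s' := tsq Y)
    (lfmap tiota f : lmor (tiota_obj (t1 X)) (tiota_obj (t1 Y))) F.
Proof.
move=> Ff.
apply: trep_uniq (trepM (trepM (tsqm_rep Y) Ff) (tsqe_rep X)) _.
exact: trepM (trepM (tsqq_rep Y) (tiotaP f)) (tsqk_rep X).
Qed.

End AdelmanUniversal.

(** * Exact functors out of the Adelman category *)

Lemma sq_lift (R : comPzRingType) (A : ab_category R) (x0 x1 x2 : lobj A)
  (a : lmor x0 x1) (b : lmor x1 x2) (s : subquotient a b) w (x : lmor w x1) :
  b \ol x = 0 -> exists u : lmor w (sqK s), sqk s \ol u = x.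
Proof. by have [_ _ kU] := sqkP s; apply: kU. Qed.

Section SubquotientExactness.
Context (R : comPzRingType) (A : ab_category R).
Context (x0 x1 x2 y0 y1 y2 : lobj A) (a : lmor x0 x1) (b : lmor x1 x2)
  (c : lmor y0 y1) (d : lmor y1 y2) (f : lmor x1 y1).

(** [a'] and [b'] are the block matrices of [tcok]. A cycle of [sZ] is a pair [(y, 0)] with
    [d y = 0], which gives surjectivity of [P]; it is a boundary when [y = c y0 + f x] with
    [b x = 0], so the class of [y] is then the image under [F] of the class of [x]. *)
Lemma sq_cokernel_exact (f2 : lmor x2 y2)
  (b0 : biproduct y0 x1) (b1 : biproduct y1 x2) (b2 : biproduct y2 x2)
  (a' : lmor (bs b0) (bs b1)) (b' : lmor (bs b1) (bs b2))
  (sX : subquotient a b) (sY : subquotient c d) (sZ : subquotient a' b')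
  (F : lmor (sqI sX) (sqI sY)) (P : lmor (sqI sY) (sqI sZ)) :
  d \ol f = f2 \ol b ->
  a' = bi1 b1 \ol (c \ol bp1 b0 + f \ol bp2 b0) + bi2 b1 \ol b \ol bp2 b0 ->
  b' = bi1 b2 \ol d \ol bp1 b1 + bi2 b2 \ol bp2 b1 ->
  sq_rep f F -> sq_rep (bi1 b1) P -> epic P /\ exact_at F P.
Proof.
move=> f2E a'E b'E Ff Pp.
have pb1 : bp1 b2 \ol b' = d \ol bp1 b1 by rewrite b'E; lin_expand.
have pb2 : bp2 b2 \ol b' = bp2 b1 by rewrite b'E; lin_expand.
have bi1' : b' \ol bi1 b1 = bi1 b2 \ol d by rewrite b'E; lin_expand.
have pa1 : bp1 b1 \ol a' = c \ol bp1 b0 + f \ol bp2 b0 by rewrite a'E; lin_expand.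
have pa2 : bp2 b1 \ol a' = b \ol bp2 b0 by rewrite a'E; lin_expand.
split.
  have [w [p [u [pe pE uE]]]] := sq_elt (lidm (sqI sZ)).
  rewrite lcomp1m in pE.
  have u1 : d \ol (bp1 b1 \ol (sqk sZ \ol u)) = 0.
    by rewrite lcompA -pb1 -lcompA uE lcomp0r.
  have u2 : bp2 b1 \ol (sqk sZ \ol u) = 0.
    by rewrite -pb2 -lcompA uE lcomp0r.
  have [v vE] := sq_lift sY u1.
  apply: (epic_lift (u := sqe sY \ol v) pe).
  rewrite pE; apply: (sq_rep_elt Pp).
  by rewrite vE [RHS](bip_to b1) u2 lcomp0r addr0.
move=> w v Pv.
have [w1 [p [u [pe pE uE]]]] := sq_elt v.
have [|Pu PuE] := sq_lift sZ (x := bi1 b1 \ol (sqk sY \ol u)).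
  by rewrite lcompA bi1' -lcompA uE lcomp0r.
have Pu0 : sqe sZ \ol Pu = 0.
  by rewrite -(sq_rep_elt Pp (esym PuE)) -pE lcompA Pv lcomp0l.
have [w2 [p2 [y [p2e yE]]]] := sq_elt_exact Pu0.
have yE1 : sqk sY \ol u \ol p2 = c \ol (bp1 b0 \ol y) + f \ol (bp2 b0 \ol y).
  rewrite !lcompA -lcompDl -pa1 -[_ \ol y in RHS]lcompA -yE PuE.
  by rewrite -[in RHS]lcompA bp11A.
have yE2 : b \ol (bp2 b0 \ol y) = 0.
  by rewrite lcompA -pa2 -lcompA -yE PuE -lcompA bp21A.
have [u2 u2E] := sq_lift sX yE2.
have [|u3 u3E] := sq_lift sY (x := f \ol (bp2 b0 \ol y)).
  by rewrite lcompA f2E -lcompA yE2 lcomp0r.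
exists w2, (p \ol p2), (sqe sX \ol u2); split; first exact: epic_comp.
rewrite (sq_rep_elt (v' := u3) Ff); last by rewrite u2E.
rewrite lcompA pE -lcompA; apply/eqP; rewrite -subr_eq0 -lcompBr; apply/eqP.
apply: (sq_elt_eq0 (u := bp1 b0 \ol y)).
by rewrite lcompBr lcompA yE1 u3E addrK.
Qed.

(** [a'] and [b'] are the block matrices of [tker]. If the first component of a cycle [(x, y)] is a
    boundary [a x0], then [(x, y)] is the boundary of [(x0, y)]. *)
Lemma sq_kernel_monic
  (b0 : biproduct x0 y0) (b1 : biproduct x1 y0) (b2 : biproduct x2 y1)
  (a' : lmor (bs b0) (bs b1)) (b' : lmor (bs b1) (bs b2))
  (sX : subquotient a b) (sN : subquotient a' b') (K : lmor (sqI sN) (sqI sX)) :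
  a' = bi1 b1 \ol a \ol bp1 b0 + bi2 b1 \ol bp2 b0 ->
  b' = bi1 b2 \ol b \ol bp1 b1 + bi2 b2 \ol (f \ol bp1 b1 + c \ol bp2 b1) ->
  sq_rep (bp1 b1) K -> monic K.
Proof.
move=> a'E b'E Kk w v Kv.
have pb1 : bp1 b2 \ol b' = b \ol bp1 b1 by rewrite b'E; lin_expand.
have aE w' (y : lmor w' x0) (v' : lmor w' y0) :
  a' \ol (bi1 b0 \ol y + bi2 b0 \ol v') = bi1 b1 \ol (a \ol y) + bi2 b1 \ol v'.
  by rewrite a'E; lin_expand.
have [w1 [p [u [pe pE uE]]]] := sq_elt v.
have uE1 : b \ol (bp1 b1 \ol (sqk sN \ol u)) = 0.
  by rewrite lcompA -pb1 -lcompA uE lcomp0r.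
have [u1 u1E] := sq_lift sX uE1.
have u10 : sqe sX \ol u1 = 0.
  rewrite -(sq_rep_elt (v := u) Kk); last by rewrite u1E.
  by rewrite -pE lcompA Kv lcomp0l.
have [w2 [p2 [y [p2e yE]]]] := sq_elt_exact u10.
apply: pe; apply: p2e; rewrite pE -lcompA.
apply: (sq_elt_eq0 (u := bi1 b0 \ol y + bi2 b0 \ol (bp2 b1 \ol (sqk sN \ol u) \ol p2))).
by rewrite aE -yE u1E -!lcompA [LHS](bip_to b1).
Qed.

End SubquotientExactness.

Section AdelmanExtension.
Context (R : comPzRingType) (B : lin_category R).
Context (z : lobj B) (z0 : lidm z = 0) (bi : forall x y : lobj B, biproduct x y).
Context (A : ab_category R).

Let Ad : ab_category R := adelman_ab z0 bi.
Let iota : functor B Ad := tiota z0 bi.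

Section Existence.
Context (S : functor B A) (Slin : is_linear_functor S).

Definition esq (X : lobj Ad) : subquotient (lfmap S (ta X)) (lfmap S (tb X)) :=
  sval (cid (ex_subquotient (lfmap S (ta X)) (lfmap S (tb X)))).

Definition eobj (X : lobj Ad) : lobj A := sqI (esq X).

Lemma lfmap_adm (X Y : lobj Ad) (f : lmor (t1 X) (t1 Y)) : tadm (X := X) (Y := Y) f ->
  (exists f0, lfmap S f \ol lfmap S (ta X) = lfmap S (ta Y) \ol f0) /\
  (exists f2, lfmap S (tb Y) \ol lfmap S f = f2 \ol lfmap S (tb X)).
Proof.
move=> [[f0 f0E] [f2 f2E]]; split.
  by exists (lfmap S f0); rewrite -!lfmapM f0E.
by exists (lfmap S f2); rewrite -!lfmapM f2E.
Qed.

Let erep (X Y : lobj Ad) (f : lmor (t1 X) (t1 Y)) (h : lmor (eobj X) (eobj Y)) :=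
  sq_rep (s := esq X) (s' := esq Y) (lfmap S f) h.

Lemma emap_ex (X Y : lobj Ad) (F : lmor X Y) : exists h, exists2 f, trep F f & erep f h.
Proof.
have [f Ff] := trep_ex F.
have [[f0 f0E] [f2 f2E]] := lfmap_adm (trep_adm Ff).
by have [h hE] := sq_rep_ex (esq X) (esq Y) f0E f2E; exists h, f.
Qed.

Definition emap (X Y : lobj Ad) (F : lmor X Y) : lmor (eobj X) (eobj Y) :=
  sval (cid (emap_ex F)).

(** Two representatives differ by some [ta Y \ol s + t \ol tb X]. Between the kernel of [tb X] and
    the cokernel of [ta Y] both terms vanish, so the induced map does not depend on the
    representative. *)
Lemma emapP (X Y : lobj Ad) (F : lmor X Y) f : trep F f -> erep f (emap F).
Proof.
rewrite /emap; case: cid => h /= [f' Ff' H] Ff; rewrite /erep /sq_rep H.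
have [s [t E]] := (trep_eq Ff' Ff).1 erefl.
have -> : f' = f + (ta Y \ol s + t \ol tb X) by rewrite -E addrC subrK.
have [kX _ _] := sqkP (esq X); have [qY _ _] := sqqP (esq Y).
rewrite !(lfmapD Slin) !lfmapM lcompDr lcompDl lcompDr lcompDl.
by rewrite [sqq _ \ol (_ \ol lfmap S s)]lcompA qY !lcomp0l -!lcompA kX !lcomp0r !addr0.
Qed.

Definition efunctor : functor Ad A.
Proof.
exists (eobj : Ad -> A) emap.
- move=> X; apply: (sq_rep_unique (emapP (trep1 X))).
  by rewrite lfmap1; apply: sq_rep_id.
- move=> X Y Z G F; have [g Gg] := trep_ex G; have [f Ff] := trep_ex F.
  apply: (sq_rep_unique (emapP (trepM Gg Ff))).
  have [_ [f2 f2E]] := lfmap_adm (trep_adm Ff).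
  rewrite lfmapM.
  exact: (sq_rep_comp f2E (emapP Ff) (emapP Gg)).
Defined.

Lemma efunctor_linear : is_linear_functor efunctor.
Proof.
move=> X Y a F G; have [g Gg] := trep_ex G; have [f Ff] := trep_ex F.
apply: (sq_rep_unique (emapP (trepD (trepZ a Ff) Gg))).
rewrite /sq_rep (lfmapD Slin) (lfmapZ Slin) !(lcompDr, lcompDl, lcompZr, lcompZl).
by rewrite (emapP Ff) (emapP Gg).
Qed.

Let Sl := (lfmapM S, lfmapD Slin).

Lemma lfmap_bp (x y : lobj B) (b : biproduct x y) :
  is_biproduct (lfmap S (bi1 b)) (lfmap S (bi2 b)) (lfmap S (bp1 b)) (lfmap S (bp2 b)).
Proof.
by split; rewrite -!lfmapM -?(lfmapD Slin) ?(bp11, bp22, bp21, bp12, bip) ?lfmap1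
  ?(lfmap0 Slin).
Qed.

Definition lfmap_biproduct (x y : lobj B) (b : biproduct x y) : biproduct (A := A) (S x)
    (S y) :=
  Biproduct (lfmap_bp b).

Lemma efunctor_cokernel (X Y : lobj Ad) (F : lmor X Y) f (P : lmor Y (tcok bi f)) :
  trep F f -> trep P (bi1 (bi (t1 Y) (t2 X))) ->
  epic (emap P) /\ exact_at (emap F) (emap P).
Proof.
move=> Ff Pp; have [_ [f2 f2E]] := lfmap_adm (trep_adm Ff).
apply: (sq_cokernel_exact (c := lfmap S (ta Y)) (f := lfmap S f)
  (b0 := lfmap_biproduct (bi (t0 Y) (t1 X))) (b1 := lfmap_biproduct (bi (t1 Y) (t2 X)))
  (b2 := lfmap_biproduct (bi (t2 Y) (t2 X))) (sX := esq X) (sY := esq Y)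
  (sZ := esq (tcok bi f)) f2E _ _ (emapP Ff) (emapP Pp)); by rewrite /= !Sl.
Qed.

Lemma efunctor_kernel (X Y : lobj Ad) (F : lmor X Y) f (K : lmor (tker bi f) X) :
  trep F f -> trep K (bp1 (bi (t1 X) (t0 Y))) -> monic (emap K).
Proof.
move=> Ff Kk.
apply: (sq_kernel_monic (c := lfmap S (ta Y)) (f := lfmap S f)
  (b0 := lfmap_biproduct (bi (t0 X) (t0 Y))) (b1 := lfmap_biproduct (bi (t1 X) (t0 Y)))
  (b2 := lfmap_biproduct (bi (t2 X) (t1 Y))) (sX := esq X)
  (sN := esq (tker bi f)) _ _ (emapP Kk)); by rewrite /= !Sl.
Qed.

(** In a short exact sequence, [G] is isomorphic to the explicit cokernel of [F], and [F] to the
    explicit kernel of [G]; the chases for the block matrices then supply exactness. *)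
Lemma efunctor_exact : is_exact_linear efunctor.
Proof.
split; first exact: efunctor_linear.
move=> X Y Z F G /short_exactP[FG GF].
have [f Ff] := trep_ex F; have [g Gg] := trep_ex G.
have [P Pp] := trep_make (tcok_adm bi f); have [K Kk] := trep_make (tker_adm bi g).
have [s [si sE]] := cokernel_unique GF (tcok_cokernel Ff Pp).
have [t [ti tE]] := kernel_unique FG (tker_kernel Gg Kk).
have [Pe FPx] := efunctor_cokernel Ff Pp; have Km := efunctor_kernel Gg Kk.
have sm : monic (emap s) by apply/iso_monic/(functor_iso efunctor si).
have se : epic (emap s) by apply/iso_epic/(functor_iso efunctor si).
have tm : monic (emap t) by apply/iso_monic/(functor_iso efunctor ti).
have GE : emap G = emap s \ol emap P by rewrite -sE; apply: (fmapM efunctor).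
have FE : emap F = emap K \ol emap t by rewrite -tE; apply: (fmapM efunctor).
apply: short_exact_intro.
- have [GF0 _ _] := GF.
  by rewrite -[_ \ol _](fmapM efunctor G F) [_ \oc _]GF0; apply: (lfmap0 efunctor_linear).
- by rewrite [fmap _ _]FE; apply: monic_comp.
- move=> w v; rewrite [fmap _ _]GE -lcompA => /sm; exact: FPx.
- by rewrite [fmap _ _]GE; apply: epic_comp.
Qed.

(** Both ends of the row of [iota x] map to zero arrows, so [S x] with identity maps is another
    subquotient of the same row as [esq (iota x)], and two subquotients of one row are
    isomorphic. *)
Lemma efunctor_iota : exists c : forall x : lobj B, lmor (eobj (iota x)) (S x),
  (forall x, is_iso (C := A) (c x)) /\
  (forall x y (f : lmor x y), c y \ol emap (lfmap iota f) = lfmap S f \ol c x).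
Proof.
have k x : kernel (lidm (S x)) (lfmap S (0 : lmor x z)).
  rewrite (lfmap0 Slin); split; [by rewrite lcomp0l | exact: monic_id |].
  by move=> w g _; exists g; rewrite lcomp1m.
have q x : cokernel (lidm (S x)) (lfmap S (0 : lmor z x)).
  rewrite (lfmap0 Slin); split; [by rewrite lcomp0r | exact: epic_id |].
  by move=> w g _; exists g; rewrite lcompm1.
pose s x := Subquotient (k x) (q x) (epic_id (x := S x)) (monic_id (x := S x)) erefl.
have ex x : exists c, sq_rep (s := esq (iota x)) (s' := s x) (lidm (S x)) c.
  by apply: (sq_rep_ex _ _ (a0 := lidm _) (a2 := lidm _)); rewrite lcompm1 lcomp1m.
exists (fun x => sval (cid (ex x))); split=> [x | x y f].
  by case: cid => c /=; apply: sq_rep_iso.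
case: cid => c /= cP; case: cid => d /= dP.
have [_ [f2 f2E]] := lfmap_adm (tiota_adm z f).
have H1 := sq_rep_comp f2E (emapP (tiotaP z0 bi f)) cP.
have H2 : sq_rep (s := s x) (s' := s y) (lfmap S f) (lfmap S f) by [].
have E : lfmap S (0 : lmor x z) \ol lidm (S x) = lidm (S z) \ol lfmap S (0 : lmor x z).
  by rewrite lcompm1 lcomp1m.
have H3 := sq_rep_comp E dP H2.
rewrite lcomp1m in H1; rewrite lcompm1 in H3; exact: sq_rep_unique H1 H3.
Qed.

End Existence.

End AdelmanExtension.

(** * Transformations between exact functors on the Adelman category *)

Section Transformations.
Context (R : comPzRingType) (B : lin_category R).
Context (z : lobj B) (z0 : lidm z = 0) (bi : forall x y : lobj B, biproduct x y).
Context (A : ab_category R).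

Let Ad : ab_category R := adelman_ab z0 bi.
Let iota : functor B Ad := tiota z0 bi.

Section MapSubquotient.
Context (A1 A2 : ab_category R) (G : functor A1 A2) (Gex : is_exact_linear G).
Context (x0 x1 x2 : lobj A1) (f : lmor x0 x1) (g : lmor x1 x2) (s : subquotient f g).

Lemma sq_map_eq : lfmap G (sqm s) \ol lfmap G (sqe s) = lfmap G (sqq s) \ol lfmap G
    (sqk s).
Proof. by rewrite -!lfmapM sqE. Qed.

Definition sq_map : subquotient (lfmap G f) (lfmap G g) :=
  Subquotient (exact_preserves_kernel Gex (sqkP s))
    (exact_preserves_cokernel Gex (sqqP s))
    (exact_epic Gex (sqeP s)) (exact_monic Gex (sqmP s)) sq_map_eq.
End MapSubquotient.

Lemma nat_sq_rep (A1 A2 : ab_category R) (G G' : functor A1 A2) (Gex : is_exact_linear G)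
  (Gex' : is_exact_linear G') (b : nat_trans G G')
  (x0 x1 x2 : lobj A1) (f : lmor x0 x1) (g : lmor x1 x2) (s : subquotient f g) :
  sq_rep (s := sq_map Gex s) (s' := sq_map Gex' s) (b x1) (b (sqI s)).
Proof.
pose bN y w (h : lmor (l := A1) y w) : b w \ol lfmap G h = lfmap G' h \ol b y := ntP b h.
by rewrite /sq_rep /= -!lcompA !bN !lcompA -!lfmapM sqE.
Qed.

Lemma sq_rep_map (A1 A2 : ab_category R) (G : functor A1 A2) (Gex : is_exact_linear G)
  (x0 x1 x2 y0 y1 y2 : lobj A1) (f : lmor x0 x1) (g : lmor x1 x2) (s : subquotient f g)
  (f' : lmor y0 y1) (g' : lmor y1 y2) (s' : subquotient f' g') a
    (h : lmor (sqI s) (sqI s')) :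
  sq_rep a h -> sq_rep (s := sq_map Gex s) (s' := sq_map Gex s') (lfmap G a) (lfmap G h).
Proof. by rewrite /sq_rep /= -!lfmapM => ->. Qed.

Section TransformationExtension.
Context (G G' : functor Ad A) (Gex : is_exact_linear G) (Gex' : is_exact_linear G').

Let sG X := sq_map Gex (tsq z0 bi X).
Let sG' X := sq_map Gex' (tsq z0 bi X).

Lemma tsq_nat_sq_rep (b : nat_trans G G') (X : lobj Ad) :
  sq_rep (s := sG X) (s' := sG' X) (b (iota (t1 X))) (b X).
Proof. exact: (nat_sq_rep Gex Gex' b (tsq z0 bi X)). Qed.

Lemma adelman_nat_unique (b b' : nat_trans G G') :
  (forall x, b (iota x) = b' (iota x)) -> b = b'.
Proof.
move=> bb'; apply: nat_trans_eq => X.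
by apply: sq_rep_unique (tsq_nat_sq_rep b X) _; rewrite bb'; apply: tsq_nat_sq_rep.
Qed.

(** Naturality of [a] at [ta X] and [tb X] is exactly the ladder needed for [a (t1 X)] to induce a
    map of subquotients. Naturality of the extension holds because both composites are induced by
    equal middle maps. *)
Lemma adelman_nat_extend (a : forall x : lobj B, lmor (G (iota x)) (G' (iota x))) :
  (forall x y (f : lmor x y), a y \ol lfmap G (lfmap iota f) = lfmap G' (lfmap iota f)
    \ol a x) ->
  exists b : nat_trans G G', forall x, b (iota x) = a x.
Proof.
move=> aN.
have ex X : exists b, sq_rep (s := sG X) (s' := sG' X) (a (t1 X)) b.
  by apply: sq_rep_ex; [exact: aN | exact: esym (aN _ _ _)].
pose b X := sval (cid (ex X)).
have bP X : sq_rep (s := sG X) (s' := sG' X) (a (t1 X)) (b X) by apply: svalP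
    (cid (ex X)).
have mapP (K : functor Ad A) (Kex : is_exact_linear K) X Y (F : lmor X Y) f : trep F f ->
  sq_rep (s := sq_map Kex (tsq z0 bi X)) (s' := sq_map Kex (tsq z0 bi Y))
    (lfmap K (lfmap iota f)) (lfmap K F).
  by move=> /(trep_sq_rep z0 bi); apply: sq_rep_map.
have bN (X Y : Ad) (F : mor X Y) :
    (b Y : mor (G Y) (G' Y)) \oc fmap G F = fmap G' F \oc (b X : mor (G X) (G' X)).
  have [f Ff] := trep_ex F.
  have [_ [f2 f2E]] := trep_adm Ff.
  have E : lfmap G (lfmap iota (tb Y)) \ol lfmap G (lfmap iota f) =
           lfmap G (lfmap iota f2) \ol lfmap G (lfmap iota (tb X)).
    by rewrite -!lfmapM f2E.
  have H1 := sq_rep_comp E (mapP G Gex _ _ _ _ Ff) (bP Y).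
  have H2 := sq_rep_comp (esym (aN _ _ (tb X))) (bP X) (mapP G' Gex' _ _ _ _ Ff).
  by apply: sq_rep_unique H1 _; rewrite aN.
exists (@NatTrans _ _ G G' b bN) => x /=.
(* On an object [iota x] the four structure maps of the canonical subquotient are identities, so the
   equation defining [b] reads [b (iota x) = a x]. *)
have idE (F : lmor (iota x) (iota x)) : trep F (lidm x) -> F = lidm (l := Ad) (iota x).
  by move=> /trep_uniq; apply; apply: (trep1 (iota x : lobj (adelman B))).
have idG (K : functor Ad A) (F : lmor (iota x) (iota x)) : trep F (lidm x) -> lfmap K F
    = lidm (K (iota x)).
  by move=> /idE ->; apply: lfmap1.
have E1 : sqm (sG' (iota x)) = lidm (G' (iota x)) := idG _ _ (tsqm_rep z0 bi (iota x)).
have E2 : sqe (sG (iota x)) = lidm (G (iota x)) := idG _ _ (tsqe_rep z0 bi (iota x)).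
have E3 : sqq (sG' (iota x)) = lidm (G' (iota x)) := idG _ _ (tsqq_rep z0 bi (iota x)).
have E4 : sqk (sG (iota x)) = lidm (G (iota x)) := idG _ _ (tsqk_rep z0 bi (iota x)).
have := bP (iota x); rewrite /sq_rep E1 E2 E3 E4.
by rewrite !lcompm1 !lcomp1m.
Qed.

End TransformationExtension.
End Transformations.

(** * Transformations between linear functors on the free additive category *)

Section ExpressionTransformations.
Context (R : comPzRingType) (C : category) (A : lin_category R).
Context (T T' : functor (xcat R C) A).
Hypothesis (Tlin : is_linear_functor T) (Tlin' : is_linear_functor T').

Local Notation in1 a b := (xclass (XIn1 R a b)).
Local Notation in2 a b := (xclass (XIn2 R a b)).
Local Notation pr1 a b := (xclass (XPr1 R a b)).
Local Notation pr2 a b := (xclass (XPr2 R a b)).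

Lemma xcat_nat_unique (b b' : nat_trans T T') :
  (forall i x, b (XGen i x) = b' (XGen i x)) -> b = b'.
Proof.
move=> bb'; apply: nat_trans_eq; elim=> [i x||c Ec d Ed]; first exact: bb'.
  have T0 : lidm (T (XZero C)) = 0 by rewrite -lfmap1 xzeroP lfmap0.
  by rewrite (from_zero (b (XZero C)) T0) (from_zero (b' (XZero C)) T0).
have H (e : nat_trans T T') : e (XSum c d) = e (XSum c d) \ol
  (lfmap T (in1 c d) \ol lfmap T (pr1 c d) + lfmap T (in2 c d) \ol lfmap T (pr2 c d)).
  have [_ _ _ _ E] := xsumP R c d.
  by rewrite -!lfmapM -(lfmapD Tlin) E lfmap1 lcompm1.
pose eN (e : nat_trans T T') Y Z (F : lmor (l := xcat R C) Y Z) :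
  e Z \ol lfmap T F = lfmap T' F \ol e Y := ntP e F.
by rewrite (H b) (H b') !lcompDr !lcompA !eN Ec Ed.
Qed.

Context (a : forall i x, lmor (T (XGen i x)) (T' (XGen i x))).
Hypothesis aN : forall i x y (f : @mor C x y),
  a i y \ol lfmap T (xclass (XMor R i f)) = lfmap T' (xclass (XMor R i f)) \ol a i x.

Fixpoint xext (c : xobj C) : lmor (T c) (T' c) :=
  match c with
  | XGen i x => a i x
  | XZero => 0
  | XSum c d => lfmap T' (in1 c d) \ol xext c \ol lfmap T (pr1 c d) +
                lfmap T' (in2 c d) \ol xext d \ol lfmap T (pr2 c d)
  end.

(** Induction on an expression representing [f]: naturality is stable under every operation, and for
    injections and projections it is the biproduct identities. *)
Lemma xext_nat c d (f : lmor (l := xcat R C) c d) : xext d \ol lfmap T f = lfmap T' f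
    \ol xext c.
Proof.
have [{f}e ->] := xclass_onto f; elim: e => {c d}.
- by move=> i x y f; apply: aN.
- by move=> c; rewrite xclass1 !lfmap1 lcomp1m lcompm1.
- by move=> b c d g Eg f Ef; rewrite xclassM !lfmapM lcompA Eg -!lcompA Ef.
- by move=> c d; rewrite xclass0 (lfmap0 Tlin) (lfmap0 Tlin') lcomp0l lcomp0r.
- by move=> c d f Ef g Eg; rewrite xclassD (lfmapD Tlin) (lfmapD Tlin') lcompDl lcompDr
  Ef Eg.
- by move=> c d r f Ef; rewrite xclassZ (lfmapZ Tlin) (lfmapZ Tlin') lcompZl lcompZr Ef.
- move=> c d /=; have [E1 E2 E3 E4 _] := xsumP R c d.
  by rewrite lcompDl -!lcompA -!(lfmapM T) E1 E3 lfmap1 (lfmap0 Tlin) !lcomp0r addr0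
    lcompm1.
- move=> c d /=; have [E1 E2 E3 E4 _] := xsumP R c d.
  by rewrite lcompDl -!lcompA -!(lfmapM T) E2 E4 lfmap1 (lfmap0 Tlin) !lcomp0r add0r
    lcompm1.
- move=> c d /=; have [E1 E2 E3 E4 _] := xsumP R c d.
  by rewrite lcompDr !lcompA -!(lfmapM T') E1 E4 lfmap1 (lfmap0 Tlin') !lcomp0l addr0
    lcomp1m.
- move=> c d /=; have [E1 E2 E3 E4 _] := xsumP R c d.
  by rewrite lcompDr !lcompA -!(lfmapM T') E2 E3 lfmap1 (lfmap0 Tlin') !lcomp0l add0r
    lcomp1m.
Qed.

End ExpressionTransformations.

(** * The universal homology *)

Section UniversalHomology.
Context (R : comPzRingType) (C : category).

Definition xbip (a b : xobj C) : biproduct (A := xcat R C) a b := Biproduct (xsumP R a b).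

Definition univ_ab : ab_category R := adelman_ab (xzeroP R C) xbip.

Let iota : functor (xcat R C) univ_ab := tiota (xzeroP R C) xbip.

Definition univ_homology : homologies C univ_ab := fun i => iota \of xgen R C i.

Lemma comp_linear (A1 A2 A3 : lin_category R) (G : functor A2 A3) (F : functor A1 A2) :
  is_linear_functor G -> is_linear_functor F -> is_linear_functor (G \of F).
Proof.
move=> Gl Fl x y a f g; rewrite -[fmap (G \of F) _]/(lfmap G (lfmap F (a *: f + g))).
by rewrite (lfmapD Fl) (lfmapZ Fl) (lfmapD Gl) (lfmapZ Gl).
Qed.

Lemma univ_homologyP : universal_homology univ_homology.
Proof.
move=> A; apply: equivalence_of_ff.
- move=> G G' b b' E.
  apply: adelman_nat_unique (svalP G) (svalP G') _ _ _ => x.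
  pose w (c : nat_trans (sval G) (sval G')) := nat_whiskr c iota.
  suff : w b = w b' by move=> /(congr1 (fun c => ntc c x)).
  have Gl := comp_linear (svalP G).1 (@tiota_linear _ _ _ (xzeroP R C) xbip).
  apply: (xcat_nat_unique Gl) => i y.
  by have := congr1 (fun c => ntc (c i) y) E.
- move=> G G' b.
  have Gl := comp_linear (svalP G).1 (@tiota_linear _ _ _ (xzeroP R C) xbip).
  have Gl' := comp_linear (svalP G').1 (@tiota_linear _ _ _ (xzeroP R C) xbip).
  pose a i x : lmor ((sval G \of iota) (XGen i x)) ((sval G' \of iota) (XGen i x)) := b
    i x.
  have aN i x y (f : @mor C x y) :
    a i y \ol lfmap (sval G \of iota) (xclass (XMor R i f)) =
    lfmap (sval G' \of iota) (xclass (XMor R i f)) \ol a i x := ntP (b i) f.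
  have [c cE] := adelman_nat_extend (svalP G) (svalP G') (xext_nat Gl Gl' aN).
  exists c; apply: functional_extensionality_dep => i.
  by apply: nat_trans_eq => x; apply: cE.
move=> H; have Sl := xsem_linear H.
exists (exist _ (efunctor (xzeroP R C) xbip Sl) (efunctor_exact _ _ Sl)).
have [c [ci cN]] := efunctor_iota (xzeroP R C) xbip Sl.
pose E := efunctor (xzeroP R C) xbip Sl.
pose c' i x : mor ((E \of (iota \of xgen R C i)) x) (H i x) := c (XGen i x).
have cN' i x y (f : @mor C x y) :
  c' i y \oc fmap (E \of (iota \of xgen R C i)) f = fmap (H i) f \oc c' i x.
  exact: etrans (cN _ _ (fmap (xgen R C i) f)) (congr1 (fun h => lcomp h (c (XGen i x)))
    (xsem_gen H i f)).
exists (fun i => @NatTrans _ _ (E \of (iota \of xgen R C i)) (H i) (c' i) (cN' i)).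
by apply: pow_iso => i; apply: nat_iso => x; apply: ci.
Qed.

End UniversalHomology.

(** * Quotients by thick subcategories *)

Lemma lin_iso_inv (R : comPzRingType) (A : lin_category R) (x y : lobj A) (f : lmor x y) :
  is_iso (C := A) f -> exists g : lmor y x, g \ol f = lidm x /\ f \ol g = lidm y.
Proof. by []. Qed.

Lemma kernel_iso_src (R : comPzRingType) (A : lin_category R) (k w x y : lobj A)
  (f : lmor x y) (t : lmor w x) (i : lmor k w) :
  is_iso (C := A) t -> kernel i (f \ol t) -> kernel (t \ol i) f.
Proof.
move=> ti [fi im iU]; split; first by rewrite lcompA.
  by apply: monic_comp im; apply: iso_monic.
case: ti => s [_ /= ts] v g fg.
have [|h hE] := iU _ (s \ol g); first by rewrite -lcompA [t \ol _]lcompA ts lcomp1m.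
by exists h; rewrite -lcompA hE lcompA ts lcomp1m.
Qed.

Lemma cokernel_iso_src (R : comPzRingType) (A : lin_category R) (k w x y : lobj A)
  (f : lmor x y) (t : lmor w x) (i : lmor k w) :
  is_iso (C := A) t -> cokernel (f \ol t) i -> cokernel f (t \ol i).
Proof.
move=> ti [fi fe fU]; split; [by rewrite lcompA | exact: epic_cancel fe |].
move=> v g; rewrite lcompA => /fU[h hE]; exists h.
by apply: (epic_eq (iso_epic ti)); rewrite -lcompA.
Qed.

Section ThickSubcategories.
Context (R : comPzRingType).

Lemma thick_op (A : ab_category R) (T : A -> Prop) : is_thick T -> is_thick
    (A := ab_op A) T.
Proof.
move=> [z s q e]; split.
- by move=> x x0; apply: z => y; have [? ?] := x0 y.
- by move=> x y f; apply: q.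
- by move=> x y f; apply: s.
- by move=> x y w f g [kf cg] Tx Tw; apply: (e w y x g f).
Qed.

(** Asking this of all kernels agrees with asking it of one, as in [iso_mod]: kernels are unique up
    to isomorphism and a thick [T] is closed under isomorphism. *)
Definition thick_monic (A : ab_category R) (T : A -> Prop) (x y : lobj A)
    (f : lmor x y) : Prop :=
  forall k (i : lmor k x), kernel i f -> T k.
Definition thick_epic (A : ab_category R) (T : A -> Prop) (x y : lobj A)
    (f : lmor x y) : Prop :=
  forall c (q : lmor y c), cokernel q f -> T c.
Definition thick_iso (A : ab_category R) (T : A -> Prop) (x y : lobj A)
    (f : lmor x y) : Prop :=
  thick_monic T f /\ thick_epic T f.

Section Thick.
Context (A : ab_category R) (T : A -> Prop) (Tth : is_thick T).

Lemma thick_monic_sub (x y : lobj A) (f : lmor x y) : monic f -> T y -> T x.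
Proof. by move=> /monoP fm; apply: (thick_sub Tth) fm. Qed.

Lemma thick_epic_quo (x y : lobj A) (f : lmor x y) : epic f -> T x -> T y.
Proof. by move=> /epiP fm; apply: (thick_quo Tth) fm. Qed.

Lemma thick_0 (x : lobj A) : lidm x = 0 -> T x.
Proof. by move=> x0; apply: (thick_zero Tth); apply/zero_objectP. Qed.

(** [x] is an extension of the image of [f], a subobject of [y], by [k]. *)
Lemma thick_kernel_codomain (x y k : lobj A) (f : lmor x y) (i : lmor k x) :
  kernel i f -> T k -> T y -> T x.
Proof.
have [z [e [m [ee mm ->]]]] := epi_mono_factor f.
move=> /(kernel_monic_comp _ _ mm) ie Tk /(thick_monic_sub mm).
exact: thick_ext Tth _ _ _ _ _ (epic_short_exact ee ie) Tk.
Qed.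

Lemma thick_monicP (x y k : lobj A) (f : lmor x y) (i : lmor k x) :
  kernel i f -> T k -> thick_monic T f.
Proof.
move=> fi Tk k' i' fi'; have [t [ti _]] := kernel_unique fi' fi.
exact: thick_monic_sub (iso_monic ti) Tk.
Qed.

Lemma monic_thick_monic (x y : lobj A) (f : lmor x y) : monic f -> thick_monic T f.
Proof.
move=> fm k i [/fm i0 im _]; apply: thick_0; apply: im.
by rewrite lcompm1.
Qed.

(** [f] maps the kernel of [g \ol f] into the kernel of [g], and the kernel of that map embeds in
    the kernel of [f]. *)
Lemma thick_monic_comp (x y z : lobj A) (g : lmor y z) (f : lmor x y) :
  thick_monic T g -> thick_monic T f -> thick_monic T (g \ol f).
Proof.
move=> gT fT k i [gfi im iU].
have [k' [i' gi']] := ex_kernel g; have [_ im' iU'] := gi'.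
have [|h hE] := iU' _ (f \ol i); first by rewrite lcompA.
have [l [j hj]] := ex_kernel h; have [hj0 jm jU] := hj.
have [l' [j' fj']] := ex_kernel f; have [_ _ jU'] := fj'.
apply: (thick_kernel_codomain hj _ (gT _ _ gi')).
have [|u uE] := jU' _ (i \ol j); first by rewrite lcompA -hE -lcompA hj0 lcomp0r.
apply: (thick_monic_sub _ (fT _ _ fj')).
by apply: (@monic_cancel _ _ _ _ _ j' u); rewrite uE; apply: monic_comp.
Qed.

End Thick.

Section ThickIso.
Context (A : ab_category R) (T : A -> Prop) (Tth : is_thick T).
Let Top := thick_op Tth.

Lemma thick_isoP (x y : lobj A) (f : lmor x y) : iso_mod (A := A) T f <-> thick_iso T f.
Proof.
split=> [[[k [i [/kernelP ik Tk]]] [c [q [/cokernelP qc Tc]]]] | [fm fe]].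
  split; first exact: thick_monicP ik Tk.
  exact: (thick_monicP Top qc Tc).
have [k [i ik]] := ex_kernel f; have [c [q qc]] := ex_cokernel f.
split; first by exists k, i; split; [apply/kernelP | apply: fm ik].
by exists c, q; split; [apply/cokernelP | apply: fe qc].
Qed.

Lemma epic_thick_epic (x y : lobj A) (f : lmor x y) : epic f -> thick_epic T f.
Proof. exact: (monic_thick_monic Top). Qed.

Lemma thick_epic_comp (x y z : lobj A) (g : lmor y z) (f : lmor x y) :
  thick_epic T g -> thick_epic T f -> thick_epic T (g \ol f).
Proof. by move=> gT fT; apply: (thick_monic_comp Top). Qed.

Lemma thick_iso_comp (x y z : lobj A) (g : lmor y z) (f : lmor x y) :
  thick_iso T g -> thick_iso T f -> thick_iso T (g \ol f).
Proof. by move=> [? ?] [? ?]; split; [apply: thick_monic_comp | apply: thick_epic_comp].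
  Qed.

Lemma thick_iso_id (x : lobj A) : thick_iso T (lidm x).
Proof. by split; [apply/(monic_thick_monic Tth)/monic_id |
  apply/epic_thick_epic/epic_id]. Qed.

(** [s'] is the pullback of [s] along [f]. Its kernel embeds in the kernel of [s], and its cokernel
    in the cokernel of [s]: an element of [x] whose image under [f] comes from [s], after
    refinement, comes from the pullback. *)
Lemma thick_ore (x y z : lobj A) (f : lmor x y) (s : lmor z y) : thick_iso T s ->
  exists w (s' : lmor w x) (f' : lmor w z), thick_iso T s' /\ f \ol s' = s \ol f'.
Proof.
move=> [sm se].
have [S [i1 [i2 [p1 [p2 [p11 p22 p21 p12 ip]]]]]] := ab_biproduct (ab_abelian A) x z.
have [w [j [hj jm jU]]] := ex_kernel (f \ol p1 - s \ol p2).
have E : f \ol (p1 \ol j) = s \ol (p2 \ol j).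
  by apply/eqP; rewrite -subr_eq0 !lcompA -lcompBl hj.
have lift v (a : lmor v x) (b : lmor v z) : f \ol a = s \ol b ->
    exists h, p1 \ol j \ol h = a /\ p2 \ol j \ol h = b.
  move=> ab; have [|h hE] := jU _ (i1 \ol a + i2 \ol b).
    rewrite lcompBl !lcompDr -!lcompA [p1 \ol _]lcompA p11 [p1 \ol _]lcompA p12.
    rewrite [p2 \ol _]lcompA p21 [p2 \ol _]lcompA p22 !lcomp0l !lcomp0r !lcomp1m.
    by rewrite addr0 add0r ab subrr.
  exists h; rewrite -!lcompA hE !lcompDr !lcompA p11 p12 p21 p22.
  by rewrite !lcomp0l !lcomp1m addr0 add0r.
exists w, (p1 \ol j), (p2 \ol j); split=> //; split.
  move=> k i [i0 im iU].
  have [k' [i' si']] := ex_kernel s; have [_ im' iU'] := si'.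
  have [|h hE] := iU' _ (p2 \ol j \ol i); first by rewrite lcompA -E -lcompA i0 lcomp0r.
  apply: (thick_monic_sub Tth _ (sm _ _ si')).
  have hm : monic h; last exact: hm.
  move=> v g hg; apply: im; apply: jm.
  have pg1 : p1 \ol (j \ol (i \ol g)) = 0 by rewrite 2!lcompA i0 lcomp0l.
  have pg2 : p2 \ol (j \ol (i \ol g)) = 0 by rewrite 2!lcompA -hE -lcompA hg lcomp0r.
  by rewrite -[LHS]lcomp1m -ip lcompDl -!lcompA pg1 pg2 !lcomp0r addr0.
move=> c q [q0 qe qU].
have [d [r rs]] := ex_cokernel s; have [rs0 _ _] := rs.
have [|h hE] := qU _ (r \ol f); first by rewrite -lcompA E lcompA rs0 lcomp0l.
apply: (thick_monic_sub Tth _ (se _ _ rs)).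
have hm : monic h; last exact: hm.
move=> v g hg; have [w1 [e1 [u [e1e uE]]]] := pullback_epic g qe.
have [w2 [e2 [b [e2e bE]]]] : exists w2 (e2 : lmor w2 w1) b, epic e2 /\ f \ol u \ol e2
  = s \ol b.
  by apply: (cokernel_exact rs); rewrite lcompA -hE -lcompA uE lcompA hg lcomp0l.
have [|a [aE _]] := lift _ (u \ol e2) b; first by rewrite lcompA.
apply: e1e; apply: e2e.
by rewrite -uE -lcompA -aE lcompA q0 lcomp0l.
Qed.

(* Equivalently, [f] factors through an object of [T]: see [thick_null_image]. *)
Definition thick_null (x y : lobj A) (f : lmor x y) : Prop :=
  exists w (t : lmor w x), thick_iso T t /\ f \ol t = 0.

(** If [t] kills [m \ol e], it kills [e], so [z] is a quotient of the cokernel of [t]. Conversely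
    the kernel of [e] is a monic with cokernel [z], hence a valid [t] as soon as [z] is in [T]. *)
Lemma thick_null_image (x z y : lobj A) (e : lmor x z) (m : lmor z y) :
  epic e -> monic m -> (thick_null (m \ol e) <-> T z).
Proof.
move=> ee mm; split=> [[w [t [[tm te] E]]] | Tz].
  have [c [q qt]] := ex_cokernel t; have [_ _ qU] := qt.
  have [|h hE] := qU _ e; first by apply: mm; rewrite lcompA.
  apply: (thick_epic_quo Tth _ (te _ _ qt)).
  by apply: (@epic_cancel _ _ _ _ _ h q); rewrite hE.
have [k [i ie]] := ex_kernel e; have [ei im _] := ie; exists k, i.
rewrite -lcompA ei lcomp0r; split=> //; split; first exact: monic_thick_monic.
exact: (thick_monicP Top (epic_cokernel ee ie) Tz).
Qed.

Lemma thick_null_iso_comp (x y w : lobj A) (s : lmor x y) (g : lmor w x) :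
  thick_iso T s -> s \ol g = 0 -> thick_null g.
Proof.
move=> [sm _]; have [z [e [m [ee mm ->]]]] := epi_mono_factor g => E.
apply/(thick_null_image ee mm).
have [k [i si]] := ex_kernel s; have [_ _ iU] := si.
have [|h hE] := iU _ m; first by apply: ee; rewrite -lcompA.
apply: (thick_monic_sub Tth _ (sm _ _ si)).
by apply: (@monic_cancel _ _ _ _ _ i h); rewrite hE.
Qed.

End ThickIso.

Lemma thick_ore_op (A : ab_category R) (T : A -> Prop) (Tth : is_thick T)
  (v x y : lobj A) (t : lmor v x) (f : lmor v y) : thick_iso T t ->
  exists p (s : lmor y p) (g : lmor x p), thick_iso T s /\ g \ol t = s \ol f.
Proof.
move=> [tm te].
have [p [s [g [[sm se] E]]]] := thick_ore (thick_op Tth) f (conj te tm).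
by exists p, s, g; split; [split|].
Qed.

(** Having an image in [T] is a self-dual condition, so a null map can also be killed on the side of
    its target. *)
Lemma thick_null_op (A : ab_category R) (T : A -> Prop) (Tth : is_thick T)
  (x y : lobj A) (f : lmor x y) : thick_null T f ->
  exists v (s : lmor y v), thick_iso T s /\ s \ol f = 0.
Proof.
have [z [e [m [ee mm ->]]]] := epi_mono_factor f => /(thick_null_image Tth ee mm) Tz.
have /(_ Tz)[v [s [[sm se] E]]] := (thick_null_image (thick_op Tth) mm ee).2.
by exists v, s; split; [split|].
Qed.

End ThickSubcategories.

(** * Roofs and the calculus of fractions *)

Section SerreQuotient.
Context (R : comPzRingType) (A : ab_category R) (T : A -> Prop) (Tth : is_thick T).

Local Notation W := (thick_iso T).

Record roof (x y : lobj A) := Roof {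
  rw : lobj A; rs : lmor rw x; rf : lmor rw y; rsP : W rs
}.

(* In the quotient this says [r \ol a = b]. *)
Definition gr (x y : lobj A) (r : roof x y) (w : lobj A) (a : lmor w x)
    (b : lmor w y) : Prop :=
  exists v (t : lmor v w) (u : lmor v (rw r)),
    [/\ W t, a \ol t = rs r \ol u & b \ol t = rf r \ol u].

Lemma gr_pre x y (r : roof x y) w (a : lmor w x) (b : lmor w y) v (g : lmor v w) :
  gr r a b -> gr r (a \ol g) (b \ol g).
Proof.
move=> [v' [t [u [tW aE bE]]]]; have [v2 [s [g' [sW sE]]]] := thick_ore Tth g tW.
exists v2, s, (u \ol g'); split=> //.
  by rewrite -lcompA sE !lcompA aE.
by rewrite -lcompA sE !lcompA bE.
Qed.

Lemma gr_loc x y (r : roof x y) w (a : lmor w x) (b : lmor w y) v (t : lmor v w) :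
  W t -> gr r (a \ol t) (b \ol t) -> gr r a b.
Proof.
move=> tW [v' [t' [u [t'W aE bE]]]]; exists v', (t \ol t'), u.
by rewrite !lcompA; split=> //; apply: thick_iso_comp.
Qed.

Lemma thick_iso_coequal x y w (s : lmor x y) (g h : lmor w x) : W s -> s \ol g = s \ol h
    ->
  exists v (t : lmor v w), W t /\ g \ol t = h \ol t.
Proof.
move=> sW E; have [|v [t [tW gt]]] := thick_null_iso_comp Tth (g := g - h) sW.
  by rewrite lcompBr E subrr.
exists v, t; split=> //; apply/eqP; rewrite -subr_eq0 -lcompBl; exact/eqP.
Qed.

Lemma gr_fun x y (r : roof x y) w (a : lmor w x) (b b' : lmor w y) :
  gr r a b -> gr r a b' -> exists v (t : lmor v w), W t /\ b \ol t = b' \ol t.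
Proof.
move=> [v1 [t1 [u1 [t1W aE1 bE1]]]] [v2 [t2 [u2 [t2W aE2 bE2]]]].
have [v [s1 [s2 [s1W sE]]]] := thick_ore Tth t1 t2W.
(* The two lifts into the roof agree only after composition with the denominator [rs r]; a further
   refinement equalizes them. *)
have [|v' [t [tW E]]] := thick_iso_coequal (g := u1 \ol s1) (h := u2 \ol s2) (rsP r).
  by rewrite !lcompA -aE1 -aE2 -!lcompA sE.
exists v', (t1 \ol s1 \ol t); split; first by do ! apply: thick_iso_comp => //.
by rewrite !lcompA bE1 -!lcompA [u1 \ol _]lcompA E !lcompA -bE2 -!lcompA
  [t1 \ol _]lcompA sE -lcompA.
Qed.

Lemma gr_tot x y (r : roof x y) w (a : lmor w x) :
  exists v (t : lmor v w) b, W t /\ gr r (a \ol t) b.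
Proof.
have [v [t [u [tW E]]]] := thick_ore Tth a (rsP r).
exists v, t, (rf r \ol u); split=> //; exists v, (lidm v), u.
by rewrite !lcompm1; split=> //; apply: thick_iso_id.
Qed.

Lemma gr_self x y (r : roof x y) : gr r (rs r) (rf r).
Proof. by exists (rw r), (lidm _), (lidm _); split=> //; apply: thick_iso_id. Qed.

Definition roof_eq x y (r r' : roof x y) : Prop := gr r' (rs r) (rf r).

Lemma roof_eq_gr x y (r r' : roof x y) w (a : lmor w x) (b : lmor w y) :
  roof_eq r r' -> gr r a b -> gr r' a b.
Proof.
move=> E [v [t [u [tW aE bE]]]]; apply: gr_loc tW _.
by rewrite aE bE; apply: gr_pre.
Qed.

(** Roofs with the same value at one common denominator coincide. The module and category axioms for
    roofs reduce to this, with the values computed in [A]. *)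
Lemma roof_eq_intro x y (r r' : roof x y) w (t : lmor w x) (f : lmor w y) :
  W t -> gr r t f -> gr r' t f -> roof_eq r r'.
Proof.
move=> tW rtf r'tf; rewrite /roof_eq.
have [v [s [t' [sW E]]]] := thick_ore Tth (rs r) tW.
have H1 : gr r (rs r \ol s) (f \ol t') by rewrite E; apply: gr_pre.
have [v' [u [uW E']]] := gr_fun H1 (gr_pre s (gr_self r)).
apply: (gr_loc (thick_iso_comp Tth sW uW)).
by rewrite !lcompA E -E' -!lcompA; apply: gr_pre.
Qed.

Lemma roof_eq_refl x y (r : roof x y) : roof_eq r r.
Proof. exact: gr_self. Qed.

Lemma roof_eq_sym x y (r r' : roof x y) : roof_eq r r' -> roof_eq r' r.
Proof. by move=> E; apply: roof_eq_intro (rsP r) E (gr_self r). Qed.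

Lemma roof_eq_trans x y (r r' r'' : roof x y) : roof_eq r r' -> roof_eq r' r'' ->
    roof_eq r r''.
Proof. by move=> E E'; apply: roof_eq_gr E' E. Qed.

Lemma gr_common2 x y z (r : roof x y) (r' : roof x z) :
  exists w (t : lmor w x) f g, [/\ W t, gr r t f & gr r' t g].
Proof.
have [v [t [b [tW tb]]]] := gr_tot r' (rs r).
exists v, (rs r \ol t), (rf r \ol t), b; split=> //.
  exact: (thick_iso_comp Tth (rsP r) tW).
exact/gr_pre/gr_self.
Qed.

Lemma gr_common3 x y z u (r : roof x y) (r' : roof x z) (r'' : roof x u) :
  exists w (t : lmor w x) f g h, [/\ W t, gr r t f, gr r' t g & gr r'' t h].
Proof.
have [v [t [b [c [tW tb tc]]]]] := gr_common2 r r'.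
have [v' [t' [h [t'W th]]]] := gr_tot r'' t.
exists v', (t \ol t'), (b \ol t'), (c \ol t'), h; split=> //; try exact: gr_pre.
exact: (thick_iso_comp Tth tW t'W).
Qed.

Lemma gr_chain x y z (r : roof x y) (r' : roof y z) w (a : lmor w x) :
  exists v (t : lmor v w) b c, [/\ W t, gr r (a \ol t) b & gr r' b c].
Proof.
have [v [t [b [tW tb]]]] := gr_tot r a.
have [v' [t' [c [t'W tc]]]] := gr_tot r' b.
exists v', (t \ol t'), (b \ol t'), c; split=> //; first exact: thick_iso_comp.
by rewrite lcompA; apply: gr_pre.
Qed.

Definition roof_of x y (f : lmor x y) : roof x y := Roof f (thick_iso_id Tth x).

Lemma gr_of x y (f : lmor x y) w (a : lmor w x) : gr (roof_of f) a (f \ol a).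
Proof.
exists w, (lidm w), a; rewrite /= lcompm1 lcomp1m.
by split=> //; [apply: thick_iso_id | rewrite lcompm1].
Qed.

Definition roof_scale k x y (r : roof x y) : roof x y := Roof (k *: rf r) (rsP r).

Lemma gr_scale k x y (r : roof x y) w (a : lmor w x) (b : lmor w y) :
  gr r a b -> gr (roof_scale k r) a (k *: b).
Proof.
by move=> [v [t [u [tW aE bE]]]]; exists v, t, u; rewrite /= !lcompZl bE.
Qed.

Lemma roof_add_ex x y (r r' : roof x y) : exists q : roof x y,
  exists f g, [/\ gr r (rs q) f, gr r' (rs q) g & rf q = f + g].
Proof.
have [w [t [f [g [tW tf tg]]]]] := gr_common2 r r'.
by exists (Roof (f + g) tW), f, g.
Qed.

Definition roof_add x y (r r' : roof x y) : roof x y := sval (cid (roof_add_ex r r')).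

(** The sum was formed at a chosen denominator [rs q]. An Ore square compares [a] with it, and one
    refinement for each summand makes the values agree; the choice becomes invisible. *)
Lemma gr_add x y (r r' : roof x y) w (a : lmor w x) (b c : lmor w y) :
  gr r a b -> gr r' a c -> gr (roof_add r r') a (b + c).
Proof.
rewrite /roof_add; case: cid => q /= [f [g [qf qg qE]]] ab ac.
have [v [t [u [tW E]]]] := thick_ore Tth a (rsP q).
have H1 : gr r (a \ol t) (f \ol u) by rewrite E; apply: gr_pre.
have H2 : gr r' (a \ol t) (g \ol u) by rewrite E; apply: gr_pre.
have [v1 [t1 [t1W E1]]] := gr_fun (gr_pre t ab) H1.
have [v2 [t2 [t2W E2]]] := gr_fun (gr_pre t1 (gr_pre t ac)) (gr_pre t1 H2).
exists v2, (t \ol t1 \ol t2), (u \ol t1 \ol t2); split.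
- by do ! apply: thick_iso_comp => //.
- by rewrite !lcompA E.
by rewrite qE !lcompDl !lcompA E1 E2.
Qed.

Lemma roof_comp_ex x y z (r' : roof y z) (r : roof x y) : exists q : roof x z,
  exists2 b, gr r (rs q) b & gr r' b (rf q).
Proof.
have [w [t [b [c [tW tb bc]]]]] := gr_chain r r' (lidm x).
by rewrite lcomp1m in tb; exists (Roof c tW), b.
Qed.

Definition roof_comp x y z (r' : roof y z) (r : roof x y) : roof x z :=
  sval (cid (roof_comp_ex r' r)).

(** As for sums, this frees the composite from the Ore square chosen to define it. *)
Lemma gr_comp x y z (r' : roof y z) (r : roof x y) w (a : lmor w x) b c :
  gr r a b -> gr r' b c -> gr (roof_comp r' r) a c.
Proof.
rewrite /roof_comp; case: cid => q /= [f qf fq] ab bc.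
have [v [t [u [tW E]]]] := thick_ore Tth a (rsP q).
have H1 : gr r (a \ol t) (f \ol u) by rewrite E; apply: gr_pre.
have [v1 [t1 [t1W E1]]] := gr_fun (gr_pre t ab) H1.
have H2 : gr r' (b \ol t \ol t1) (rf q \ol u \ol t1) by rewrite E1; do 2 apply: gr_pre.
have [v2 [t2 [t2W E2]]] := gr_fun (gr_pre t1 (gr_pre t bc)) H2.
exists v2, (t \ol t1 \ol t2), (u \ol t1 \ol t2); split.
- by do ! apply: thick_iso_comp => //.
- by rewrite !lcompA E.
by rewrite !lcompA E2.
Qed.

Definition roof_module (x y : lobj A) : pre_module R.
Proof.
apply: (@PreModule R (roof x y) (@roof_eq x y) (roof_of 0) (@roof_add x y)
  (fun k => @roof_scale k x y)).
- exact: roof_eq_refl.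
- exact: roof_eq_sym.
- exact: roof_eq_trans.
- move=> u u' v v' uu' vv'; have [w [t [f [g [tW tf tg]]]]] := gr_common2 u v.
  exact: roof_eq_intro tW (gr_add tf tg) (gr_add (roof_eq_gr uu' tf) (roof_eq_gr vv' tg)).
- move=> k u u' uu'; apply: (roof_eq_intro (rsP u) (gr_scale k (gr_self u))).
  exact: gr_scale.
- move=> u v q; have [w [t [f [g [h [tW tf tg th]]]]]] := gr_common3 u v q.
  apply: (roof_eq_intro tW (gr_add tf (gr_add tg th))).
  by rewrite addrA; do ! apply: gr_add.
- move=> u v; have [w [t [f [g [tW tf tg]]]]] := gr_common2 u v.
  by apply: (roof_eq_intro tW (gr_add tf tg)); rewrite addrC; apply: gr_add.
- move=> u; apply: (roof_eq_intro (rsP u) (gr_add (gr_of 0 _) (gr_self u))).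
  by rewrite lcomp0l add0r; apply: gr_self.
- move=> u; apply: (roof_eq_intro (rsP u) (gr_add (gr_scale (-1) (gr_self u))
  (gr_self u))).
  by rewrite scaleN1r addNr -(lcomp0l y (rs u)); apply: gr_of.
- move=> a b u; apply: (roof_eq_intro (rsP u) (gr_scale a (gr_scale b (gr_self u)))).
  by rewrite scalerA; apply/gr_scale/gr_self.
- move=> u; apply: (roof_eq_intro (rsP u) (gr_scale 1 (gr_self u))).
  by rewrite scale1r; apply: gr_self.
- move=> a u v; have [w [t [f [g [tW tf tg]]]]] := gr_common2 u v.
  apply: (roof_eq_intro tW (gr_scale a (gr_add tf tg))).
  by rewrite scalerDr; apply: gr_add; apply: gr_scale.
- move=> u a b; apply: (roof_eq_intro (rsP u) (gr_scale (a + b) (gr_self u))).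
  by rewrite scalerDl; apply: gr_add; apply/gr_scale/gr_self.
Defined.

Definition roof_lin : pre_lin R.
Proof.
apply: (@PreLin R (lobj A) roof_module (fun x => roof_of (lidm x)) roof_comp).
- move=> x y z g g' f f' gg' ff'.
  have [w [t [b [c [tW tb bc]]]]] := gr_chain f g (lidm x); rewrite lcomp1m in tb.
  exact: roof_eq_intro tW (gr_comp tb bc)
    (gr_comp (roof_eq_gr ff' tb) (roof_eq_gr gg' bc)).
- move=> x y f; apply: (roof_eq_intro (rsP f) (gr_comp (gr_self f) (gr_of _ _))).
  by rewrite lcomp1m; apply: gr_self.
- move=> x y f; apply: (@roof_eq_intro _ _ _ _ _ (rs f) (rf f));
  [exact: rsP| |exact: gr_self].
  apply: gr_comp (gr_self f); rewrite -{2}[rs f]lcomp1m; exact: gr_of.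
- move=> x y z u h g f.
  have [w [t [b [c [tW tb bc]]]]] := gr_chain f g (lidm x); rewrite lcomp1m in tb.
  have [w' [t' [d [t'W cd]]]] := gr_tot h c.
  apply: (roof_eq_intro (thick_iso_comp Tth tW t'W)
    (gr_comp (gr_comp (gr_pre t' tb) (gr_pre t' bc)) cd)).
  exact: gr_comp (gr_pre t' tb) (gr_comp (gr_pre t' bc) cd).
- move=> x y z f a g g'.
  have [v [s [e [sW se]]]] := gr_tot f (lidm x); rewrite lcomp1m in se.
  have [v1 [s1 [c1 [s1W ec]]]] := gr_tot g e.
  have [v2 [s2 [c2 [s2W ec2]]]] := gr_tot g' (e \ol s1).
  have H := gr_pre s2 (gr_pre s1 se); have H1 := gr_pre s2 ec.
  apply: (roof_eq_intro _ (gr_comp H (gr_add (gr_scale a H1) ec2))).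
    by do ! apply: thick_iso_comp => //.
  exact: gr_add (gr_scale a (gr_comp H H1)) (gr_comp H ec2).
- move=> x y z g a f f'.
  have [w [t [b [c [tW tb tc]]]]] := gr_common2 f f'.
  have [v1 [s1 [c1 [s1W ec]]]] := gr_tot g b.
  have [v2 [s2 [c2 [s2W ec2]]]] := gr_tot g (c \ol s1).
  have H := gr_pre s2 (gr_pre s1 tb); have H1 := gr_pre s2 (gr_pre s1 tc).
  have H2 := gr_pre s2 ec.
  (* A roof has linear values: the witnesses of [H2] and [ec2] are brought to one refinement by an
     Ore square and combined there. *)
  have L : gr g (a *: (b \ol s1 \ol s2) + c \ol s1 \ol s2) (a *: (c1 \ol s2) + c2).
    move: H2 ec2 => [k1 [p1 [q1 [p1W e1 f1]]]] [k2 [p2 [q2 [p2W e2 f2]]]].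
    have [k [r1 [r2 [r1W rE]]]] := thick_ore Tth p1 p2W.
    exists k, (p1 \ol r1), (a *: (q1 \ol r1) + q2 \ol r2).
    split; first exact: thick_iso_comp.
      rewrite lcompDl lcompZl lcompDr lcompZr [_ \ol (p1 \ol r1)]lcompA e1.
      by rewrite [in X in _ + X = _]rE [_ \ol (p2 \ol r2)]lcompA e2 -!lcompA.
    rewrite lcompDl lcompZl lcompDr lcompZr [_ \ol (p1 \ol r1)]lcompA f1.
    by rewrite [in X in _ + X = _]rE [_ \ol (p2 \ol r2)]lcompA f2 -!lcompA.
  apply: (roof_eq_intro _ (gr_comp (gr_add (gr_scale a H) H1) L)).
    by do ! apply: thick_iso_comp => //.
  exact: gr_add (gr_scale a (gr_comp H H2)) (gr_comp H1 ec2).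
Defined.

Definition serre_lin : lin_category R := quo_lin roof_lin.

Definition spi (x y : lobj A) (f : lmor x y) : lmor (l := serre_lin) x y :=
  qmor (P := roof_lin) (roof_of f).

Lemma spi_gr x y (r : roof x y) w (a : lmor w x) b :
  gr r a b -> qmor (P := roof_lin) r \ol spi a = spi b.
Proof.
move=> rab; rewrite -[LHS](@qmorM R roof_lin w x y r (roof_of a));
  apply/(@qmor_eq R roof_lin).
apply: (@roof_eq_intro _ _ _ _ _ (lidm w) b); first exact: thick_iso_id.
  by apply: gr_comp rab; rewrite -{2}[a]lcompm1; apply: gr_of.
by rewrite -{2}[b]lcompm1; apply: gr_of.
Qed.

Lemma spiM x y z (g : lmor y z) (f : lmor x y) : spi (g \ol f) = spi g \ol spi f.
Proof. by apply/esym/spi_gr/gr_of. Qed.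

Lemma spi1 x : spi (lidm x) = lidm (l := serre_lin) x.
Proof. by []. Qed.

Lemma spi_eq x y (f g : lmor x y) : spi f = spi g -> exists w (t : lmor w x), W t /\ f
    \ol t = g \ol t.
Proof.
move=> /(@qmor_eq R roof_lin) [v [t [u [tW /= E1 E2]]]].
by exists v, t; split=> //; rewrite E2; move: E1; rewrite !lcomp1m => ->.
Qed.

Lemma spi_lin a x y (f g : lmor x y) : spi (a *: f + g) = a *: spi f + spi g.
Proof.
rewrite -[a *: spi f](@qmorZ R roof_lin x y a (roof_of f)) -[RHS](@qmorD R roof_lin).
apply/(@qmor_eq R roof_lin).
have H h : gr (roof_of h) (lidm x) h by rewrite -[h in gr _ _ h]lcompm1; apply: gr_of.
apply: (@roof_eq_intro _ _ _ _ _ (lidm x) (a *: f + g)) => //; first exact: thick_iso_id.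
by apply: gr_add => //; apply: gr_scale.
Qed.

Lemma spi0 x y : spi (0 : lmor x y) = 0.
Proof. by []. Qed.

Lemma spi_eq0 x y (f : lmor x y) : spi f = 0 <-> thick_null T f.
Proof.
split=> [/spi_eq[w [t [tW E]]] | [w [t [tW E]]]].
  by exists w, t; rewrite E lcomp0l.
apply/(@qmor_eq R roof_lin); exists w, t, t; split=> //=.
by rewrite E lcomp0l.
Qed.

Lemma serre_fraction (x y : lobj A) (F : lmor (l := serre_lin) x y) :
  exists w (t : lmor (l := A) w x) (f : lmor w y), W t /\ F \ol spi t = spi f.
Proof.
have [r ->] := qmor_onto F; exists (rw r), (rs r), (rf r).
by split; [apply: rsP | apply/spi_gr/gr_self].
Qed.

Lemma serre_fraction2 (x y y' : lobj A) (F : lmor (l := serre_lin) x y)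
    (F' : lmor (l := serre_lin) x y') :
  exists w (t : lmor (l := A) w x) (f : lmor w y) (f' : lmor w y'),
    [/\ W t, F \ol spi t = spi f & F' \ol spi t = spi f'].
Proof.
have [r ->] := qmor_onto F; have [r' ->] := qmor_onto F'.
have [w [t [f [g [tW tf tg]]]]] := gr_common2 r r'.
by exists w, t, f, g; split=> //; apply: spi_gr.
Qed.

Lemma spi_iso x y (t : lmor x y) : W t -> is_iso (C := serre_lin) (spi t).
Proof.
move=> tW; pose r := Roof (lidm x) tW.
have H : gr r t (lidm x).
  by exists x, (lidm x), (lidm x); rewrite /= !lcompm1; split=> //; apply: thick_iso_id.
exists (qmor (P := roof_lin) r); split; first exact: (spi_gr H).
apply: etrans (esym (@qmorM R roof_lin y x y (roof_of t) r)) _;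
  apply/(@qmor_eq R roof_lin).
apply: (@roof_eq_intro _ _ _ _ _ t t) => //.
  by apply: gr_comp H _; rewrite -{2}[t]lcompm1; apply: gr_of.
by rewrite -{2}[t]lcomp1m; apply: gr_of.
Qed.

End SerreQuotient.

(** * The quotient: abelian structure and universal property *)

Section SerreAbelian.
Context (R : comPzRingType) (A : ab_category R) (T : A -> Prop) (Tth : is_thick T).

Local Notation W := (thick_iso T).
Local Notation S := (serre_lin Tth).
Local Notation pi := (spi Tth).

Definition serre_pi : functor A S.
Proof.
exists (id : A -> S) (fun x y f => pi f) => [x | x y z g f].
  exact: spi1.
exact: spiM.
Defined.

Lemma serre_pi_linear : is_linear_functor serre_pi.
Proof. by move=> x y a f g; apply: spi_lin. Qed.

Lemma serre_fraction_op (x y : lobj A) (F : lmor (l := S) x y) :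
  exists v (s : lmor (l := A) y v) (g : lmor x v), W s /\ pi s \ol F = pi g.
Proof.
have [w [t [f [tW E]]]] := serre_fraction F.
have [v [s [g [sW E']]]] := thick_ore_op Tth f tW.
exists v, s, g; split=> //; apply: (epic_eq (iso_epic (spi_iso Tth tW))).
by rewrite -lcompA E -!spiM E'.
Qed.

(** A morphism into [x] in the quotient is a fraction. If [pi f] kills it, [f] kills its numerator
    in [A] after a further refinement, so the numerator lifts to [k] there. *)
Lemma serre_kernel (k x y : lobj A) (i : lmor k x) (f : lmor x y) :
  kernel i f -> kernel (pi i) (pi f).
Proof.
move=> [fi im iU]; split; first by rewrite -spiM fi spi0.
- move=> w G; have [v [t [g [tW E]]]] := serre_fraction G => iG.
  apply: (iso_epic (spi_iso Tth tW)); rewrite E.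
  have /spi_eq0[v' [t' [t'W E']]] : pi (i \ol g) = 0 by rewrite spiM -E lcompA iG lcomp0l.
  by apply/spi_eq0; exists v', t'; split=> //; apply: im; rewrite lcompA.
move=> w G; have [v [t [g [tW E]]]] := serre_fraction G => fG.
have /spi_eq0[v' [t' [t'W E']]] : pi (f \ol g) = 0 by rewrite spiM -E lcompA fG lcomp0l.
have [|h hE] := iU _ (g \ol t'); first by rewrite lcompA.
have [s [_ ts]] := lin_iso_inv (spi_iso Tth (thick_iso_comp Tth tW t'W)).
exists (pi h \ol s); rewrite lcompA -spiM hE spiM -E.
by rewrite -[RHS]lcompm1 -ts spiM !lcompA.
Qed.

Lemma serre_cokernel (k x y : lobj A) (q : lmor y k) (f : lmor x y) :
  cokernel q f -> cokernel (pi q) (pi f).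
Proof.
move=> [fi im iU]; split; first by rewrite -spiM fi spi0.
- move=> w G; have [v [t [g [tW E]]]] := serre_fraction_op G => iG.
  apply: (iso_monic (spi_iso Tth tW)); rewrite E.
  have /spi_eq0/(thick_null_op Tth)[v' [t' [t'W E']]] : pi (g \ol q) = 0.
    by rewrite spiM -E -lcompA iG lcomp0r.
  have g0 : t' \ol g = 0 by apply: im; rewrite -lcompA.
  apply: (iso_monic (spi_iso Tth t'W)).
  by rewrite -spiM g0 spi0.
move=> w G; have [v [t [g [tW E]]]] := serre_fraction_op G => fG.
have /spi_eq0/(thick_null_op Tth)[v' [t' [t'W E']]] : pi (g \ol f) = 0.
  by rewrite spiM -E -lcompA fG lcomp0r.
have [|h hE] := iU _ (t' \ol g); first by rewrite -lcompA.
have [s [st _]] := lin_iso_inv (spi_iso Tth (thick_iso_comp Tth t'W tW)).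
exists (s \ol pi h); rewrite -lcompA -spiM hE spiM -E.
by rewrite -[RHS]lcomp1m -st spiM !lcompA.
Qed.

(** The kernel of [e] is killed by [pi f], so its inclusion becomes zero in the quotient and it lies
    in [T]; being epic, [e] is then inverted. *)
Lemma serre_mono_factor (x y : lobj A) (f : lmor x y) : monic (pi f) ->
  exists z (e : lmor (l := A) x z) (m : lmor (l := A) z y),
    [/\ monic m, f = m \ol e & is_iso (C := S) (pi e)].
Proof.
move=> fm; have [z [e [m [ee mm fE]]]] := epi_mono_factor f.
exists z, e, m; split=> //; apply: spi_iso; split; last exact: epic_thick_epic.
move=> k i ei; have [ei0 im _] := ei.
have /fm/spi_eq0 : pi f \ol pi i = 0 by rewrite -spiM fE -lcompA ei0 lcomp0r.
rewrite -[i in thick_null _ i]lcompm1.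
by move/(thick_null_image Tth (epic_id (x := k)) im).
Qed.

Lemma serre_epi_factor (x y : lobj A) (f : lmor x y) : epic (pi f) ->
  exists z (e : lmor (l := A) x z) (m : lmor (l := A) z y),
    [/\ epic e, f = m \ol e & is_iso (C := S) (pi m)].
Proof.
move=> fm; have [z [e [m [ee mm fE]]]] := epi_mono_factor f.
exists z, e, m; split=> //; apply: spi_iso; split; first exact: monic_thick_monic.
move=> k q qm; have [qm0 qe _] := qm.
have /fm/spi_eq0 : pi q \ol pi f = 0 by rewrite -spiM fE lcompA qm0 lcomp0l.
rewrite -[q in thick_null _ q]lcomp1m.
by move/(thick_null_image Tth qe (monic_id (x := k))).
Qed.

(** Up to isomorphism, monos of the quotient come from monos of [A]; this reduces their normality,
    and later short exact sequences, to [A]. *)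
Lemma serre_monic (x y : lobj A) (F : lmor (l := S) x y) : monic F ->
  exists z (m : lmor (l := A) z y) (u : lmor (l := S) x z),
    [/\ monic m, is_iso (C := S) u & F = pi m \ol u].
Proof.
move=> Fm; have [w [t [f [tW E]]]] := serre_fraction F; have ti := spi_iso Tth tW.
have fm : monic (pi f) by rewrite -E; apply: monic_comp Fm (iso_monic ti).
have [z [e [m [mm fE ei]]]] := serre_mono_factor fm.
have [s [st ts]] := lin_iso_inv ti.
exists z, m, (pi e \ol s); split=> //; first by apply: (iso_comp (C := S)) ei _; exists
  (pi t).
by apply: (epic_eq (iso_epic ti)); rewrite E fE spiM -!lcompA [s \ol _]st lcompm1.
Qed.

Lemma serre_zero (x : lobj A) : lidm x = 0 -> lidm (l := S) x = 0.
Proof. by move=> x0; rewrite -spi1 x0 spi0. Qed.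

Lemma serre_abelian : is_abelian S.
Proof.
split.
- have [z /zero_objectP z0] := ab_zero (ab_abelian A).
  by exists (z : S); apply/(zero_objectP (A := S))/serre_zero.
- move=> x y; have [s [i1 [i2 [p1 [p2 [E1 E2 E3 E4 E5]]]]]] := ab_biproduct
  (ab_abelian A) x y.
  exists s, (pi i1), (pi i2), (pi p1), (pi p2); split.
  + by rewrite -spiM E1.
  + by rewrite -spiM E2.
  + by rewrite -spiM E3.
  + by rewrite -spiM E4.
  by rewrite -!spiM -[in RHS]spi1 -E5 -[X in pi (X + _)]scale1r spi_lin scale1r.
- move=> x y F; have [w [t [f [tW E]]]] := serre_fraction F.
  have [k [i ik]] := ex_kernel f.
  exists k, (pi t \ol pi i); apply/kernelP/kernel_iso_src; first exact: spi_iso.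
  by rewrite E; apply: serre_kernel.
- move=> x y F; have [w [t [f [tW E]]]] := serre_fraction F.
  have [c [q qc]] := ex_cokernel f.
  exists c, (pi q); apply/cokernelP/(cokernel_epic_comp _ _ (iso_epic (spi_iso Tth tW))).
  by rewrite E; apply: serre_cokernel.
- move=> x y F /monoP/serre_monic[z [m [u [mm ui ->]]]].
  have [c [q qc]] := ex_cokernel m; exists c, (pi q); apply/kernelP/kernel_iso => //.
  exact/serre_kernel/monic_kernel.
move=> x y F /epiP Fe; have [w [t [f [tW E]]]] := serre_fraction F; have ti := spi_iso
  Tth tW.
have fe : epic (pi f) by rewrite -E; apply: epic_comp Fe (iso_epic ti).
have [z [e [m [ee fE mi]]]] := serre_epi_factor fe.
have [k [i ik]] := ex_kernel e; exists k, (pi t \ol pi i).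
apply/cokernelP/cokernel_iso_src => //; rewrite E fE spiM.
exact/cokernel_iso/mi/serre_cokernel/epic_cokernel.
Qed.

Definition serre_ab : ab_category R := AbCategory serre_abelian.

Definition serre_functor : functor A serre_ab := serre_pi.

Lemma serre_functor_exact : is_exact_linear serre_functor.
Proof.
split; first exact: serre_pi_linear.
move=> x y z f g /short_exactP[fg gf]; apply/short_exactP.
by split; [apply: serre_kernel | apply: serre_cokernel].
Qed.

Lemma serre_inverts : inverts (iso_mod (A := A) T) serre_functor.
Proof. by move=> x y f /(thick_isoP Tth); apply: spi_iso. Qed.

Section Lift.
Context (E : category) (G : functor A E) (GW : inverts (iso_mod (A := A) T) G).

(** For a fraction of numerator [f] and denominator [t] the value is [fmap G f] composed with the
    inverse of [fmap G t]. Prescribing it on all fractions at once makes functoriality of the lift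
    independent of the one chosen. *)
Lemma serre_lift_ex (x y : lobj A) (F : lmor (l := S) x y) :
  exists2 h : mor (G x) (G y), True & forall w (a : lmor (l := A) w x) (b : lmor w y),
    F \ol pi a = pi b -> h \oc fmap G a = fmap G b.
Proof.
have Gi x' y' (t : lmor (l := A) x' y') : W t -> is_iso (fmap G t).
  by move=> tW; apply/GW/(thick_isoP Tth).
have [v [t [f [tW tE]]]] := serre_fraction F.
have [s [st ts]] := Gi _ _ _ tW.
exists (fmap G f \oc s) => // w a b ab.
have [v1 [t1 [u [t1W E1]]]] := thick_ore Tth a tW.
have /(spi_eq)[v2 [t2 [t2W E2]]] : pi (b \ol t1) = pi (f \ol u).
  by rewrite !spiM -ab -tE -!lcompA -!spiM E1.
apply: (iso_epi (Gi _ _ _ (thick_iso_comp Tth t1W t2W))).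
rewrite -compA -!(fmapM G) /= !lcompA E1 E2 -!lcompA.
rewrite [fmap G (t \ol _)](fmapM G) -compA [s \oc _]compA st comp1m.
by rewrite -(fmapM G).
Qed.

Definition serre_lift_map (x y : lobj A) (F : lmor (l := S) x y) : mor (G x) (G y) :=
  s2val (cid2 (serre_lift_ex F)).

Lemma serre_lift_mapP (x y : lobj A) (F : lmor (l := S) x y) w (a : lmor (l := A) w x)
    (b : lmor w y) :
  F \ol pi a = pi b -> serre_lift_map F \oc fmap G a = fmap G b.
Proof. exact: (s2valP' (cid2 (serre_lift_ex F))). Qed.

Lemma serre_lift_pi (x y : lobj A) (f : lmor x y) : serre_lift_map (pi f) = fmap G f.
Proof.
have := @serre_lift_mapP x y (pi f) x (lidm x) f.
by rewrite spi1 lcompm1 [fmap G (lidm x)](fmap1 G) compm1; apply.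
Qed.

Definition serre_lift : functor S E.
Proof.
exists (fobj G : S -> E) serre_lift_map => [x | x y z g f].
  by rewrite -[idm x]spi1 serre_lift_pi; apply: (fmap1 G).
have [w [t [f' [tW Ef]]]] := serre_fraction f.
have [v [s [g' [sW Eg]]]] := serre_fraction (g \ol pi f').
have tsW := thick_iso_comp Tth tW sW.
apply: (iso_epi (GW ((thick_isoP Tth _).2 tsW))).
have Egf : lcomp g f \ol pi (t \ol s) = pi g'.
  by rewrite spiM -lcompA [f \ol _]lcompA Ef lcompA Eg.
rewrite (serre_lift_mapP Egf).
rewrite -compA (@serre_lift_mapP _ _ f _ _ (f' \ol s)); last by rewrite spiM lcompA Ef
  spiM.
by rewrite (@serre_lift_mapP _ _ g _ _ g') // spiM lcompA Eg.
Defined.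

End Lift.

(** The quotient has the objects of [A], so a transformation along [serre_functor] is already a
    family of the right type; its naturality at a fraction follows by cancelling the invertible
    denominator. *)
Lemma serre_localization : is_localization (iso_mod (A := A) T) serre_functor.
Proof.
exists serre_inverts => E; apply: equivalence_of_ff.
- move=> G G' b b' bb'; apply: nat_trans_eq => x.
  pose w (c : nat_trans G G') := nat_whiskr c serre_functor.
  have bb : w b = w b' := bb'.
  exact: (congr1 (fun c : nat_trans (G \of serre_functor) (G' \of serre_functor) => ntc
    c x) bb).
- move=> G G' b.
  have bN (x y : S) (F : mor x y) :
    (b y : mor (G y) (G' y)) \oc fmap G F = fmap G' F \oc (b x : mor (G x) (G' x)).
    have [w [t [f [tW tE]]]] := serre_fraction F.
    have ti := functor_iso G (spi_iso Tth tW).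
    apply: (iso_epi ti).
    have Nt := ntP b t; have Nf := ntP b f; rewrite /= in Nt Nf.
    by rewrite -compA -fmapM [F \oc _]tE Nf -compA Nt compA -fmapM [F \oc _]tE.
  by exists (@NatTrans _ _ G G' b bN); apply: nat_trans_eq.
move=> [G GW]; exists (serre_lift GW : fun_cat serre_ab E).
apply/full_sub_isomorphic.
apply: (@nat_isomorphic A E (serre_lift GW \of serre_functor) G (fun x => idm (G x))) =>
  [x y f /= | x]; last exact: iso_id.
by rewrite serre_lift_pi comp1m compm1.
Qed.

Section ExactLift.
Context (A' : ab_category R) (K : functor serre_ab A').

(** Every short exact sequence of the quotient is isomorphic to the image of one in [A], and any two
    parallel morphisms have a common denominator, which gives linearity. *)
Lemma serre_lift_exact : is_exact_linear (K \of serre_functor) -> is_exact_linear K.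
Proof.
move=> Kex; have Klin := Kex.1.
have KM (x y z : lobj A) (G : lmor (l := S) y z) (F : lmor (l := S) x y) :
  lfmap K (G \ol F) = lfmap K G \ol lfmap K F := fmapM K G F.
have Kpi (x y : lobj A) (f : lmor x y) : lfmap K (pi f) = lfmap (K \of serre_functor) f
    by [].
split=> [x y a F F' | x y z F G].
  have [w [t [f [f' [tW Ef Ef']]]]] := serre_fraction2 F F'.
  have ti : epic (lfmap K (pi t)) by apply/iso_epic/(functor_iso K)/spi_iso.
  apply: (epic_eq ti); rewrite -/(lfmap K F) -/(lfmap K F') -/(lfmap K (a *: F + F')).
  rewrite -KM !lcompDl !lcompZl -!KM Ef Ef' -spi_lin !Kpi.
  by rewrite (lfmapD Klin) (lfmapZ Klin).
move=> /short_exactP[FG GF]; have [_ Fm _] := FG.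
have [v [m [u [mm ui FE]]]] := serre_monic Fm.
have [c [q qm]] := ex_cokernel m.
have GF' : cokernel G (pi m).
  by move: GF; rewrite FE cokernel_epic_comp //; apply: iso_epic.
have [s [si sE]] := cokernel_unique GF' (serre_cokernel qm).
have /short_exactP[mq' qm'] := Kex.2 _ _ _ _ _ (monic_short_exact mm qm).
have Kui := functor_iso K ui; have Ksi := functor_iso K si.
apply/short_exactP; rewrite -[fmap K F]/(lfmap K F) -[fmap K G]/(lfmap K G) FE -sE !KM;
  split.
  by apply: kernel_iso Kui; apply/kernel_monic_comp => //; apply: iso_monic.
by apply: cokernel_iso Ksi; apply/cokernel_epic_comp => //; apply: iso_epic.
Qed.

End ExactLift.

Lemma exact_inverts (A' : ab_category R) (G : functor A A') : is_exact_linear G ->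
  (forall x, T x -> is_zero_object (G x)) -> inverts (iso_mod (A := A) T) G.
Proof.
move=> Gex GT x y f /(thick_isoP Tth)[fm fe].
have [k [i ik]] := ex_kernel f; have [c [q qc]] := ex_cokernel f.
have [_ _ iU] := exact_preserves_kernel Gex ik.
have [_ _ qU] := exact_preserves_cokernel Gex qc.
have k0 : lidm (G k) = 0 by apply/zero_objectP/GT/(fm _ _ ik).
have c0 : lidm (G c) = 0 by apply/zero_objectP/GT/(fe _ _ qc).
apply: (monic_epic_iso (A := A')).
  by move=> w g /iU[h <-]; rewrite (to_zero h k0) lcomp0r.
by move=> w g /qU[h <-]; rewrite (from_zero h c0) lcomp0l.
Qed.

End SerreAbelian.

(** * The universal homology satisfying the point axiom *)

Lemma homology_isomorphic (R : comPzRingType) (C : category) (A : ab_category R)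
    (X Y : homologies C A) (c : forall i x, mor (X i x) (Y i x)) :
  (forall i x y (f : mor x y), c i y \oc fmap (X i) f = fmap (Y i) f \oc c i x) ->
  (forall i x, is_iso (c i x)) -> isomorphic X Y.
Proof.
move=> cN ci; exists (fun i => NatTrans (cN i)).
by apply: pow_iso => i; apply: nat_iso.
Qed.

Lemma homology_isomorphicE (R : comPzRingType) (C : category) (A : ab_category R)
    (X Y : homologies C A) : isomorphic X Y ->
  exists c : forall i x, mor (X i x) (Y i x),
    (forall i x y (f : mor x y), c i y \oc fmap (X i) f = fmap (Y i) f \oc c i x) /\
    (forall i x, is_iso (c i x)).
Proof.
move=> [c /pow_iso_at ci]; exists (fun i x => ntc (c i) x); split=> [i x y f | i x].
  exact: (ntP (c i : nat_trans (X i) (Y i)) f).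
exact: (@nat_iso_at C A (X i) (Y i) (c i) (ci i) x).
Qed.

Lemma hlg_push_isomorphic (R : comPzRingType) (C : category) (A B : ab_category R)
    (X Y : homologies C A) (G : functor A B) :
  isomorphic X Y -> isomorphic (hlg_push X G) (hlg_push Y G).
Proof.
move=> /homology_isomorphicE[c [cN ci]].
apply: (@homology_isomorphic _ _ _ (hlg_push X G) (hlg_push Y G)
  (fun i x => fmap G (c i x))).
  move=> i x y f; rewrite -[LHS](fmapM G (c i y) (fmap (X i) f)) cN.
  exact: (fmapM G).
by move=> i x; apply: (functor_iso G (ci i x)).
Qed.

Lemma hlg_push_comp (R : comPzRingType) (C : category) (A B D : ab_category R)
    (X : homologies C A) (G : functor A B) (G' : functor B D) :
  isomorphic (hlg_push (hlg_push X G) G') (hlg_push X (G' \of G)).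
Proof.
apply: (@homology_isomorphic _ _ _ (hlg_push (hlg_push X G) G') (hlg_push X (G' \of G))
  (fun i x => idm (G' (G (X i x))))).
  by move=> i x y f; rewrite comp1m compm1.
by move=> i x; apply: iso_id.
Qed.

Lemma hlg_push_id (R : comPzRingType) (C : category) (A : ab_category R)
    (X : homologies C A) :
  isomorphic (hlg_push X (id_functor A)) X.
Proof.
apply: (@homology_isomorphic _ _ _ (hlg_push X (id_functor A)) X
  (fun i x => idm (X i x))).
  by move=> i x y f; rewrite comp1m compm1.
by move=> i x; apply: iso_id.
Qed.

Section ExactFunctorFacts.
Context (R : comPzRingType).

Lemma id_exact (A : ab_category R) : is_exact_linear (id_functor A).
Proof. by split. Qed.

Lemma comp_exact (A B D : ab_category R) (G : functor B D) (F : functor A B) :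
  is_exact_linear G -> is_exact_linear F -> is_exact_linear (G \of F).
Proof.
move=> Gex Fex; split; first exact: comp_linear Gex.1 Fex.1.
by move=> x y z f g /(Fex.2 _ _ _)/(Gex.2 _ _ _).
Qed.

(** Makes the kernel of an exact functor available as a test subcategory [T] in [point_thick]. *)
Lemma exact_kernel_thick (A B : ab_category R) (G : functor A B) : is_exact_linear G ->
  is_thick (fun x : A => is_zero_object (G x)).
Proof.
move=> Gex; split.
- exact: exact_zero_object.
- move=> x y f /monoP/(exact_monic Gex) fm /zero_objectP y0; apply/zero_objectP/fm.
  exact: to_zero.
- move=> x y f /epiP/(exact_epic Gex) fm /zero_objectP y0; apply/zero_objectP/fm.
  exact: from_zero.
- move=> x y z f g /short_exactP[fg _] /zero_objectP x0 /zero_objectP z0;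
  apply/zero_objectP.
  have [_ _ fU] := exact_preserves_kernel Gex fg.
  have [|h <-] := fU _ (lidm (G y)); first exact: to_zero.
  by rewrite (to_zero h x0) lcomp0r.
Qed.

End ExactFunctorFacts.

(** * Localizations composed with an equivalence *)

Section LocalizationTransport.
Context (C D D' : category) (W : morphism_class C) (Q : functor C D) (Th : functor D D').

Lemma localization_equivalence :
  is_localization W Q -> is_equivalence Th -> is_localization W (Th \of Q).
Proof.
move=> [QW Qloc] Theq; have [Thfa Thfu Thes] := ff_of_equivalence Theq.
exists (inverts_comp Th QW) => E.
have [Qfa Qfu Qes] := ff_of_equivalence (Qloc E).
apply: equivalence_of_ff.
- move=> G G' b b' bb'.
  pose w (c : nat_trans G G') : mor (c := fun_cat D E) (G \of Th)
    (G' \of Th) := nat_whiskr c Th.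
  have wE : w b = w b'.
    apply: Qfa; apply: nat_trans_eq => x.
    exact: (congr1 (fun c : nat_trans (G \of (Th \of Q)) (G' \of (Th \of Q)) => ntc c x)
      bb').
  apply: nat_trans_eq => y; have [x [e ei]] := Thes y.
  apply: iso_epi (functor_iso G ei) _ _ _ _.
  rewrite !ntP; congr (_ \oc _).
  exact: (congr1 (fun c : nat_trans (G \of Th) (G' \of Th) => ntc c x) wE).
- move=> G G' b.
  (* The two bracketings of the composite functors have the same components but different proofs of
     functoriality, so the transformation is rebuilt from its components. *)
  pose b1 x : mor ((G \of Th \of Q) x) ((G' \of Th \of Q) x) := ntc b x.
  have b1N x y (f : @mor C x y) :
    b1 y \oc fmap (G \of Th \of Q) f = fmap (G' \of Th \of Q) f \oc b1 x := ntP b f.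
  pose b0 := @NatTrans C E (G \of Th \of Q) (G' \of Th \of Q) b1 b1N.
  have [c cE] := Qfu (G \of Th) (G' \of Th) b0.
  pose c1 x : mor (G (Th x)) (G' (Th x)) := ntc c x.
  have cN x y (f : @mor D x y) : c1 y \oc fmap G (fmap Th f) = fmap G' (fmap Th f) \oc
      c1 x.
    exact: (ntP c f).
  (* Prescribing [h] against every [e] from some [Th x], and not only against one isomorphism, makes
     the choice of preimage irrelevant and naturality formal. *)
  have ex y : exists h : mor (G y) (G' y),
    forall x (e : mor (Th x) y), h \oc fmap G e = fmap G' e \oc c1 x.
    have [x [e ei]] := Thes y; have [e' [e'e ee']] := ei.
    exists (fmap G' e \oc c1 x \oc fmap G e') => x' f.
    have [g gE] := Thfu x' x (e' \oc f).
    have fE : f = e \oc fmap Th g by rewrite gE compA ee' comp1m.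
    rewrite -compA -fmapM -gE -compA cN compA -fmapM.
    by rewrite -fE.
  pose h y := sval (cid (ex y)).
  have hP y x (e : mor (Th x) y) : h y \oc fmap G e = fmap G' e \oc c1 x.
    exact: (svalP (cid (ex y)) x e).
  have hN y z (g : mor y z) : h z \oc fmap G g = fmap G' g \oc h y.
    have [x [e ei]] := Thes y; apply: iso_epi (functor_iso G ei) _ _ _ _.
    by rewrite -!compA hP -fmapM hP compA -fmapM.
  exists (@NatTrans _ _ G G' h hN); apply: nat_trans_eq => x /=.
  have := hP (Th (Q x)) (Q x) (idm _); rewrite !fmap1 compm1 comp1m => ->.
  exact: (congr1 (fun k : nat_trans (G \of Th \of Q) (G' \of Th \of Q) => ntc k x) cE).
move=> F; have [K [k ki]] := Qes F; have [P [PTh ThP]] := Theq.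
have [n /nat_iso_at ni] := PTh.
exists (K \of P : fun_cat D' E); apply/full_sub_isomorphic.
apply: (@nat_isomorphic C E (K \of P \of (Th \of Q)) (sval F)
  (fun x => (ntc k x : mor (K (Q x)) (sval F x)) \oc fmap K (ntc n (Q x)))).
  move=> x y f.
  have /= N1 := ntP n (fmap Q f); have /= N2 := ntP k f.
  by rewrite /= -compA -fmapM N1 fmapM compA N2 compA.
move=> x; apply: iso_comp; last by apply: functor_iso; apply: ni.
have [k' [E1 E2]] := ki.
by apply: (@nat_iso_at C E (K \of Q) (sval F) k); exists k'.
Qed.

End LocalizationTransport.

Section PointQuotient.
Context (R : comPzRingType) (C : point_category) (A : ab_category R) (U : homologies C A).
Hypothesis Uuniv : universal_homology U.

(** The intersection of all thick subcategories containing the objects to be killed; membership is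
    used by instantiating [T]. *)
Definition point_thick (x : A) : Prop := forall T : A -> Prop, is_thick T ->
  (forall i (k : pidx C), i != 0 -> T (U i (pobj k))) -> T x.

Lemma point_thickP : is_thick point_thick.
Proof.
split.
- by move=> x x0 T Tth _; apply: (thick_zero Tth).
- by move=> x y f fm yT T Tth TU; apply: (thick_sub Tth fm); apply: yT.
- by move=> x y f fm xT T Tth TU; apply: (thick_quo Tth fm); apply: xT.
- by move=> x y z f g fg xT zT T Tth TU; apply: (thick_ext Tth fg);
  [apply: xT | apply: zT].
Qed.

Definition point_ab : ab_category R := serre_ab point_thickP.

Let Q : functor A point_ab := serre_functor point_thickP.

Lemma point_homology_axiom : point_axiom (A := point_ab) (hlg_push U Q).
Proof.
move=> i k i0; apply/(zero_objectP (A := point_ab)).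
rewrite -[LHS](spi1 point_thickP); apply/spi_eq0.
rewrite -[lidm _]lcomp1m; apply/(thick_null_image point_thickP (@epic_id _ _ _)
  (@monic_id _ _ _)).
by move=> T Tth TU; apply: TU.
Qed.

Definition point_homology : point_homologies C point_ab := exist _ _ point_homology_axiom.

Lemma point_homology_universal : universal_point_homology point_homology.
Proof.
move=> A'; have [Ufa Ufu Ues] := ff_of_equivalence (Uuniv A').
have Qex := serre_functor_exact point_thickP.
have [QW Qloc] := serre_localization point_thickP.
pose res (K : ex_cat point_ab A') : ex_cat A A' := exist _ (sval K \of Q)
  (comp_exact (svalP K) Qex).
apply: equivalence_of_ff.
- move=> K K' b b' bb'.
  pose w (c : nat_trans (sval K) (sval K')) : mor (res K) (res K') := nat_whiskr c Q.
  have wE : w b = w b'.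
    apply: Ufa; apply: functional_extensionality_dep => i; apply: nat_trans_eq => x.
    exact: (congr1 (fun c : mor (c := homologies C A') (hlg_push (sval point_homology)
      (sval K))
      (hlg_push (sval point_homology) (sval K')) => ntc (c i) x) bb').
  apply: nat_trans_eq => x.
  exact: (congr1 (fun c : nat_trans (sval K \of Q) (sval K' \of Q) => ntc c x) wE).
- move=> K K' b.
  pose b1 i x : mor ((sval K \of Q \of U i) x) ((sval K' \of Q \of U i) x) := ntc (b i) x.
  have b1N i x y (f : @mor C x y) :
    b1 i y \oc fmap (sval K \of Q \of U i) f = fmap (sval K' \of Q \of U i) f \oc b1 i x.
    exact: (ntP (b i) f).
  pose b0 : mor (c := homologies C A') (hlg_push U (sval K \of Q))
    (hlg_push U (sval K' \of Q)) :=
    fun i => @NatTrans C A' (sval K \of Q \of U i) (sval K' \of Q \of U i) (b1 i) (b1N i).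
  have [c cE] := Ufu (res K) (res K') b0.
  have [_ Lfu _] := ff_of_equivalence (Qloc A').
  have [d dE] := Lfu (sval K) (sval K') c.
  exists d; apply: functional_extensionality_dep => i; apply: nat_trans_eq => x.
  have := congr1 (fun k : nat_trans (sval K \of Q) (sval K' \of Q) => ntc k (U i x)) dE.
  move=> /= ->.
  exact: (congr1 (fun k : mor (c := homologies C A') (hlg_push U (sval K \of Q))
    (hlg_push U (sval K' \of Q))
    => ntc (k i) x) cE).
move=> [H HP]; have [[G Gex] GU] := Ues H.
have [c [cN ci]] := homology_isomorphicE GU.
have GW : inverts (iso_mod (A := A) point_thick) G.
  apply: (exact_inverts point_thickP Gex) => x xT.
  (* The kernel of [G] is thick and contains the generators because [H] satisfies the point axiom,
     so [G] kills all of [point_thick]. *)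
  apply: (xT (fun y => is_zero_object (G y))); first exact: exact_kernel_thick.
  move=> i k i0; have /zero_objectP H0 := HP i k i0; apply/zero_objectP.
  apply: (zero_isomorphic H0); apply: isomorphic_sym; exists (c i (pobj k)).
  exact: (ci i (pobj k)).
have Kex : is_exact_linear (serre_lift point_thickP GW : functor point_ab A').
  apply: serre_lift_exact; split.
    by move=> x y a f g; rewrite /= !serre_lift_pi; apply: Gex.1.
  by move=> x y z f g fg; rewrite /= !serre_lift_pi; apply: Gex.2.
exists (exist _ (serre_lift point_thickP GW : functor point_ab A') Kex).
apply: (@homology_isomorphic R C A'
  (hlg_push (hlg_push U Q) (serre_lift point_thickP GW : functor point_ab A')) H c) =>
    // i x y f.
by rewrite /= serre_lift_pi; apply: cN.
Qed.

End PointQuotient.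

(** Each universal property yields a functor towards the other category. A composite of the two
    fixes the universal homology up to isomorphism, as does the identity, and evaluation at that
    homology is fully faithful. *)
Lemma universal_point_comparison (R : comPzRingType) (C : point_category)
    (A1 A2 : ab_category R) (H1 : point_homologies C A1) (H2 : point_homologies C A2) :
  universal_point_homology H1 -> universal_point_homology H2 ->
  exists Th : functor A1 A2, [/\ is_exact_linear Th, is_equivalence Th &
    isomorphic (C := homologies C A2) (hlg_push (sval H1) Th) (sval H2)].
Proof.
move=> u1 u2.
have [_ _ /(_ H2)[[F Fex] FH]] := ff_of_equivalence (u1 A2).
have [_ _ /(_ H1)[[G Gex] GH]] := ff_of_equivalence (u2 A1).
have retract (A : ab_category R) (H : point_homologies C A)
    (u : universal_point_homology H)
    (K : functor A A) : is_exact_linear K ->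
    isomorphic (C := homologies C A) (hlg_push (sval H) K) (sval H) ->
    isomorphic (C := fun_cat A A) K (id_functor A).
  move=> Kex KH; have [fa fu _] := ff_of_equivalence (u A).
  pose K0 : ex_cat A A := exist _ K Kex.
  pose I0 : ex_cat A A := exist _ (id_functor A) (id_exact A).
  have KI : isomorphic (point_eval A H K0) (point_eval A H I0).
    apply/full_sub_isomorphic.
    exact: isomorphic_trans KH (isomorphic_sym (hlg_push_id (sval H))).
  exact: ((full_sub_isomorphic K0 I0).1 (ff_isomorphic fa fu KI)).
have FH' : isomorphic (C := homologies C A2) (hlg_push (sval H1) F)
    (sval H2) := (full_sub_isomorphic _ _).1 FH.
have GH' : isomorphic (C := homologies C A1) (hlg_push (sval H2) G)
    (sval H1) := (full_sub_isomorphic _ _).1 GH.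
exists F; split; [exact: Fex | exists G; split | exact: FH'].
  apply: (retract A1 H1 u1); first exact: comp_exact.
  apply: isomorphic_trans (isomorphic_sym (hlg_push_comp (sval H1) F G)) _.
  exact: (isomorphic_trans (hlg_push_isomorphic G FH') GH').
apply: (retract A2 H2 u2); first exact: comp_exact.
apply: isomorphic_trans (isomorphic_sym (hlg_push_comp (sval H2) G F)) _.
exact: (isomorphic_trans (hlg_push_isomorphic F GH') FH').
Qed.

Lemma hlg_pull_point_axiom (R : comPzRingType) (C D : point_category) (F : functor C D)
    (A : ab_category R) (H : homologies D A) :
  preserves_points F -> point_axiom H -> point_axiom (C := C) (hlg_pull F H).
Proof. by move=> Fp HP i k i0; rewrite /hlg_pull /=; have [l ->] := Fp k; apply: HP. Qed.

Theorem proposition3p1p7 (R : comPzRingType) :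
  (forall C : point_category,
     exists (Apt : ab_category R) (H : point_homologies C Apt),
       universal_point_homology H /\
       forall (A : ab_category R) (U : homologies C A),
         universal_homology U ->
         exists pi : functor A Apt,
           is_quotient pi /\
           isomorphic (C := homologies C Apt) (hlg_push U pi) (sval H)) /\
  (forall (C D : point_category) (F : functor C D),
     preserves_points F ->
     forall (AC : ab_category R) (HC : point_homologies C AC)
            (AD : ab_category R) (HD : point_homologies D AD),
       universal_point_homology HC -> universal_point_homology HD ->
       exists rF : ex_cat AC AD,
         isomorphic (C := homologies C AD)
           (hlg_push (sval HC) (sval rF)) (hlg_pull F (sval HD)) /\
         forall r : ex_cat AC AD,
           isomorphic (C := homologies C AD)
             (hlg_push (sval HC) (sval r)) (hlg_pull F (sval HD)) ->
           isomorphic r rF).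
Proof.
split=> [C | C D F Fp AC HC AD HD uC uD].
  have Uuniv := @univ_homologyP R C.
  have u0 := point_homology_universal Uuniv.
  exists (point_ab (univ_homology R C)), (point_homology (univ_homology R C)); split=>
    // A U uU.
  (* The point quotient built from the given [U] is universal as well, hence equivalent to the fixed
     one; the projection to the former followed by this equivalence is the required quotient
     functor. *)
  have [Th [Thex Theq ThH]] := universal_point_comparison (point_homology_universal uU)
    u0.
  exists (Th \of serre_functor (point_thickP U)); split.
    exists (point_thick U); split; first exact: point_thickP; split.
      exact: comp_exact Thex (serre_functor_exact _).
    exact: localization_equivalence (serre_localization _) Theq.
  exact: isomorphic_trans (isomorphic_sym (hlg_push_comp _ _ _)) ThH.
(* Pulled back along [F], the homology [HD] still satisfies the point axiom, so it lies in the
   essential image of evaluation at [HC]; uniqueness comes from full faithfulness. *)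
have [fa fu /(_ (exist _ _ (hlg_pull_point_axiom Fp (svalP HD))))[r rH]] :=
  ff_of_equivalence (uC AD).
have rH' := (full_sub_isomorphic _ _).1 rH.
exists r; split=> [|r' r'H]; first exact: rH'.
apply/(ff_isomorphic fa fu)/full_sub_isomorphic.
exact: isomorphic_trans r'H (isomorphic_sym rH').
Qed.
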